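(* Let $f$ be a transcendental meromorphic function in $\mathbb{C}$, and let $\varphi(z)\not\equiv 0,\infty$ be a small function of $f$. Suppose that every pole of $f$ has multiplicity at least $l$, where $l\ge 1$ is an integer, and let $k\ge 1$, $q_0\ge 1+\frac{2}{l}$, $q_i\ge 0$ $(i=1,2,\ldots,k-1)$, $q_k\ge 1$ be integers. Let $a(z)\not\equiv 0,\infty$ be a small function of $f$, and put $M[f]=a(z)(f)^{q_0}(f')^{q_1}\cdots(f^{(k)})^{q_k}$. Then $$T(r,f)\le \frac{l}{lq_0-l-1}N\left(r,\frac{1}{M[f]-\varphi(z)}\right)+S(r,f).$$
   Context: Standard notation of Nevanlinna theory is used: $T(r,f)$ is the Nevanlinna characteristic, and $N\left(r,\frac{1}{M[f]-\varphi}\right)$ is the integrated counting function of the zeros of $M[f]-\varphi$ counted with multiplicity. $S(r,f)$ denotes any quantity satisfying $S(r,f)=o(T(r,f))$ as $r\to\infty$, $r\notin E$, where $E$ is a set of positive real numbers of finite linear (Lebesgue) measure, not necessarily the same at each occurrence. A meromorphic function $b(z)\not\equiv 0,\infty$ is a small function of (with respect to) $f$ if $T(r,b)=S(r,f)$. *)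

(* Defs.v *)
From HB Require Import structures.
From mathcomp Require Export all_boot all_order all_algebra.
From mathcomp Require Export complex.
From mathcomp Require Export all_classical all_reals all_analysis.
Export Order.TTheory GRing.Theory Num.Theory.
Export numFieldNormedType.Exports.

Set Implicit Arguments.
Unset Strict Implicit.
Unset Printing Implicit Defensive.

Local Open Scope classical_set_scope.
Local Open Scope ring_scope.

(* The library puts its topology and derivatives on an abstract numFieldType;
   these notions are used at C := R[i], where complex differentiability in a
   neighbourhood is holomorphy. *)
Definition holomorphic_at (C : numFieldType) (f : C -> C) (z0 : C) : Prop :=
  \forall z \near z0, derivable f z 1.

(* The order is read off a punctured neighbourhood, so it does not depend on
   the value that the total function f happens to take at z0.  No n works when
   f vanishes identically near z0. *)
Definition has_order (C : numFieldType) (f : C -> C) (z0 : C) (n : int) :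
    Prop :=
  exists g : C -> C,
    [/\ holomorphic_at g z0, g z0 != 0 &
        \forall z \near z0^', f z = (z - z0) ^ n * g z].

(* Multiplicities are 0 at points that are not a zero (resp. a pole). *)
Definition zero_mult (C : numFieldType) (f : C -> C) (z : C) : nat :=
  xget 0%N [set m : nat | has_order f z m%:Z].

Definition pole_mult (C : numFieldType) (f : C -> C) (z : C) : nat :=
  xget 0%N [set m : nat | has_order f z (- m%:Z)].

(* Meromorphic in the whole plane: holomorphic except for poles.  The value of
   the total function f at a pole is arbitrary: multiplicities ignore it, and
   it affects the proximity integral on a null set only. *)
Definition meromorphic (C : numFieldType) (f : C -> C) : Prop :=
  forall z : C, holomorphic_at f z \/ (0 < pole_mult f z)%N.

Definition rational_function (C : numFieldType) (f : C -> C) : Prop :=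
  exists p q : {poly C},
    q != 0 /\ forall z : C, q.[z] != 0 -> f z = p.[z] / q.[z].

Definition transcendental (C : numFieldType) (f : C -> C) : Prop :=
  ~ rational_function f.

(* n(t): number of points in the closed disc |z| <= t, weighted by mult.  A sum
   over an infinite support would be 0, but the zeros (of finite order) and
   poles of a meromorphic function are finite in number in every disc. *)
Definition unintegrated_counting (R : realType) (mult : R[i] -> nat) (t : R) : R :=
  \sum_(z \in [set z | Normc.normc z <= t]) ((mult z)%:R : R).

Definition integrated_counting (R : realType) (mult : R[i] -> nat) (r : R) : R :=
  let n := unintegrated_counting mult in
  (\int[lebesgue_measure]_(t in `]0, r]) ((n t - n 0) / t)) + n 0 * ln r.

(* N(r, f) *)
Definition counting_poles (R : realType) (r : R) (f : R[i] -> R[i]) : R :=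
  integrated_counting (pole_mult f) r.

(* N(r, 1/f) *)
Definition counting_zeros (R : realType) (r : R) (f : R[i] -> R[i]) : R :=
  integrated_counting (zero_mult f) r.

(* At x = 0 the library's convention ln 0 = 0 gives the expected value 0. *)
Definition logplus (R : realType) (x : R) : R := Num.max 0 (ln x).

Definition proximity (R : realType) (r : R) (f : R[i] -> R[i]) : R :=
  (2 * pi)^-1 *
  (\int[lebesgue_measure]_(t in `[0%R, (2 * pi)%R])
     logplus (Normc.normc (f (Complex (r * cos t) (r * sin t)))))%R.

Definition characteristic (R : realType) (r : R) (f : R[i] -> R[i]) : R :=
  proximity r f + counting_poles r f.

(* s(r) = S(r, f), i.e. s is little-o of T(r, f) as r -> +oo with r not in E. *)
Definition is_S (R : realType) (f : R[i] -> R[i]) (s : R -> R) : Prop :=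
  exists E : set R,
    [/\ measurable E, E `<=` [set r | 0 < r],
        (lebesgue_measure E < +oo)%E &
        forall eps : R, 0 < eps ->
          \forall r \near +oo,
            ~ E r -> `|s r| <= eps * `|characteristic r f|].

(* b is not identically infinity because it is meromorphic. *)
Definition small_function (R : realType) (f b : R[i] -> R[i]) : Prop :=
  [/\ meromorphic b, exists z, b z != 0 & is_S f (fun r => characteristic r b)].

Definition diff_monomial (C : numFieldType) (k : nat) (q : nat -> nat)
    (a f : C -> C) (z : C) : C :=
  a z * \prod_(0 <= j < k.+1) derive1n j f z ^+ q j.

(* Main.v *)
(** Write G = M[f]/phi, gamma = q_0 + ... + q_k and W = M[f]/f^gamma, so that
    f^(-gamma) = (W/phi) (1 - (G'/G) ((G - 1)/G')).  By the lemma on the logarithmic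
    derivative W/phi and G'/G have small proximity functions, hence gamma m(r, 1/f) is at most
    m(r, (G - 1)/G') + S(r, f).  Jensen's formula for (G - 1)/G' turns this proximity function
    into the counting function of the divisor of (G - 1)/G', the proximity of the inverse being
    again that of a logarithmic derivative.  Pointwise, this divisor plus gamma times the zeros
    of f is at most the zeros of M[f] - phi, plus gamma - q_0 + 1 times the zeros of f, plus the
    distinct poles of f (at most N(r, f)/l), plus zeros and poles of the small functions.  With
    m(r, 1/f) + N(r, 1/f) = T(r, f) + O(1) this is the claim.

    Since an exceptional set is allowed, only circles free of zeros, poles and arbitrary values
    are ever used, so all integrands are continuous.  Jensen's formula and the logarithmic
    derivative come from dividing out Blaschke factors and, for a zero-free g, from the Cauchy
    kernel representation of g'/g by log |g|.  The logarithmic derivative is bounded pointwise,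
    outside small intervals around the moduli of the zeros and poles. *)

Require Import Defs.
From mathcomp Require Import ring lra.
From mathcomp Require finmap.

Set Implicit Arguments.
Unset Strict Implicit.
Unset Printing Implicit Defensive.
Import Normc.
Local Notation Re := complex.Re.
Local Notation Im := complex.Im.

Local Open Scope classical_set_scope.
Local Open Scope ring_scope.
Local Open Scope complex_scope.

(** * Complex numbers and circle integrals *)

Section ComplexPlane.
Variable R : realType.
Notation C := (R[i] : numFieldType).
Implicit Types (z w : C) (x y e : R).

(** Two facts make the plan work and need their own proofs. First, G must not be constant, or (G -
    1)/G' is meaningless; if it were, both m(r, 1/f) and N(r, 1/f) would be small, against the first
    main theorem. Second, the logarithmic derivative costs log r + log T, so log r must be o(T(r,
    f)). This is where f being transcendental matters most; the same hypothesis keeps every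
    derivative of f from vanishing identically. Three obstacles shape the code. Functions are total
    and take arbitrary values at poles, so identities live on punctured neighbourhoods and orders
    replace values. No branch of a complex logarithm is chosen: log |g| is differentiated as a real
    function along circles, and a primitive of g'/g stands in for log g. Monotonicity of T in r is
    never available, so growth arguments go through infima over good radii. All error terms are
    bounded from above only. This suffices because the final S is the positive part of the
    difference of the two sides. *)

Lemma normc_norm z : `|z| = (normc z)%:C.
Proof. by case: z. Qed.

Lemma normc_ge0 z : 0 <= normc z.
Proof. by case: z => a b; rewrite sqrtr_ge0. Qed.

Lemma normc_eq0 z : (normc z == 0) = (z == 0).
Proof.
by apply/eqP/eqP => [/eq0_normc // | ->]; rewrite (normc0 R).
Qed.

Lemma normc_gt0 z : (0 < normc z) = (z != 0).
Proof. by rewrite lt_def normc_ge0 andbT normc_eq0. Qed.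

Lemma normcR x : normc (x%:C : C) = `|x|.
Proof. by rewrite /= expr0n /= addr0 sqrtr_sqr. Qed.

Lemma normcD z w : normc (z + w) <= normc z + normc w.
Proof. by have := ler_normD z w; rewrite !normc_norm -rmorphD lecR. Qed.

Lemma normcN z : normc (- z) = normc z.
Proof. by case: z => a b /=; rewrite !sqrrN. Qed.

Lemma normcBC z w : normc (z - w) = normc (w - z).
Proof. by rewrite -normcN opprB. Qed.

Lemma normcB_le z w : normc (z - w) <= normc z + normc w.
Proof. by rewrite -(normcN w) normcD. Qed.

Lemma ler_normcB z w : normc z - normc w <= normc (z - w).
Proof. by rewrite lerBlDr; have := normcD (z - w) w; rewrite subrK. Qed.

Lemma normcX z n : normc (z ^+ n) = normc z ^+ n.
Proof.
by elim: n => [|n IH]; [rewrite !expr0 (normc1 R)|rewrite !exprS normcM IH].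
Qed.

Lemma normc_Re z : `|Re z| <= normc z.
Proof.
case: z => a b /=; rewrite -sqrtr_sqr ler_sqrt ?addr_ge0 ?sqr_ge0 //.
by rewrite lerDl sqr_ge0.
Qed.

Lemma normc_Im z : `|Im z| <= normc z.
Proof.
case: z => a b /=; rewrite -sqrtr_sqr ler_sqrt ?addr_ge0 ?sqr_ge0 //.
by rewrite lerDr sqr_ge0.
Qed.

Lemma normc_ReIm z : normc z <= `|Re z| + `|Im z|.
Proof.
case: z => a b /=; rewrite -[leRHS]ger0_norm ?addr_ge0 // -sqrtr_sqr.
rewrite ler_sqrt ?sqr_ge0 // sqrrD !real_normK ?num_real //.
by rewrite lerD2r lerDl mulrn_wge0 // mulr_ge0.
Qed.

Lemma normc_conj z : normc (conjc z) = normc z.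
Proof. by case: z => a b /=; rewrite sqrrN. Qed.

Lemma conjcM z w : conjc (z * w) = conjc z * conjc w.
Proof.
case: z w => a b [c d].
by apply/eqP; rewrite eq_complex /=; apply/andP; split; apply/eqP; ring.
Qed.

Lemma conjcB z w : conjc (z - w) = conjc z - conjc w.
Proof.
case: z w => a b [c d].
by apply/eqP; rewrite eq_complex /=; apply/andP; split; apply/eqP; ring.
Qed.

Lemma mulc_conj z : z * conjc z = (normc z ^+ 2)%:C.
Proof.
case: z => a b; rewrite sqr_sqrtr ?addr_ge0 ?sqr_ge0 //.
by apply/eqP; rewrite eq_complex /=; apply/andP; split; apply/eqP; ring.
Qed.

Lemma nbhsCP z (P : set C) :
  (\forall w \near z, P w) <->
  exists e, 0 < e /\ forall w, normc (w - z) < e -> P w.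
Proof.
split=> [/nbhs_ballP [e /= e0 h] | [e [e0 h]]].
  have e1 : e = (Re e)%:C by rewrite (RRe_real (gtr0_real e0)).
  exists (Re e); split; first by rewrite -ltcR -e1.
  move=> w hw; apply: h; rewrite /ball /= normc_norm normcBC e1.
  by rewrite ltcR.
apply/nbhs_ballP; exists e%:C => /=; first by rewrite ltcR.
by move=> w; rewrite /ball /= normc_norm normcBC ltcR; apply: h.
Qed.

Lemma dnbhsCP z (P : set C) :
  (\forall w \near z^', P w) <->
  exists e, 0 < e /\ forall w, w != z -> normc (w - z) < e -> P w.
Proof.
split=> [/nbhsCP [e [e0 h]] | [e [e0 h]]].
  by exists e; split => // w wz hw; exact: h.
by apply/nbhsCP; exists e; split => // w hw wz; exact: h.
Qed.

Lemma cvgCP (T : Type) (F : set_system T) {FF : Filter F} (f : T -> C) (l : C) :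
  f @ F --> l <-> forall e, 0 < e -> \forall t \near F, normc (f t - l) < e.
Proof.
split=> [/cvgrPdist_lt h e e0 | h].
  have : 0 < e%:C :> C by rewrite ltcR.
  move=> /h; apply: filterS => t.
  by rewrite normc_norm normcBC ltcR.
apply/cvgrPdist_lt => e e0.
have e1 : e = (Re e)%:C by rewrite (RRe_real (gtr0_real e0)).
have : 0 < Re e by rewrite -ltcR -e1.
move=> /h; apply: filterS => t.
by rewrite normc_norm normcBC e1 ltcR.
Qed.

Lemma cvg_Re (T : Type) (F : set_system T) {FF : Filter F} (f : T -> C) (l : C) :
  f @ F --> l -> (fun t => Re (f t)) @ F --> Re l.
Proof.
move=> /cvgCP h; apply/cvgrPdistC_lt => e /h; apply: filterS => t.
by apply: le_lt_trans; rewrite -raddfB; exact: normc_Re.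
Qed.

Lemma cvg_Im (T : Type) (F : set_system T) {FF : Filter F} (f : T -> C) (l : C) :
  f @ F --> l -> (fun t => Im (f t)) @ F --> Im l.
Proof.
move=> /cvgCP h; apply/cvgrPdistC_lt => e /h; apply: filterS => t.
by apply: le_lt_trans; rewrite -raddfB; exact: normc_Im.
Qed.

Lemma cvg_Complex (T : Type) (F : set_system T) {FF : Filter F} (f g : T -> R) x y :
  f @ F --> x -> g @ F --> y ->
  (fun t => (f t +i* g t : C)) @ F --> (x +i* y : C).
Proof.
move=> /cvgrPdistC_lt hf /cvgrPdistC_lt hg; apply/cvgCP => e e0.
have e2 : 0 < e / 2 by rewrite divr_gt0.
near=> t; apply: le_lt_trans (normc_ReIm _) _ => /=.
rewrite (splitr e) ltrD //; near: t; [exact: hf|exact: hg].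
Unshelve. all: by end_near. Qed.

Lemma cvg_normc (T : Type) (F : set_system T) {FF : Filter F} (f : T -> C) (l : C) :
  f @ F --> l -> (fun t => normc (f t)) @ F --> normc l.
Proof.
move=> /cvgCP h; apply/cvgrPdistC_lt => e /h; apply: filterS => t.
apply: le_lt_trans; rewrite ler_norml ler_normcB andbT lerNl opprB normcBC.
exact: ler_normcB.
Qed.

Lemma cvg_RC (T : Type) (F : set_system T) {FF : Filter F} (f : T -> R) x :
  f @ F --> x -> (fun t => ((f t)%:C : C)) @ F --> (x%:C : C).
Proof. by move=> h; apply: cvg_Complex => //; exact: cvg_cst. Qed.

Lemma cvg_conjc (T : Type) (F : set_system T) {FF : Filter F} (f : T -> C) (l : C) :
  f @ F --> l -> (fun t => (conjc (f t) : C)) @ F --> (conjc l : C).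
Proof.
move=> /cvgCP h; apply/cvgCP => e /h; apply: filterS => t.
by rewrite -rmorphB normc_conj.
Qed.

Section ContinuityAt.
Variable T : topologicalType.
Implicit Types (F G : T -> C) (p : T).

Lemma eq_cc p F G : F =1 G -> {for p, continuous F} -> {for p, continuous G}.
Proof. by move=> /funext ->. Qed.

Lemma cc_cst p (k : C) : {for p, continuous (fun _ : T => k)}.
Proof. exact: cvg_cst. Qed.

Lemma ccB p F G : {for p, continuous F} -> {for p, continuous G} ->
  {for p, continuous (fun t => F t - G t)}.
Proof. by move=> hF hG; exact: (cvgB hF hG). Qed.

Lemma ccM p F G : {for p, continuous F} -> {for p, continuous G} ->
  {for p, continuous (fun t => F t * G t)}.
Proof. by move=> hF hG; exact: (cvgM hF hG). Qed.

Lemma ccV p F : F p != 0 -> {for p, continuous F} ->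
  {for p, continuous (fun t => (F t)^-1)}.
Proof. by move=> h hF; exact: (cvgV h hF). Qed.

Lemma ccX p F n : {for p, continuous F} ->
  {for p, continuous (fun t => F t ^+ n)}.
Proof.
move=> hF; elim: n => [|n IH].
  by apply: (@eq_cc p (fun=> 1 : C)); [move=> t; rewrite expr0|exact: cc_cst].
apply: (@eq_cc p (fun t => F t * F t ^+ n)); first by move=> t; rewrite exprS.
exact: ccM hF IH.
Qed.

End ContinuityAt.

(** Continuity in the full topology of the line, endpoints included: every integrand is defined on
    all of [R], so no subspace topology has to be carried along. *)
Definition contin a b (F : R -> C) :=
  forall x, a <= x <= b -> {for x, continuous F}.

Definition continR a b (f : R -> R) :=
  forall x, a <= x <= b -> {for x, continuous f}.

Lemma continR_integrable a b (f : R -> R) : continR a b f ->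
  (@lebesgue_measure R).-integrable `[a, b] (EFin \o f).
Proof.
move=> cf; apply: continuous_compact_integrable; first exact: segment_compact.
by apply: continuous_in_subspaceT => x /[!inE]/=; rewrite in_itv /=; exact: cf.
Qed.

Lemma contin_Re a b F : contin a b F -> continR a b (fun x => Re (F x)).
Proof. by move=> h x /h; exact: cvg_Re. Qed.
Lemma contin_Im a b F : contin a b F -> continR a b (fun x => Im (F x)).
Proof. by move=> h x /h; exact: cvg_Im. Qed.

Definition rint a b (f : R -> R) : R := \int[lebesgue_measure]_(x in `[a, b]) f x.

Lemma rintD a b f g : continR a b f -> continR a b g ->
  rint a b (fun x => f x + g x) = rint a b f + rint a b g.
Proof. by move=> hf hg; apply: RintegralD => //; exact: continR_integrable. Qed.

Lemma rintB a b f g : continR a b f -> continR a b g ->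
  rint a b (fun x => f x - g x) = rint a b f - rint a b g.
Proof. by move=> hf hg; apply: RintegralB => //; exact: continR_integrable. Qed.

Lemma rintZ a b k f : continR a b f ->
  rint a b (fun x => k * f x) = k * rint a b f.
Proof. by move=> hf; apply: RintegralZl => //; exact: continR_integrable. Qed.

Lemma rint_cst a b k : a <= b -> rint a b (fun=> k) = (b - a) * k.
Proof.
move=> ab; rewrite /rint Rintegral_cst //= lebesgue_measure_itv /= lte_fin.
case: ltP => [_|ba]; first by rewrite /= mulrC.
have -> : a = b by apply/le_anti; rewrite ab ba.
by rewrite subrr /= mulr0 mul0r.
Qed.

Lemma rint_le a b f g : continR a b f -> continR a b g ->
  (forall x, a <= x <= b -> f x <= g x) -> rint a b f <= rint a b g.
Proof.
move=> hf hg h; apply: le_Rintegral => //; exact: continR_integrable.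
Qed.

Lemma eq_rint a b f g : (forall x, a <= x <= b -> f x = g x) ->
  rint a b f = rint a b g.
Proof.
by move=> h; apply: eq_Rintegral => x; rewrite inE /= in_itv; exact: h.
Qed.

Lemma rint_split a b c f : a <= b -> b <= c -> continR a c f ->
  rint a c f = rint a b f + rint b c f.
Proof.
move=> ab bc hf; have i1 := continR_integrable hf.
have : rint a c f - rint a b f =
    \int[lebesgue_measure]_(x in [set` Interval (BRight b) (BRight c)]) f x.
  by apply: Rintegral_itvB => //; rewrite bnd_simp.
rewrite Rintegral_itv_obnd_cbnd; first by rewrite -/(rint b c f) => <-; ring.
apply: integrableS i1 => // x /=; rewrite !in_itv /= => /andP[bx ->].
by rewrite (le_trans ab) // ltW.
Qed.

Lemma ler_norm_rint a b f k : a <= b -> continR a b f ->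
  (forall x, a <= x <= b -> `|f x| <= k) -> `|rint a b f| <= (b - a) * k.
Proof.
move=> ab hf h; rewrite ler_norml -mulrN -!rint_cst //.
by apply/andP; split; apply: rint_le => //; (try by move=> x _; exact: cvg_cst);
  move=> x /h; rewrite ler_norml => /andP[].
Qed.

Definition cint a b (F : R -> C) : C :=
  rint a b (fun x => Re (F x)) +i* rint a b (fun x => Im (F x)).

Lemma cintD a b F G : contin a b F -> contin a b G ->
  cint a b (fun x => F x + G x) = cint a b F + cint a b G.
Proof.
move=> hF hG; apply/eqP; rewrite eq_complex /=; apply/andP; split; apply/eqP;
 (rewrite -rintD; last 2 first);
 [exact: contin_Re|exact: contin_Re| |exact: contin_Im|exact: contin_Im| ];
 by apply: eq_rint => x _; rewrite raddfD.
Qed.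

Lemma cintZ a b k F : contin a b F ->
  cint a b (fun x => k * F x) = k * cint a b F.
Proof.
case: k => p q hF; have hR := contin_Re hF; have hI := contin_Im hF.
have cZ r f : continR a b f -> continR a b (fun x => r * f x).
  by move=> h x /h h1; apply: cvgM => //; exact: cvg_cst.
apply/eqP; rewrite eq_complex /= -!rintZ // -rintB -?rintD; try exact: cZ.
by apply/andP; split; apply/eqP; apply: eq_rint => x _; case: (F x).
Qed.

Lemma cintB a b F G : contin a b F -> contin a b G ->
  cint a b (fun x => F x - G x) = cint a b F - cint a b G.
Proof.
move=> hF hG.
have hG' : contin a b (fun x => -1 * G x).
  by move=> x /hG h; apply: (ccM _ h); exact: cc_cst.
have -> : (fun x => F x - G x) = (fun x => F x + -1 * G x).
  by apply/funext => x; rewrite mulN1r.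
by rewrite cintD // cintZ // mulN1r.
Qed.

Lemma cint_cst a b k : a <= b -> cint a b (fun=> k) = (b - a)%:C * k.
Proof.
move=> ab; rewrite /cint !rint_cst //; case: k => p q /=.
by apply/eqP; rewrite eq_complex /=; apply/andP; split; apply/eqP; ring.
Qed.

Lemma eq_cint a b F G : (forall x, a <= x <= b -> F x = G x) ->
  cint a b F = cint a b G.
Proof.
by move=> h; rewrite /cint; congr (_ +i* _); apply: eq_rint => x /h ->.
Qed.

Lemma cint_split a b c F : a <= b -> b <= c -> contin a c F ->
  cint a c F = cint a b F + cint b c F.
Proof.
move=> ab bc hF; apply/eqP; rewrite eq_complex /= -!rint_split ?eqxx //.
  exact: contin_Im.
exact: contin_Re.
Qed.

(** The factor 2 comes from bounding real and imaginary parts separately; it only affects constants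
    later on. *)
Lemma normc_cint a b F k : a <= b -> contin a b F ->
  (forall x, a <= x <= b -> normc (F x) <= k) ->
  normc (cint a b F) <= 2 * ((b - a) * k).
Proof.
move=> ab hF h; apply: le_trans (normc_ReIm _) _; rewrite mulr_natl mulr2n.
apply: lerD; apply: ler_norm_rint => //.
- exact: contin_Re.
- by move=> x /h; apply: le_trans; exact: normc_Re.
- exact: contin_Im.
- by move=> x /h; apply: le_trans; exact: normc_Im.
Qed.

Lemma ler_norm_rint_norm a b f : continR a b f ->
  `|rint a b f| <= rint a b (fun x => `|f x|).
Proof. by move=> hf; apply: le_normr_Rintegral => //; exact: continR_integrable. Qed.

Lemma normc_cint_le a b F : contin a b F ->
  normc (cint a b F) <= 2 * rint a b (fun x => normc (F x)).
Proof.
move=> hF; apply: le_trans (normc_ReIm _) _; rewrite mulr_natl mulr2n.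
have cn : continR a b (fun x => normc (F x)).
  by move=> x hx; exact: (cvg_normc (hF x hx)).
have cabs f : continR a b f -> continR a b (fun x => `|f x|).
  by move=> h x hx; exact: (cvg_norm (h x hx)).
have [hR hI] := (contin_Re hF, contin_Im hF).
apply: lerD.
  apply: le_trans (ler_norm_rint_norm hR) _.
  by apply: rint_le (cabs _ hR) cn _ => x _; exact: normc_Re.
apply: le_trans (ler_norm_rint_norm hI) _.
by apply: rint_le (cabs _ hI) cn _ => x _; exact: normc_Im.
Qed.

Lemma conj_cint a b F : contin a b F ->
  conjc (cint a b F) = cint a b (fun x => conjc (F x)).
Proof.
move=> hF; rewrite /cint /=; congr (_ +i* _).
  by apply: eq_rint => x _; case: (F x).
rewrite -mulN1r -rintZ; last exact: contin_Im.
by apply: eq_rint => x _; rewrite mulN1r; case: (F x).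
Qed.

End ComplexPlane.

Arguments normc {R} x : simpl never.
Arguments cint {R} a b F : simpl never.
Arguments rint {R} a b f : simpl never.

(** * Cauchy's theorem and Cauchy's formula *)

Section Goursat.
Variable R : realType.
Notation C := (R[i] : numFieldType).
Implicit Types (H : R -> R -> C) (a b c d s t e : R).

Definition ci (a b : R) : C := a +i* b.

(* Here H is read as a function of the complex coordinate s + i t. *)
Definition plane_diff H s t := exists D : C, forall e, 0 < e ->
  exists2 del, 0 < del & forall s' t', `|s' - s| < del -> `|t' - t| < del ->
    normc (H s' t' - H s t - D * ci (s' - s) (t' - t)) <=
      e * (`|s' - s| + `|t' - t|).

Lemma plane_diff_cont H s t : plane_diff H s t ->
  {for s, continuous (fun s' => H s' t)} /\ {for t, continuous (H s)}.
Proof.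
move=> [D hD]; have [del del0 h] := hD 1 ltr01.
have K0 : 0 < 1 + normc D by rewrite ltr_pwDl // normc_ge0.
have bnd s' t' : `|s' - s| < del -> `|t' - t| < del ->
    normc (H s' t' - H s t) <= (1 + normc D) * (`|s' - s| + `|t' - t|).
  move=> h1 h2; have := h _ _ h1 h2; rewrite mul1r => h3.
  rewrite -[X in normc X](subrK (D * ci (s' - s) (t' - t))).
  apply: le_trans (normcD _ _) _; rewrite mulrDl mul1r lerD // normcM.
  by apply: ler_wpM2l; [exact: normc_ge0|exact: normc_ReIm].
split; apply/cvgCP => e e0.
  near=> s'; have hs : `|s' - s| < Num.min del (e / (1 + normc D)).
    near: s'; apply: cvgr_distC_lt; first exact: cvg_id.
    by rewrite lt_min del0 divr_gt0.
  move: hs; rewrite lt_min => /andP[h1 h2].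
  apply: le_lt_trans (bnd _ _ h1 _) _; first by rewrite subrr normr0.
  by rewrite subrr normr0 addr0 mulrC -ltr_pdivlMr.
near=> s'; have hs : `|s' - t| < Num.min del (e / (1 + normc D)).
  near: s'; apply: cvgr_distC_lt; first exact: cvg_id.
  by rewrite lt_min del0 divr_gt0.
move: hs; rewrite lt_min => /andP[h1 h2].
apply: le_lt_trans (bnd _ _ _ h1) _; first by rewrite subrr normr0.
by rewrite subrr normr0 add0r mulrC -ltr_pdivlMr.
Unshelve. all: by end_near. Qed.

(** The contour integral of H d(s + i t), counterclockwise around the rectangle, with opposite sides
    paired into one integral. *)
Definition rect_int H a b c d : C :=
  cint a b (fun s => H s c - H s d) + 'i%C * cint c d (fun t => H b t - H a t).

Definition rect_diff H a b c d :=
  forall s t, a <= s <= b -> c <= t <= d -> plane_diff H s t.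

Lemma rect_diff_h H a b c d t : rect_diff H a b c d -> c <= t <= d ->
  contin a b (fun s => H s t).
Proof. move=> h ht s hs; exact: (plane_diff_cont (h _ _ hs ht)).1. Qed.

Lemma rect_diff_v H a b c d s : rect_diff H a b c d -> a <= s <= b ->
  contin c d (H s).
Proof. move=> h hs t ht; exact: (plane_diff_cont (h _ _ hs ht)).2. Qed.

Lemma rect_diff_sub H a b c d a' b' c' d' : rect_diff H a b c d ->
  a <= a' -> b' <= b -> c <= c' -> d' <= d -> rect_diff H a' b' c' d'.
Proof.
move=> h aa bb cc dd s t /andP[h1 h2] /andP[h3 h4]; apply: h; apply/andP; split.
- exact: le_trans h1.
- exact: le_trans bb.
- exact: le_trans h3.
- exact: le_trans dd.
Qed.

Lemma continB a b (F G : R -> C) : contin a b F -> contin a b G ->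
  contin a b (fun x => F x - G x).
Proof. move=> hF hG x hx; exact: (ccB (hF x hx) (hG x hx)). Qed.

Lemma rect_int_hsplit H a b c d m : rect_diff H a b c d ->
  a <= m <= b -> c <= d ->
  rect_int H a b c d = rect_int H a m c d + rect_int H m b c d.
Proof.
move=> h /andP[am mb] cd; have ab := le_trans am mb.
have vc s : a <= s <= b -> contin c d (H s) by move=> hs; exact: rect_diff_v hs.
have hc t : c <= t <= d -> contin a b (fun s => H s t).
  by move=> ht; exact: rect_diff_h ht.
have lec : c <= c <= d by rewrite lexx.
have led : c <= d <= d by rewrite lexx andbT.
have lea : a <= a <= b by rewrite lexx.
have leb : a <= b <= b by rewrite lexx andbT.
have lem : a <= m <= b by rewrite am.
rewrite /rect_int (cint_split am mb (continB (hc c lec) (hc d led))).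
rewrite (cintB (vc b leb) (vc a lea)) (cintB (vc m lem) (vc a lea)).
rewrite (cintB (vc b leb) (vc m lem)).
move: (cint _ _ _) (cint _ _ _) (cint _ _ _) (cint _ _ _) (cint _ _ _) => x y z u v.
ring.
Qed.

Lemma rect_int_vsplit H a b c d m : rect_diff H a b c d ->
  a <= b -> c <= m <= d ->
  rect_int H a b c d = rect_int H a b c m + rect_int H a b m d.
Proof.
move=> h ab /andP[cm md]; have cd := le_trans cm md.
have vc s : a <= s <= b -> contin c d (H s) by move=> hs; exact: rect_diff_v hs.
have hc t : c <= t <= d -> contin a b (fun s => H s t).
  by move=> ht; exact: rect_diff_h ht.
have lec : c <= c <= d by rewrite lexx.
have led : c <= d <= d by rewrite lexx andbT.
have lem : c <= m <= d by rewrite cm.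
have lea : a <= a <= b by rewrite lexx.
have leb : a <= b <= b by rewrite lexx andbT.
rewrite /rect_int (cint_split cm md (continB (vc b leb) (vc a lea))).
rewrite (cintB (hc c lec) (hc d led)) (cintB (hc c lec) (hc m lem)).
rewrite (cintB (hc m lem) (hc d led)).
move: (cint _ _ _) (cint _ _ _) (cint _ _ _) (cint _ _ _) (cint _ _ _) => x y z u v.
ring.
Qed.

Arguments rect_int : simpl never.

Record rect := Rect { ra : R; rb : R; rc : R; rd : R }.

Definition rI H (Q : rect) := normc (rect_int H (ra Q) (rb Q) (rc Q) (rd Q)).

Definition quarters (Q : rect) : seq rect :=
  let m := (ra Q + rb Q) / 2 in let n := (rc Q + rd Q) / 2 in
  [:: Rect (ra Q) m (rc Q) n; Rect (ra Q) m n (rd Q);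
      Rect m (rb Q) (rc Q) n; Rect m (rb Q) n (rd Q)].

(** The first quarter carrying at least a fourth of the integral; by [next_rectP] the default [Q] of
    [nth] is never reached. *)
Definition next_rect H (Q : rect) : rect :=
  nth Q (quarters Q) (find (fun Q' => rI H Q / 4 <= rI H Q') (quarters Q)).

Lemma quarter_false (i x y p q u v : R) :
  i <= x + y -> x <= p + q -> y <= u + v ->
  p < i / 4 -> q < i / 4 -> u < i / 4 -> v < i / 4 -> False.
Proof. lra. Qed.

Lemma next_rectP H Q : ra Q <= rb Q -> rc Q <= rd Q ->
  rect_diff H (ra Q) (rb Q) (rc Q) (rd Q) ->
  [/\ rI H Q / 4 <= rI H (next_rect H Q),
      ra Q <= ra (next_rect H Q), rb (next_rect H Q) <= rb Q,
      rc Q <= rc (next_rect H Q) & rd (next_rect H Q) <= rd Q] /\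
  rb (next_rect H Q) - ra (next_rect H Q) = (rb Q - ra Q) / 2 /\
  rd (next_rect H Q) - rc (next_rect H Q) = (rd Q - rc Q) / 2.
Proof.
case: Q => a b c d /= ab cd hd.
have hH : has (fun Q' => rI H (Rect a b c d) / 4 <= rI H Q') (quarters (Rect a b c d)).
  apply/negPn/negP => /=; rewrite !negb_or /= -!ltNge /rI /= => /and5P[h1 h2 h3 h4 _].
  set m := (a + b) / 2 in h1 h2 h3 h4; set n := (c + d) / 2 in h1 h2 h3 h4.
  have mE : m = (a + b) / 2 by []. have nE : n = (c + d) / 2 by [].
  have am : a <= m <= b by clear -mE ab; lra.
  have cn : c <= n <= d by clear -nE cd; lra.
  have [/andP[a1 a2] /andP[c1 c2]] := (am, cn).
  have e1 := rect_int_hsplit hd am cd.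
  have e2 := rect_int_vsplit (rect_diff_sub hd (lexx a) a2 (lexx c) (lexx d)) a1 cn.
  have e3 := rect_int_vsplit (rect_diff_sub hd a1 (lexx b) (lexx c) (lexx d)) a2 cn.
  have n1 := normcD (rect_int H a m c d) (rect_int H m b c d).
  have n2 := normcD (rect_int H a m c n) (rect_int H a m n d).
  have n3 := normcD (rect_int H m b c n) (rect_int H m b n d).
  rewrite -e1 in n1; rewrite -e2 in n2; rewrite -e3 in n3.
  exact: quarter_false n1 n2 n3 h1 h2 h3 h4.
have := nth_find (Rect a b c d) hH; move: hH; rewrite has_find.
rewrite -/(next_rect H _) /next_rect.
case: (find _ _) => [|[|[|[|]]]] //= _ -> ; do 2 split; lra.
Qed.

(** Bisection: the chosen rectangles shrink to a point where H is differentiable. There the affine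
    part of H has zero contour integral, and the remainder is at most a small multiple of the
    squared perimeter, which shrinks exactly like the factor [4 ^+ n] lost in the choices. *)
Lemma goursat H a b c d : a <= b -> c <= d -> rect_diff H a b c d ->
  rect_int H a b c d = 0.
Proof.
move=> ab cd hd.
pose Q n := iter n (next_rect H) (Rect a b c d).
have inv n : [/\ a <= ra (Q n), rb (Q n) <= b, c <= rc (Q n) & rd (Q n) <= d] /\
   [/\ rb (Q n) - ra (Q n) = (b - a) / 2 ^+ n, rd (Q n) - rc (Q n) = (d - c) / 2 ^+ n
     & rI H (Rect a b c d) / 4 ^+ n <= rI H (Q n)].
  elim: n => [|n [[h1 h2 h3 h4] [h5 h6 h7]]].
    by rewrite /= !expr0 !divr1; do 2 split => //.
  have p2 : 0 < 2 ^+ n :> R by rewrite exprn_gt0.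
  have ab' : ra (Q n) <= rb (Q n) by rewrite -subr_ge0 h5 divr_ge0 ?subr_ge0 // ltW.
  have cd' : rc (Q n) <= rd (Q n) by rewrite -subr_ge0 h6 divr_ge0 ?subr_ge0 // ltW.
  have [[k1 k2 k3 k4 k5] [k6 k7]] := next_rectP ab' cd' (rect_diff_sub hd h1 h2 h3 h4).
  rewrite [Q n.+1]/= -/(Q n); split; first by split; lra.
  rewrite k6 k7 h5 h6 !exprSr !invfM !mulrA; split => //.
  by apply: le_trans k1; rewrite ler_pM2r.
have p2 n : 0 < 2 ^+ n :> R by rewrite exprn_gt0.
have ab' n : ra (Q n) <= rb (Q n).
  by have [_ [h5 _ _]] := inv n; rewrite -subr_ge0 h5 divr_ge0 ?subr_ge0 // ltW.
have cd' n : rc (Q n) <= rd (Q n).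
  by have [_ [_ h6 _]] := inv n; rewrite -subr_ge0 h6 divr_ge0 ?subr_ge0 // ltW.
have mono n m : (n <= m)%N -> [/\ ra (Q n) <= ra (Q m), rb (Q m) <= rb (Q n),
     rc (Q n) <= rc (Q m) & rd (Q m) <= rd (Q n)].
  elim: m => [|m IH]; first by rewrite leqn0 => /eqP ->.
  rewrite leq_eqVlt => /predU1P[-> // | /IH [h1 h2 h3 h4]].
  have [[g1 g2 g3 g4] _] := inv m.
  have [[_ k2 k3 k4 k5] _] := next_rectP (ab' m) (cd' m) (rect_diff_sub hd g1 g2 g3 g4).
  by rewrite [Q m.+1]/= -/(Q m); split; [exact: le_trans h1 _|exact: le_trans k3 _|
     exact: le_trans h3 _|exact: le_trans k5 _].
have nested (f g : nat -> R) : (forall n m, (n <= m)%N -> f n <= f m) ->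
    (forall n m, (n <= m)%N -> g m <= g n) -> (forall n, f n <= g n) ->
    exists x, forall n, f n <= x <= g n.
  move=> hf hg fg.
  have fgmn n m : f n <= g m.
    apply: (le_trans (hf n (maxn n m) (leq_maxl _ _))).
    by apply: (le_trans (fg _)); apply: hg; exact: leq_maxr.
  have hs : has_sup (range f).
    by split; [exists (f 0%N), 0%N|exists (g 0%N) => _ [n _ <-]].
  exists (sup (range f)) => n; apply/andP; split.
    by apply: sup_upper_bound => //; exists n.
  by apply: sup_le_ub; [exact: hs.1|move=> _ [m _ <-]].
have [s0 hs0] := nested (fun n => ra (Q n)) (fun n => rb (Q n))
  (fun n m h => let: And4 x _ _ _ := mono n m h in x)
  (fun n m h => let: And4 _ x _ _ := mono n m h in x) ab'.
have [t0 ht0] := nested (fun n => rc (Q n)) (fun n => rd (Q n))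
  (fun n m h => let: And4 _ _ x _ := mono n m h in x)
  (fun n m h => let: And4 _ _ _ x := mono n m h in x) cd'.
have [D hD] : plane_diff H s0 t0.
  by apply: hd; [exact: (hs0 0%N)|exact: (ht0 0%N)].
(* The added 1 keeps [S] positive for degenerate rectangles. *)
pose S := (b - a) + (d - c) + 1.
have S0 : 0 < S by rewrite /S; lra.
apply/eqP; rewrite -normc_eq0 eq_le normc_ge0 andbT.
apply/ler_addgt0Pr => e e0; rewrite add0r.
(* Chosen so that the final bound [4 * e' * T ^+ 2 * 4 ^+ n], with [T = S / 2 ^+ n], is exactly
   [e]. *)
pose e' := e / (4 * S ^+ 2).
have e'0 : 0 < e' by rewrite divr_gt0 // mulr_gt0 // exprn_gt0.
have [del del0 hdel] := hD e' e'0.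
have [n hn] : exists n, S / 2 ^+ n < del.
  have [n hn] : exists n : nat, S / del < n%:R.
    have := archi_boundP (divr_ge0 (ltW S0) (ltW del0)).
    by move=> ?; exists (Num.bound (S / del)).
  exists n; rewrite ltr_pdivrMr // mulrC -ltr_pdivrMr //.
  apply: lt_le_trans hn _; rewrite -natrX ler_nat ltnW //.
  exact: ltn_expl.
have [[g1 g2 g3 g4] [h5 h6 h7]] := inv n.
pose T := S / 2 ^+ n.
have TE : (rb (Q n) - ra (Q n)) + (rd (Q n) - rc (Q n)) <= T.
  by rewrite h5 h6 /T -mulrDl ler_pM2r ?invr_gt0 // /S; lra.
move: h7 TE hn (ab' n) (cd' n) (hs0 n) (ht0 n) g1 g2 g3 g4; rewrite /rI /= -/T.
set A := ra _; set B := rb _; set P := rc _; set V := rd _.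
move=> h7 TE hn AB PV hs ht g1 g2 g3 g4.
have hd' := rect_diff_sub hd g1 g2 g3 g4.
pose E s t := H s t - H s0 t0 - D * ci (s - s0) (t - t0).
have Eb s t : A <= s <= B -> P <= t <= V -> normc (E s t) <= e' * T.
  move=> h1 h2; have hs1 : `|s - s0| <= B - A by rewrite ler_norml; lra.
  have ht1 : `|t - t0| <= V - P by rewrite ler_norml; lra.
  by apply: le_trans (hdel _ _ _ _) _; try lra; rewrite ler_pM2l //; lra.
have cE1 t : P <= t <= V -> contin A B (fun s => E s t).
  move=> h2 s h1; rewrite /E /ci; apply: ccB; first apply: ccB.
  - exact: (rect_diff_h hd').
  - exact: cc_cst.
  apply: ccM; first exact: cc_cst.
  apply: cvg_Complex; last exact: cvg_cst.
  by apply: cvgB; [exact: cvg_id|exact: cvg_cst].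
have cE2 s : A <= s <= B -> contin P V (E s).
  move=> h2 t h1; rewrite /E /ci; apply: ccB; first apply: ccB.
  - exact: (rect_diff_v hd').
  - exact: cc_cst.
  apply: ccM; first exact: cc_cst.
  apply: cvg_Complex; first exact: cvg_cst.
  by apply: cvgB; [exact: cvg_id|exact: cvg_cst].
(* [I1] and [I2] isolate the contribution of the affine part of H on the horizontal and the vertical
   sides; in [IE] the two cancel because [ci 0 (P - V)] is minus i times [V - P]. *)
have I1 : cint A B (fun s => H s P - H s V) =
    cint A B (fun s => E s P - E s V) + (B - A)%:C * (D * ci 0 (P - V)).
  rewrite -cint_cst // -cintD; first last.
  - by move=> s _; exact: cc_cst.
  - by apply: continB; apply: cE1; lra.
  apply: eq_cint => s _; rewrite /E /ci.
  have -> : (0 +i* (P - V)) = ((s - s0) +i* (P - t0)) - ((s - s0) +i* (V - t0)) :> C.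
    by apply/eqP; rewrite eq_complex /=; apply/andP; split; apply/eqP; ring.
  ring.
have I2 : cint P V (fun t => H B t - H A t) =
    cint P V (fun t => E B t - E A t) + (V - P)%:C * (D * ci (B - A) 0).
  rewrite -cint_cst // -cintD; first last.
  - by move=> s _; exact: cc_cst.
  - by apply: continB; apply: cE2; lra.
  apply: eq_cint => t _; rewrite /E /ci.
  have -> : ((B - A) +i* 0) = ((B - s0) +i* (t - t0)) - ((A - s0) +i* (t - t0)) :> C.
    by apply/eqP; rewrite eq_complex /=; apply/andP; split; apply/eqP; ring.
  ring.
have IE : rect_int H A B P V =
    cint A B (fun s => E s P - E s V) + 'i%C * cint P V (fun t => E B t - E A t).
  rewrite /rect_int I1 I2.
  have -> : ci (B - A) 0 = (B - A)%:C by [].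
  have -> : ci 0 (P - V) = 'i%C * - (V - P)%:C.
    by apply/eqP; rewrite eq_complex /=; apply/andP; split; apply/eqP; ring.
  ring.
have bI : normc (rect_int H A B P V) <= 4 * e' * T ^+ 2.
  rewrite IE; apply: le_trans (normcD _ _) _; rewrite normcM.
  have -> : normc ('i%C : C) = 1 by rewrite /normc /= expr0n /= add0r expr1n sqrtr1.
  rewrite mul1r.
  have n1 : normc (cint A B (fun s => E s P - E s V)) <= 2 * ((B - A) * (e' * T + e' * T)).
    apply: normc_cint => //; first by apply: continB; apply: cE1; lra.
    move=> s hs1; apply: le_trans (normcB_le _ _) _; apply: lerD; apply: Eb => //; lra.
  have n2 : normc (cint P V (fun t => E B t - E A t)) <= 2 * ((V - P) * (e' * T + e' * T)).
    apply: normc_cint => //; first by apply: continB; apply: cE2; lra.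
    move=> s hs1; apply: le_trans (normcB_le _ _) _; apply: lerD; apply: Eb => //; lra.
  apply: le_trans (lerD n1 n2) _.
  have -> : 2 * ((B - A) * (e' * T + e' * T)) + 2 * ((V - P) * (e' * T + e' * T)) =
     4 * e' * T * (B - A + (V - P)) by ring.
  have T0 : 0 <= T := divr_ge0 (ltW S0) (ltW (p2 n)).
  rewrite [T ^+ 2]expr2 [leRHS]mulrA; apply: ler_wpM2l TE.
  by apply: mulr_ge0 => //; apply: mulr_ge0 => //; exact: ltW.
move: (le_trans h7 bI); rewrite ler_pdivrMr ?exprn_gt0 //.
have -> : 4 * e' * T ^+ 2 * 4 ^+ n = e.
  rewrite /e' /T.
  have -> : 4 ^+ n = (2 ^+ n) ^+ 2 :> R by rewrite -exprM mulnC exprM; congr (_ ^+ n); ring.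
  by field; rewrite !gt_eqF.
by [].
Qed.

End Goursat.

(** Linear approximation instead of a limit of quotients: no division, and [h = 0] needs no
    exception. *)
Lemma is_derive_expansion (K : numFieldType) (f : K -> K) (x d : K) :
  is_derive x 1 f d <-> forall e : K, 0 < e ->
    \forall h \near (0 : K), `|f (h + x) - f x - d * h| <= e * `|h|.
Proof.
split=> [[df <-] e e0|H].
  have : h^-1 *: (f (h *: 1 + x) - f x) @[h --> 0^'] --> 'D_1 f x by exact: df.
  move=> /cvgrPdistC_le /(_ e e0) h1.
  move: h1; rewrite /dnbhs near_withinE; apply: filterS => h /= h1.
  have [-> | h0] := eqVneq h 0; first by rewrite add0r subrr mulr0 subrr normr0 mulr0.
  have := h1 h0; rewrite [h *: 1]mulr1 => h2.
  have -> : f (h + x) - f x - 'D_1 f x * h =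
            (h^-1 *: (f (h + x) - f x) - 'D_1 f x) * h.
    by rewrite mulrBl /GRing.scale /= mulrAC mulVf // mul1r.
  by rewrite normrM ler_wpM2r.
have cv : h^-1 *: (f (h *: 1 + x) - f x) @[h --> 0^'] --> d.
  apply/cvgrPdistC_le => e e0.
  have := H e e0 => h1; rewrite /dnbhs near_withinE; apply: filterS h1 => h /= h1 h0.
  have -> : h^-1 *: (f (h *: 1 + x) - f x) - d = h^-1 * (f (h + x) - f x - d * h).
    by rewrite [h *: 1]mulr1 [RHS]mulrBr [d * h]mulrC mulKf.
  by rewrite normrM normfV mulrC ler_pdivrMr // normr_gt0.
apply: DeriveDef; first by apply/cvg_ex; exists d.
exact: cvg_lim cv.
Qed.

(** * Polar coordinates and means over circles *)

Section Circle.
Variable R : realType.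
Notation C := (R[i] : numFieldType).
Implicit Types (F h : C -> C) (z w D : C) (r s t e : R).

Lemma is_deriveCP F z D : is_derive z 1 F D <-> forall e, 0 < e ->
  exists2 del, 0 < del & forall w, normc (w - z) < del ->
    normc (F w - F z - D * (w - z)) <= e * normc (w - z).
Proof.
rewrite is_derive_expansion; split=> H e e0.
  have e1 : 0 < e%:C :> C by rewrite ltcR.
  have /nbhsCP [del [del0 hd]] := H _ e1; exists del => // w hw.
  have := hd (w - z); rewrite subr0 subrK => /(_ hw).
  by rewrite !normc_norm -rmorphM lecR.
have e1 : e = (Re e)%:C by rewrite (RRe_real (gtr0_real e0)).
have e2 : 0 < Re e by rewrite -ltcR -e1.
have [del del0 hd] := H _ e2; apply/nbhsCP; exists del; split => // h hh.
have := hd (h + z); rewrite addrK => /(_ _).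
rewrite e1 !normc_norm -rmorphM lecR; apply.
by rewrite subr0 in hh.
Qed.

Lemma is_deriveRP (f : R -> R) (x d : R) : is_derive x 1 f d -> forall e, 0 < e ->
  exists2 del : R, 0 < del & forall h : R, `|h| < del ->
    `|f (h + x) - f x - d * h| <= e * `|h|.
Proof.
move=> /is_derive_expansion H e /H /nbhs_ballP [del /= del0 hd].
by exists del => // h hh; apply: hd; rewrite /ball /= sub0r normrN.
Qed.

Lemma derivable_cc F z : derivable F z 1 -> {for z, continuous F}.
Proof. by move=> h; apply: differentiable_continuous; exact/derivable1_diffP. Qed.

Definition circ r t : C := (r * cos t) +i* (r * sin t).

Lemma normc_circ r t : normc (circ r t) = `|r|.
Proof.
rewrite /circ /normc !exprMn -mulrDr cos2Dsin2 mulr1; exact: sqrtr_sqr.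
Qed.

Lemma circ0 t : circ 0 t = 0.
Proof. by apply/eqP; rewrite -normc_eq0 normc_circ normr0. Qed.

Lemma circM r r' t t' : circ (r * r') (t + t') = circ r t * circ r' t'.
Proof.
apply/eqP; rewrite eq_complex /= cosD sinD.
by apply/andP; split; apply/eqP; ring.
Qed.

Lemma conj_circ r t : circ r t * conjc (circ r t) = (r ^+ 2)%:C.
Proof. by rewrite mulc_conj normc_circ real_normK ?num_real. Qed.

Lemma circ_2pi r : circ r (2 * pi) = circ r 0.
Proof. by rewrite /circ mulr_natl cos2pi sin2pi cos0 sin0. Qed.

Lemma cc_circ r t : {for t, continuous (circ r)}.
Proof.
by apply: cvg_Complex; apply: cvgM; (try exact: cvg_cst);
 [exact: continuous_cos|exact: continuous_sin].
Qed.

(** [circ (expR s) t] is exp(s + i t), so this says that the complex exponential has derivative 1 at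
    the origin. *)
Lemma polar_expansion e : 0 < e -> exists2 del, 0 < del & forall s t : R,
  `|s| < del -> `|t| < del ->
  normc (circ (expR s) t - 1 - ci s t) <= e * (`|s| + `|t|).
Proof.
(* The errors add up to [e1 * |s| + 5 * e1 * |t|], whence the fifth. *)
move=> e0; pose e1 := Num.min 1 (e / 5).
have e10 : 0 < e1 by rewrite lt_min ltr01 divr_gt0.
have e11 : e1 <= 1 by rewrite ge_min lexx.
have e14 : 5 * e1 <= e by rewrite mulrC -ler_pdivlMr // ge_min lexx orbT.
have [d1 d10 h1] := is_deriveRP (is_derive_expR 0) e10.
have [d2 d20 h2] := is_deriveRP (is_derive_cos 0) e10.
have [d3 d30 h3] := is_deriveRP (is_derive_sin 0) e10.
exists (Num.min (Num.min d1 d2) (Num.min d3 (e1 / 2))).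
  by rewrite !lt_min d10 d20 d30 divr_gt0.
move=> s t; rewrite !lt_min => /andP[/andP[s1 s2] /andP[s3 s4]].
move=> /andP[/andP[t1 t2] /andP[t3 t4]].
have := h1 _ s1; have := h2 _ t2; have := h3 _ t3.
rewrite !addr0 expR0 cos0 sin0 oppr0 mul0r ?subr0 !addr0 !mul1r => k3 k2 k1.
have c1 : `|cos t| <= 1 by rewrite ler_norml cos_geN1 cos_le1.
have s2' : `|1 + s| <= 2 by apply: le_trans (ler_normD _ _) _; rewrite normr1; lra.
have x1 : `|expR s - 1| <= 2 * `|s|.
  have -> : expR s - 1 = (expR s - 1 - s) + s by ring.
  have : e1 * `|s| <= `|s| by rewrite ler_piMl.
  by have := ler_normD (expR s - 1 - s) s; lra.
have x2 : `|sin t| <= 2 * `|t|.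
  have -> : sin t = (sin t - t) + t by ring.
  have : e1 * `|t| <= `|t| by rewrite ler_piMl.
  by have := ler_normD (sin t - t) t; lra.
apply: le_trans (normc_ReIm _) _ => /=.
have -> : expR s * cos t - 1 - s = (expR s - 1 - s) * cos t + (1 + s) * (cos t - 1) by ring.
have -> : expR s * sin t - 0 - t = (expR s - 1) * sin t + (sin t - t) by ring.
have y1 : `|(expR s - 1 - s) * cos t| <= e1 * `|s|.
  by rewrite normrM; apply: le_trans k1; rewrite ler_piMr.
have y2 : `|(1 + s) * (cos t - 1)| <= 2 * (e1 * `|t|).
  by rewrite normrM; apply: ler_pM.
have y3 : `|(expR s - 1) * sin t| <= (2 * (e1 / 2)) * (2 * `|t|).
  rewrite normrM; apply: ler_pM => //; apply: le_trans x1 _.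
  by rewrite ler_pM2l // ltW.
have := ler_normD ((expR s - 1 - s) * cos t) ((1 + s) * (cos t - 1)).
have := ler_normD ((expR s - 1) * sin t) (sin t - t).
have : 5 * e1 * (`|s| + `|t|) <= e * (`|s| + `|t|).
  by rewrite ler_wpM2r // addr_ge0.
have : 0 <= e1 * `|s| by rewrite mulr_ge0 // ltW.
clear -y1 y2 y3 k3; lra.
Qed.

(** The chain rule for F composed with exp, whose derivative at log z is D z: by [circM] the
    increment of exp at (s, t) is z times its increment at the origin. *)
Lemma polar_deriv F s t D : is_derive (circ (expR s) t) 1 F D ->
  forall e, 0 < e -> exists2 del, 0 < del &
    forall s' t' : R, `|s' - s| < del -> `|t' - t| < del ->
    normc (F (circ (expR s') t') - F (circ (expR s) t) -
           D * circ (expR s) t * ci (s' - s) (t' - t)) <=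
      e * (`|s' - s| + `|t' - t|).
Proof.
set z := circ _ _ => /is_deriveCP hF e e0.
pose n := normc z + 1; pose m := normc D + 1.
have n0 : 0 < n by rewrite ltr_wpDl // normc_ge0.
have m0 : 0 < m by rewrite ltr_wpDl // normc_ge0.
(* The increment of z is at most [n * (2 * q)], so this constant makes the error of F at most
   [e / 2 * q]; [e20] does the same for the error of exp, multiplied by D and z. *)
have e10 : 0 < e / (4 * n) by rewrite divr_gt0 // mulr_gt0.
have [d1 d10 h1] := hF _ e10.
have e20 : 0 < Num.min 1 (e / (2 * (m * n))).
  by rewrite lt_min ltr01 divr_gt0 // !mulr_gt0.
have [d2 d20 h2] := polar_expansion e20.
have d30 : 0 < d1 / (4 * n) by rewrite divr_gt0 // mulr_gt0.
exists (Num.min d2 (d1 / (4 * n))); first by rewrite lt_min d20.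
move=> s' t'; rewrite !lt_min => /andP[s1 s2] /andP[t1 t2].
have := h2 _ _ s1 t1; set E := circ _ _ - 1 - _ => hE.
have zE : circ (expR s') t' = z * circ (expR (s' - s)) (t' - t).
  by rewrite -circM -expRD [s + _]addrC subrK [t + _]addrC subrK.
set c := ci _ _ in E hE *; set q := `|_| + `|_| in hE *.
have q0 : 0 <= q by rewrite addr_ge0.
have cq : normc c <= q by exact: normc_ReIm.
have dz : circ (expR s') t' - z = z * (c + E) by rewrite zE /E; ring.
have nE1 : normc E <= q.
  by apply: le_trans hE _; rewrite ler_piMl // ge_min lexx.
have nE2 : normc E <= e / (2 * (m * n)) * q.
  by apply: le_trans hE _; rewrite ler_wpM2r // ge_min lexx orbT.
have zn : normc z <= n by rewrite lerDl.
have dzb : normc (circ (expR s') t' - z) <= n * (2 * q).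
  rewrite dz normcM; apply: ler_pM; rewrite ?normc_ge0 //.
  by have := normcD c E; lra.
have dzb1 : normc (circ (expR s') t' - z) < d1.
  apply: le_lt_trans dzb _.
  have : q < d1 / (4 * n) + d1 / (4 * n) by exact: ltrD.
  have -> : d1 / (4 * n) + d1 / (4 * n) = d1 / (n * 2) by field; rewrite gt_eqF.
  by rewrite ltr_pdivlMr ?mulr_gt0 // mulrC mulrA.
have := h1 _ dzb1 => h3.
have -> : F (circ (expR s') t') - F z - D * z * c =
  (F (circ (expR s') t') - F z - D * (circ (expR s') t' - z)) + D * (z * E).
  by rewrite dz; ring.
apply: le_trans (normcD _ _) _; rewrite !normcM.
have b1 : e / (4 * n) * normc (circ (expR s') t' - z) <= e / 2 * q.
  apply: le_trans (ler_wpM2l (ltW e10) dzb) _.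
  by rewrite le_eqVlt; apply/orP; left; apply/eqP; field; rewrite gt_eqF.
have b2 : normc D * (normc z * normc E) <= e / 2 * q.
  apply: le_trans (_ : m * (n * (e / (2 * (m * n)) * q)) <= _).
    apply: ler_pM; rewrite ?mulr_ge0 ?normc_ge0 ?lerDl //.
    by apply: ler_pM; rewrite ?normc_ge0.
  by rewrite le_eqVlt; apply/orP; left; apply/eqP; field; rewrite !gt_eqF.
by clear -h3 b1 b2; lra.
Qed.

Lemma polar_diff F s t : derivable F (circ (expR s) t) 1 ->
  plane_diff (fun s t => F (circ (expR s) t)) s t.
Proof.
by move=> dF; exists ('D_1 F (circ (expR s) t) * circ (expR s) t);
  apply: polar_deriv; exact: derivableP.
Qed.

Lemma continR_bounded a b (f : R -> R) : a <= b -> continR a b f ->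
  exists M, forall x, a <= x <= b -> f x <= M.
Proof.
move=> ab hf; have [|c _ hc] := @EVT_max R f a b ab.
  by apply: continuous_in_subspaceT => x /[!inE]/=; rewrite in_itv /=; exact: hf.
by exists (f c) => x hx; apply: hc; rewrite in_itv.
Qed.

Lemma contin_normc a b (u : R -> C) : contin a b u -> continR a b (fun x => normc (u x)).
Proof. move=> h x hx; exact: (cvg_normc (h x hx)). Qed.

Lemma contin_bounded a b (u : R -> C) : a <= b -> contin a b u ->
  exists M, forall x, a <= x <= b -> normc (u x) <= M.
Proof. by move=> ab hu; exact: (continR_bounded ab (contin_normc hu)). Qed.

Definition cmean (u : R -> C) : C := ((2 * pi)^-1)%:C * cint 0 (2 * pi) u.

Lemma twopi_gt0 : 0 < 2 * pi :> R.
Proof. by rewrite mulr_gt0 // pi_gt0. Qed.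

Lemma twopi_ge0 : 0 <= 2 * pi :> R.
Proof. exact: ltW twopi_gt0. Qed.

Notation ccont := (contin 0 (2 * pi)).

Lemma cmeanD u v : ccont u -> ccont v -> cmean (fun t => u t + v t) = cmean u + cmean v.
Proof. by move=> hu hv; rewrite /cmean (cintD hu hv) mulrDr. Qed.

Lemma cmeanB u v : ccont u -> ccont v -> cmean (fun t => u t - v t) = cmean u - cmean v.
Proof. by move=> hu hv; rewrite /cmean (cintB hu hv) mulrBr. Qed.

Lemma cmeanZ k u : ccont u -> cmean (fun t => k * u t) = k * cmean u.
Proof. by move=> hu; rewrite /cmean (cintZ k hu) mulrCA. Qed.

Lemma cmean_cst k : cmean (fun=> k) = k.
Proof.
rewrite /cmean (cint_cst _ twopi_ge0) subr0 mulrA -rmorphM mulVf ?mul1r //.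
by rewrite gt_eqF // twopi_gt0.
Qed.

Lemma eq_cmean u v : (forall t, u t = v t) -> cmean u = cmean v.
Proof. by move=> /funext ->. Qed.

Lemma conj_cmean u : ccont u -> conjc (cmean u) = cmean (fun t => conjc (u t)).
Proof.
move=> hu; rewrite /cmean -(conj_cint hu); set k := ((2 * pi)^-1)%:C.
have {2}-> : k = conjc k by rewrite /= oppr0.
by rewrite conjcM.
Qed.

Lemma normc_cmean u k : ccont u ->
  (forall t, 0 <= t <= 2 * pi -> normc (u t) <= k) ->
  normc (cmean u) <= 2 * k.
Proof.
move=> hu h; rewrite /cmean normcM normcR ger0_norm ?invr_ge0 ?twopi_ge0 //.
have := normc_cint twopi_ge0 hu h; rewrite subr0 => h1.
rewrite mulrC ler_pdivrMr ?twopi_gt0 //; apply: le_trans h1 _.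
by rewrite le_eqVlt; apply/orP; left; apply/eqP; ring.
Qed.

(** [goursat] for F composed with exp on the rectangle [ln r1, ln r2] x [0, 2 pi]: the horizontal
    sides cancel by periodicity, and the vertical sides are the two circle integrals. *)
Lemma cmean_annulus F r1 r2 : 0 < r1 -> r1 <= r2 ->
  (forall z, r1 <= normc z <= r2 -> derivable F z 1) ->
  cmean (fun t => F (circ r1 t)) = cmean (fun t => F (circ r2 t)).
Proof.
move=> r10 r12 dF; have r20 := lt_le_trans r10 r12.
have l12 : ln r1 <= ln r2 by rewrite ler_ln.
pose H s t := F (circ (expR s) t).
have hd : rect_diff H (ln r1) (ln r2) 0 (2 * pi).
  move=> s t /andP[h1 h2] _; apply: polar_diff; apply: dF.
  rewrite normc_circ ger0_norm ?expR_ge0 //.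
  by rewrite -{1}(lnK r10) -{1}(lnK r20) !ler_expR h1.
have := goursat l12 twopi_ge0 hd; rewrite /rect_int.
have -> : cint (ln r1) (ln r2) (fun s => H s 0 - H s (2 * pi)) = 0.
  rewrite -[RHS](mulr0 (ln r2 - ln r1)%:C) -cint_cst //.
  by congr cint; apply/funext => s; rewrite /H circ_2pi subrr.
have l1 : ln r1 <= ln r1 <= ln r2 by rewrite lexx.
have l2 : ln r1 <= ln r2 <= ln r2 by rewrite lexx andbT.
rewrite add0r (cintB (rect_diff_v hd l2) (rect_diff_v hd l1)) /H !lnK //.
move/eqP; rewrite mulf_eq0 subr_eq0 => /orP[|/eqP h].
  by rewrite eq_complex /= oner_eq0 andbF.
by rewrite /cmean h.
Qed.

End Circle.

(** * The mean value property *)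

Section Cauchy.
Variable R : realType.
Notation C := (R[i] : numFieldType).
Notation ccont := (contin 0 (2 * pi)).
Implicit Types (F h : C -> C) (z w D : C) (r s t e : R).

Lemma cvg_compC (T : Type) (G : set_system T) (g : T -> C) F z :
  g @ G --> z -> {for z, continuous F} -> (fun x => F (g x)) @ G --> F z.
Proof. by move=> hg hF; apply: (@cvg_comp _ _ _ g F); [exact: hg|exact: hF]. Qed.

Lemma cc_circ_comp F r t : {for circ r t, continuous F} ->
  {for t, continuous (fun t => F (circ r t))}.
Proof. by move=> hF; apply: cvg_compC; [exact: cc_circ|exact: hF]. Qed.

Lemma circ_cvg r t : (fun p : R * R => (circ p.2 p.1 : C)) @ (nbhs t, nbhs r) --> (circ r t : C).
Proof.
apply: cvg_Complex; apply: cvgM; (try exact: cvg_snd);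
 apply: (cvg_comp _ _ cvg_fst); [exact: continuous_cos|exact: continuous_sin].
Qed.

(** Continuity at each point (t, r0) becomes uniform in t by compactness of [0, 2 pi], used in its
    near-covering form. *)
Lemma circ_uniform F r0 e : 0 < e -> (forall t, {for circ r0 t, continuous F}) ->
  \forall r \near r0, forall t, 0 <= t <= 2 * pi ->
    normc (F (circ r t) - F (circ r0 t)) <= e.
Proof.
move=> e0 hF.
pose K : set R := [set` `[0, 2 * pi]].
have cK : compact K by exact: segment_compact.
have := (compact_near_coveringP K).1 cK R (nbhs r0)
  (fun r t => normc (F (circ r t) - F (circ r0 t)) <= e) _.
move=> /(_ _) h; have /h : forall t, K t ->
   \forall t' \near t & r \near r0, normc (F (circ r t') - F (circ r0 t')) <= e.
  move=> t _.
  have e20 : 0 < e / 2 by rewrite divr_gt0.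
  have c1 : (fun p : R * R => F (circ p.2 p.1)) @ (nbhs t, nbhs r0) --> F (circ r0 t).
    by apply: cvg_compC; [exact: circ_cvg|exact: hF].
  have c2 : (fun p : R * R => F (circ r0 p.1)) @ (nbhs t, nbhs r0) --> F (circ r0 t).
    apply: cvg_compC; last exact: hF.
    by apply: (@cvg_comp _ _ _ fst (circ r0) _ _ _ cvg_fst); exact: cc_circ.
  move/cvgCP: c1 => /(_ _ e20) c1; move/cvgCP: c2 => /(_ _ e20) c2.
  apply: filterS2 c1 c2 => -[t' r] /= c1 c2.
  rewrite -(subrKA (F (circ r0 t))); apply: le_trans (normcD _ _) _.
  by rewrite [X in _ + X]normcBC (splitr e) lerD // ltW.
apply: filterS => r hr t ht; apply: hr.
by rewrite /K /= in_itv.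
Qed.

Lemma ccont_circ F r : (forall t, {for circ r t, continuous F}) ->
  ccont (fun t => F (circ r t)).
Proof. move=> h t _; exact: cc_circ_comp (h t). Qed.

Lemma cmean_circ_cvg F r0 : (\forall r \near r0, forall t, {for circ r t, continuous F}) ->
  {for r0, continuous (fun r => cmean (fun t => F (circ r t)))}.
Proof.
move=> hF; apply/cvgCP => e e0.
have h0 : forall t, {for circ r0 t, continuous F} := nbhs_singleton hF.
have e3 : 0 < e / 3 by rewrite divr_gt0.
apply: filterS2 hF (circ_uniform e3 h0) => r hr hu.
rewrite -(cmeanB (ccont_circ hr) (ccont_circ h0)).
apply: le_lt_trans (normc_cmean _ hu) _; last by clear -e0; lra.
exact: continB (ccont_circ hr) (ccont_circ h0).
Qed.

Lemma const_right (m : R -> C) a b : {for a, continuous m} ->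
  (forall x y, a < x < b -> a < y < b -> m x = m y) ->
  forall x, a < x < b -> m x = m a.
Proof.
move=> ca hm x hx; apply/eqP; rewrite -subr_eq0 -normc_eq0 eq_le normc_ge0 andbT.
apply/ler_addgt0Pr => e e0; rewrite add0r.
move/cvgCP: ca => /(_ e e0) /nbhs_ballP [d /= d0 hd].
have [ax xb] := andP hx; pose y := Num.min x (a + d / 2).
have d20 : 0 < d / 2 by rewrite divr_gt0.
have hy : a < y < b by rewrite lt_min ax ltrDl d20 /= gt_min xb.
rewrite (hm x y hx hy) ltW //; apply: hd; rewrite /ball /= distrC gtr0_norm; last first.
  by rewrite subr_gt0; case/andP: hy.
have : y <= a + d / 2 by rewrite ge_min lexx orbT.
by clear -d0; lra.
Qed.

Lemma const_left (m : R -> C) a b : {for b, continuous m} ->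
  (forall x y, a < x < b -> a < y < b -> m x = m y) ->
  forall x, a < x < b -> m x = m b.
Proof.
move=> cb hm x hx; apply/eqP; rewrite -subr_eq0 -normc_eq0 eq_le normc_ge0 andbT.
apply/ler_addgt0Pr => e e0; rewrite add0r.
move/cvgCP: cb => /(_ e e0) /nbhs_ballP [d /= d0 hd].
have [ax xb] := andP hx; pose y := Num.max x (b - d / 2).
have d20 : 0 < d / 2 by rewrite divr_gt0.
have hy : a < y < b by rewrite gt_max xb gtrBl d20 /= andbT lt_max ax.
rewrite (hm x y hx hy) ltW //; apply: hd; rewrite /ball /= gtr0_norm; last first.
  by rewrite subr_gt0; case/andP: hy.
have : b - d / 2 <= y by rewrite le_max lexx orbT.
by clear -d0; lra.
Qed.

(* The exceptional circle |z| = p is bridged by continuity, so that a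
   continuous difference quotient is admissible. *)
Lemma cmean_center F rho' p : 0 <= p ->
  (forall z, normc z < rho' -> {for z, continuous F}) ->
  (forall z, normc z < rho' -> z != 0 -> normc z != p -> derivable F z 1) ->
  forall rho, 0 < rho < rho' -> cmean (fun t => F (circ rho t)) = F 0.
Proof.
move=> p0 cF dF rho /andP[rho0 rhoR].
pose m r := cmean (fun t => F (circ r t)).
have cm r : 0 <= r < rho' -> {for r, continuous m}.
  move=> /andP[r0 rR]; apply: cmean_circ_cvg.
  have : \forall s \near r, `|s| < rho'.
    have h : (fun s : R => `|s|) @ r --> `|r| by apply: cvg_norm; exact: cvg_id.
    by move/cvgr_lt: h; apply; rewrite ger0_norm.
  by apply: filterS => s hs t; apply: cF; rewrite normc_circ.
have m0 : m 0 = F 0.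
  by rewrite /m -[RHS]cmean_cst; apply: eq_cmean => t; rewrite circ0.
have cst a b : 0 <= a -> b <= rho' -> ~~ (a < p < b) ->
    forall x y, a < x < b -> a < y < b -> m x = m y.
  move=> a0 bR hp.
  have main x y : a < x -> x <= y -> y < b -> m x = m y.
    move=> ax xy yb; apply: cmean_annulus => //; first exact: le_lt_trans ax.
    move=> z /andP[xz zy]; apply: dF.
    - by apply: le_lt_trans zy _; exact: lt_le_trans bR.
    - by rewrite -normc_gt0; apply: lt_le_trans xz; exact: le_lt_trans ax.
    - apply: contra hp => /eqP <-; apply/andP; split.
        exact: lt_le_trans xz.
      exact: le_lt_trans yb.
  move=> x y /andP[ax xb] /andP[ay yb].
  by have [xy|/ltW yx] := leP x y; [exact: main|symmetry; exact: main].
rewrite -m0 -/(m rho).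
have c0 : {for 0, continuous m} by apply: cm; rewrite lexx (lt_trans rho0).
have [rp|pr] := leP rho p.
  have h1 : ~~ (0 < p < rho) by rewrite negb_and -[X in _ || X]leNgt rp orbT.
  have h2 x : 0 < x < rho -> m x = m 0.
    by apply: const_right c0 _ x; apply: cst => //; exact: ltW.
  have cr : {for rho, continuous m} by apply: cm; rewrite rhoR ltW.
  have h3 : 0 < rho / 2 < rho by clear -rho0; lra.
  rewrite -(h2 _ h3); symmetry; apply: (const_left cr _ h3).
  by apply: cst => //; exact: ltW.
have h3 : m rho = m p.
  apply: (@const_right m p rho'); last by rewrite pr.
    by apply: cm; rewrite p0 (lt_trans pr).
  by apply: cst => //; rewrite ltxx.
rewrite h3; have [->//|p1] := eqVneq p 0.
have p2 : 0 < p by rewrite lt_def p1.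
have h2 x : 0 < x < p -> m x = m 0.
  apply: const_right c0 _ x; apply: cst => //; last by rewrite ltxx andbF.
  by apply: ltW; exact: lt_trans rhoR.
have cp : {for p, continuous m} by apply: cm; rewrite p0 (lt_trans pr).
have h4 : 0 < p / 2 < p by clear -p2; lra.
rewrite -(h2 _ h4); symmetry; apply: (const_left cp _ h4).
apply: cst => //; last by rewrite ltxx andbF.
by apply: ltW; exact: lt_trans rhoR.
Qed.

Lemma normc_circB r z t : r - normc z <= normc (circ r t - z).
Proof.
apply: le_trans (ler_normcB _ _); rewrite normc_circ lerD2r; exact: ler_norm.
Qed.

Lemma circ_neq r z t : normc z < r -> circ r t - z != 0.
Proof.
move=> h; rewrite -normc_gt0; apply: lt_le_trans (normc_circB r z t).
by rewrite subr_gt0.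
Qed.

Lemma ccont_kernel (u : R -> C) r z n : ccont u -> normc z < r ->
  ccont (fun t => u t / (circ r t - z) ^+ n).
Proof.
move=> hu hz t ht; apply: ccM; first exact: hu.
apply: ccV; first by rewrite expf_neq0 // circ_neq.
by apply: ccX; apply: ccB; [exact: cc_circ|exact: cc_cst].
Qed.

Lemma ccontM (u v : R -> C) : ccont u -> ccont v -> ccont (fun t => u t * v t).
Proof. move=> hu hv t ht; exact: ccM (hu t ht) (hv t ht). Qed.

Lemma ccont_cst k : ccont (fun=> k : C).
Proof. move=> t ht; exact: cc_cst. Qed.

Lemma ccont_id r : ccont (circ r).
Proof. move=> t _; exact: cc_circ. Qed.

Lemma der_cst (k z : C) : derivable (fun _ : C => k : C) z 1.
Proof. exact: derivable_cst. Qed.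

Lemma der_id z : derivable (fun w : C => w : C) z 1.
Proof. exact: derivable_id. Qed.

Lemma derD F h z : derivable F z 1 -> derivable h z 1 ->
  derivable (fun w : C => F w + h w : C) z 1.
Proof. exact: derivableD. Qed.

Lemma derB F h z : derivable F z 1 -> derivable h z 1 ->
  derivable (fun w : C => F w - h w : C) z 1.
Proof. exact: derivableB. Qed.

Lemma derM F h z : derivable F z 1 -> derivable h z 1 ->
  derivable (fun w : C => F w * h w : C) z 1.
Proof. exact: derivableM. Qed.

Lemma derV F z : F z != 0 -> derivable F z 1 -> derivable (fun w : C => (F w)^-1 : C) z 1.
Proof. exact: derivableV. Qed.

Lemma derX F z n : derivable F z 1 -> derivable (fun w : C => F w ^+ n : C) z 1.
Proof.
move=> dF; elim: n => [|n IH].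
  apply: (@near_eq_derivable _ _ _ (fun=> 1 : C)); last exact: der_cst.
  by near=> w; rewrite expr0.
apply: (@near_eq_derivable _ _ _ (fun w => F w * F w ^+ n)); last exact: derM dF IH.
by near=> w; rewrite exprS.
Unshelve. all: by end_near. Qed.

End Cauchy.

Arguments der_cst {R} k z.
Arguments der_id {R} z.
Arguments derD {R F h z} _ _.
Arguments derB {R F h z} _ _.
Arguments derM {R F h z} _ _.
Arguments derV {R F z} _ _.
Arguments derX {R F z} n _.
Arguments ccont_kernel {R u r z} n _ _.
Arguments ccontM {R u v} _ _.
Arguments ccont_cst {R} k.
Arguments ccont_id {R} r.

(** * Cauchy's formula and the differentiability of derivatives *)

Section CauchyFormula.
Variable R : realType.
Notation C := (R[i] : numFieldType).
Notation ccont := (contin 0 (2 * pi)).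
Implicit Types (F h g : C -> C) (z w D : C) (r s t e : R).

Definition diffq h z w := if w == z then 'D_1 h z else (h w - h z) / (w - z).

Lemma diffq_derivable h z w : w != z -> derivable h w 1 -> derivable (diffq h z) w 1.
Proof.
move=> wz hw; apply: (@near_eq_derivable _ _ _ (fun v => (h v - h z) / (v - z))).
  apply/nbhsCP; exists (normc (w - z)).
  split; first by rewrite normc_gt0 subr_eq0.
  move=> v hv; rewrite /diffq; case: eqP => // vz.
  by move: hv; rewrite vz normcBC ltxx.
apply: derM; first exact: derB hw (der_cst _ _).
by apply: derV; [rewrite subr_eq0|exact: derB (der_id _) (der_cst _ _)].
Qed.

Lemma ccP F z : {for z, continuous F} <-> forall e, 0 < e ->
  exists2 del, 0 < del & forall w, normc (w - z) < del -> normc (F w - F z) < e.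
Proof.
have FF : Filter (nbhs z) by exact: nbhs_filter.
split=> [/(@cvgCP _ _ _ FF) h e /h /nbhsCP [del [? ?]]|h]; first by exists del.
apply/(@cvgCP _ _ _ FF) => e /h [del d0 hd].
by apply/nbhsCP; exists del.
Qed.

Lemma diffq_cc h z : derivable h z 1 -> {for z, continuous (diffq h z)}.
Proof.
move=> /derivableP /is_deriveCP hd; apply/ccP => e e0.
have e2 : 0 < e / 2 by rewrite divr_gt0.
have [del del0 hdel] := hd _ e2; exists del => // w hw.
rewrite /diffq eqxx; case: eqP => [_|/eqP wz]; first by rewrite subrr (normc0 R).
have nz : 0 < normc (w - z) by rewrite normc_gt0 subr_eq0.
have := hdel _ hw; set D := 'D_1 h z.
have -> : h w - h z - D * (w - z) = ((h w - h z) / (w - z) - D) * (w - z).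
  by rewrite mulrBl divfK // subr_eq0.
rewrite normcM ler_pM2r // => /le_lt_trans; apply.
by clear -e0; lra.
Qed.

(** The denominator vanishes only at the reflection of z in the circle of radius r, which lies
    strictly outside; so there is room for a larger disc. *)
Lemma conj_den r z : normc z < r -> exists2 rho, r < rho &
  forall w, normc w < rho -> (r ^+ 2)%:C - conjc z * w != 0.
Proof.
move=> zr; have r0 : 0 < r by apply: le_lt_trans zr; exact: normc_ge0.
have [->|z0] := eqVneq z 0.
  exists (r + 1); first by rewrite ltrDl.
  move=> w _; rewrite conjc0 mul0r subr0 -normc_gt0 normcR.
  by rewrite normr_gt0 expf_neq0 // gt_eqF.
have nz : 0 < normc z by rewrite normc_gt0.
exists (r ^+ 2 / normc z); first by rewrite ltr_pdivlMr // expr2 ltr_pM2l.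
move=> w; rewrite ltr_pdivlMr // => hw.
rewrite -normc_gt0; apply: lt_le_trans (ler_normcB _ _).
by rewrite subr_gt0 normcM normc_conj normcR ger0_norm ?sqr_ge0 // mulrC.
Qed.

Lemma derivable_den (k : C) z w : derivable (fun w : C => k - z * w) w 1.
Proof.
exact: derB (der_cst _ _) (derM (der_cst _ _) (der_id _)).
Qed.

(** On the circle [r ^+ 2] is w times its conjugate. So the Cauchy kernel, singular inside the disc,
    is there the conjugate of a function holomorphic on a larger disc, to which the mean value
    property applies. *)
Lemma conj_kernel r z t : r != 0 ->
  conjc ((r ^+ 2)%:C / ((r ^+ 2)%:C - conjc z * circ r t)) = circ r t / (circ r t - z).
Proof.
move=> r0; have c0 : conjc (circ r t) != 0.
  by rewrite conjc_eq0 -normc_eq0 normc_circ normr_eq0.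
rewrite conjcM conjc_inv conjcB conjcM conjcK conjc_real -(conj_circ r t).
by rewrite -mulrBl invfM mulrACA divff // mulr1.
Qed.

Lemma cauchy_kernel_mean r z : normc z < r ->
  cmean (fun t => circ r t / (circ r t - z)) = 1.
Proof.
move=> zr; have r0 : 0 < r by apply: le_lt_trans zr; exact: normc_ge0.
have [rho rrho den] := conj_den zr.
pose F w : C := (r ^+ 2)%:C / ((r ^+ 2)%:C - conjc z * w).
have dF w : normc w < rho -> derivable F w 1.
  move=> hw; apply: derM (der_cst _ _) _.
  by apply: derV; [exact: den|exact: derivable_den].
have cF w : normc w < rho -> {for w, continuous F} by move=> /dF; exact: derivable_cc.
have m1 : cmean (fun t => F (circ r t)) = 1.
  rewrite (@cmean_center _ F rho 0 (lexx _) cF (fun v hv _ _ => dF v hv)) ?r0 //.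
  by rewrite /F mulr0 subr0 divff // -normc_eq0 normcR normr_eq0 expf_neq0 // gt_eqF.
have -> : 1 = conjc 1 :> C by rewrite conjc1.
rewrite -m1 conj_cmean; last first.
  by apply: ccont_circ => t; apply: cF; rewrite normc_circ gtr0_norm.
by apply: eq_cmean => t; rewrite /F conj_kernel // gt_eqF.
Qed.

(** The function w (h w - h z)/(w - z) is continuous, holomorphic off the circle |w| = |z| and zero
    at the origin, so its mean is 0; the mean of the kernel itself is 1 by [cauchy_kernel_mean]. *)
Lemma cauchy_formula h rho r z :
  (forall w, normc w < rho -> derivable h w 1) -> normc z < r -> r < rho ->
  cmean (fun t => h (circ r t) * circ r t / (circ r t - z)) = h z.
Proof.
move=> dh zr rrho; have r0 : 0 < r by apply: le_lt_trans zr; exact: normc_ge0.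
have cr t : normc (circ r t) < rho by rewrite normc_circ gtr0_norm.
pose F w := w * diffq h z w.
have dF w : normc w < rho -> w != 0 -> normc w != normc z -> derivable F w 1.
  move=> hw _ wz; apply: derM (der_id _) _.
  by apply: diffq_derivable; [apply: contra wz => /eqP ->|exact: dh].
have cF w : normc w < rho -> {for w, continuous F}.
  move=> hw; apply: ccM; first exact: cvg_id.
  have [->|wz] := eqVneq w z; first by apply: diffq_cc; apply: dh; exact: lt_trans rrho.
  by apply: derivable_cc; apply: diffq_derivable => //; exact: dh.
have := cmean_center (normc_ge0 z) cF dF (rho := r); rewrite r0 rrho => /(_ isT).
rewrite /F mul0r.
have ch : ccont (fun t => h (circ r t)).
  by apply: ccont_circ => t; apply: derivable_cc; exact: dh.
have c1 := ccont_kernel 1 (ccont_id r) zr.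
have c2 := ccont_kernel 1 (ccontM ch (ccont_id r)) zr.
have -> : cmean (fun t => circ r t * diffq h z (circ r t)) =
  cmean (fun t => h (circ r t) * circ r t / (circ r t - z) - h z * (circ r t / (circ r t - z))).
  apply: eq_cmean => t; have cz := circ_neq t zr.
  rewrite /diffq ifF; last by apply/negbTE; rewrite -subr_eq0.
  by field.
have c3 : ccont (fun t => h z * (circ r t / (circ r t - z))).
  by move=> t ht; apply: ccM; [exact: cc_cst|exact: c1].
by rewrite (cmeanB c2 c3) (cmeanZ (h z) c1) cauchy_kernel_mean // mulr1 => /eqP; rewrite subr_eq0 => /eqP.
Qed.

(** Differentiation under the integral sign; a quadratic remainder uniform in t is available for
    Cauchy kernels and spares dominated convergence. *)
Lemma cmean_derive (k : C -> R -> C) (k' : R -> C) z B del : 0 < del ->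
  (forall w, normc (w - z) < del -> ccont (k w)) -> ccont k' ->
  (forall w t, normc (w - z) < del -> 0 <= t <= 2 * pi ->
     normc (k w t - k z t - (w - z) * k' t) <= B * normc (w - z) ^+ 2) ->
  is_derive z 1 (fun w => cmean (k w)) (cmean k').
Proof.
move=> del0 ck ck' hB; apply/is_deriveCP => e e0.
have kz : ccont (k z) by apply: ck; rewrite subrr (normc0 R).
pose B' := 2 * `|B| + 1.
have B0 : 0 < B' by rewrite ltr_wpDl // mulr_ge0.
exists (Num.min del (e / B')); first by rewrite lt_min del0 divr_gt0.
move=> w; rewrite lt_min => /andP[w1 w2].
have kw := ck w w1.
have c3 : ccont (fun t => (w - z) * k' t) := ccontM (ccont_cst (w - z)) ck'.
have -> : cmean (k w) - cmean (k z) - cmean k' * (w - z) =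
          cmean (fun t => k w t - k z t - (w - z) * k' t).
  by rewrite (cmeanB (continB kw kz) c3) (cmeanB kw kz) (cmeanZ _ ck') [_ * (w - z)]mulrC.
apply: le_trans (normc_cmean (continB (continB kw kz) c3) (fun t => hB w t w1)) _.
set n := normc (w - z) in w1 w2 *.
have n0 : 0 <= n by exact: normc_ge0.
rewrite expr2 !mulrA ler_wpM2r //.
apply: le_trans (_ : B' * n <= e); last by rewrite mulrC -ler_pdivlMr // ltW.
rewrite ler_wpM2r // /B'.
by have := ler_norm B; clear; lra.
Qed.

Section Transform.
Variables (u : R -> C) (r : R) (z : C).
Hypotheses (cu : ccont u) (zr : normc z < r).

Let d := r - normc z.
Let d0 : 0 < d. Proof. by rewrite subr_gt0. Qed.
Let d2 : 0 < d / 2. Proof. by rewrite divr_gt0. Qed.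

Let near_w w : normc (w - z) < d / 2 -> normc w < r.
Proof.
move=> hw; have := normcD (w - z) z; rewrite subrK => h.
by have := d2; move: hw h; rewrite /d; lra.
Qed.

Let far_z t : d <= normc (circ r t - z).
Proof. exact: normc_circB. Qed.

Let far_w w t : normc (w - z) < d / 2 -> d / 2 <= normc (circ r t - w).
Proof.
move=> hw; apply: le_trans (normc_circB r w t).
have := normcD (w - z) z; rewrite subrK => h.
by have := d2; move: hw h; rewrite /d; lra.
Qed.

Lemma transform_derive1 :
  is_derive z 1 (fun w => cmean (fun t => u t / (circ r t - w)))
    (cmean (fun t => u t / (circ r t - z) ^+ 2)).
Proof.
have [M hM] := contin_bounded (twopi_ge0 R) cu.
have M0 : 0 <= M.
  by apply: le_trans (hM 0 _); [exact: normc_ge0|rewrite lexx twopi_ge0].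
(* For w within [d / 2] of z the circle stays at distance [d] from z and [d / 2] from w. *)
apply: (cmean_derive (B := M / (d ^+ 2 * (d / 2))) d2).
- by move=> w hw; exact: (ccont_kernel 1 cu (near_w hw)).
- exact: (ccont_kernel 2 cu zr).
move=> w t hw ht; have x0 := circ_neq t zr; have y0 := circ_neq t (near_w hw).
have -> : u t / (circ r t - w) - u t / (circ r t - z) - (w - z) * (u t / (circ r t - z) ^+ 2)
   = u t / ((circ r t - z) ^+ 2 * (circ r t - w)) * (w - z) ^+ 2.
  by field; rewrite x0 y0.
rewrite normcM normcX ler_wpM2r ?sqr_ge0 // normcM normcV.
apply: ler_pM; [exact: normc_ge0|by rewrite invr_ge0 normc_ge0|exact: hM|].
have dd : 0 < d ^+ 2 * (d / 2) by rewrite mulr_gt0 // exprn_gt0.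
have le : d ^+ 2 * (d / 2) <= normc ((circ r t - z) ^+ 2 * (circ r t - w)).
  rewrite normcM normcX; apply: ler_pM; [by rewrite sqr_ge0|exact: ltW| |exact: far_w].
  by rewrite ler_pXn2r ?nnegrE ?(ltW d0) ?normc_ge0.
by rewrite lef_pV2 // posrE //; exact: lt_le_trans le.
Qed.

Lemma transform_derive2 :
  is_derive z 1 (fun w => cmean (fun t => u t / (circ r t - w) ^+ 2))
    (cmean (fun t => 2 * u t / (circ r t - z) ^+ 3)).
Proof.
have [M hM] := contin_bounded (twopi_ge0 R) cu.
have M0 : 0 <= M.
  by apply: le_trans (hM 0 _); [exact: normc_ge0|rewrite lexx twopi_ge0].
(* The 4 bounds the numerator [3 * x - 2 * (w - z)] of the remainder by [4 * normc x], since
   [2 * normc (w - z)] is below [d], hence below [normc x]. *)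
apply: (cmean_derive (B := M * (4 / (d ^+ 2 * (d / 2) ^+ 2))) d2).
- by move=> w hw; exact: (ccont_kernel 2 cu (near_w hw)).
- exact: (ccont_kernel 3 (ccontM (ccont_cst 2) cu) zr).
move=> w t hw ht; have x0 := circ_neq t zr; have y0 := circ_neq t (near_w hw).
set x := circ r t - z in x0 *; set y := circ r t - w in y0 *.
have -> : u t / y ^+ 2 - u t / x ^+ 2 - (w - z) * (2 * u t / x ^+ 3)
   = u t * ((3 * x - 2 * (w - z)) / (x ^+ 3 * y ^+ 2)) * (w - z) ^+ 2.
  have -> : w - z = x - y by rewrite /x /y; ring.
  by field; rewrite x0 y0.
rewrite normcM [normc (_ ^+ 2)]normcX ler_wpM2r ?sqr_ge0 // normcM.
have fz : d <= normc x := far_z t.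
have fw : d / 2 <= normc y := far_w t hw.
have nx : 0 < normc x by apply: lt_le_trans fz.
apply: ler_pM; [exact: normc_ge0|exact: normc_ge0|exact: hM|].
have n3 : normc (3 * x - 2 * (w - z)) <= 4 * normc x.
  apply: le_trans (normcB_le _ _) _; rewrite !normcM.
  have -> : normc (3 : C) = 3 by rewrite (_ : (3 : C) = 3%:C) ?normcR ?ger0_norm // rmorph_nat.
  have -> : normc (2 : C) = 2 by rewrite (_ : (2 : C) = 2%:C) ?normcR ?ger0_norm // rmorph_nat.
  by move: hw fz; lra.
rewrite normcM normcV normcM !normcX.
have e1 : 4 / (d ^+ 2 * (d / 2) ^+ 2) = (4 * d) / (d ^+ 3 * (d / 2) ^+ 2).
  by field; rewrite gt_eqF.
have ny : 0 < normc y by apply: lt_le_trans fw.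
apply: le_trans (_ : 4 / (normc x ^+ 2 * normc y ^+ 2) <= _).
  have -> : 4 / (normc x ^+ 2 * normc y ^+ 2) = (4 * normc x) / (normc x ^+ 3 * normc y ^+ 2).
    by field; rewrite !gt_eqF.
  by rewrite ler_wpM2r // invr_ge0 mulr_ge0 // exprn_ge0 // ltW.
rewrite ler_pM2l // lef_pV2 ?posrE ?mulr_gt0 ?exprn_gt0 //.
by apply: ler_pM; rewrite ?sqr_ge0 // ler_pXn2r ?nnegrE ?(ltW d0) ?(ltW d2) ?normc_ge0.
Qed.

End Transform.

(** By Cauchy's formula h is locally a Cauchy transform: one differentiation turns h' into a mean
    over the squared kernel, and the second shows that this mean is differentiable. *)
Lemma derivable_derive1 h rho :
  (forall w, normc w < rho -> derivable h w 1) ->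
  forall z, normc z < rho -> derivable (derive1 h) z 1.
Proof.
move=> dh z zr; pose r := (normc z + rho) / 2.
have zr1 : normc z < r by rewrite /r; lra.
have rr : r < rho by rewrite /r; lra.
have r0 : 0 < r by apply: le_lt_trans zr1; exact: normc_ge0.
pose u t := h (circ r t) * circ r t.
have cu : ccont u.
  apply: ccontM; last exact: ccont_id.
  apply: ccont_circ => t; apply: derivable_cc; apply: dh.
  by rewrite normc_circ gtr0_norm.
have nz : \forall w \near z, normc w < r.
  apply/nbhsCP; exists (r - normc z); split; first by rewrite subr_gt0.
  by move=> w; have := normcD (w - z) z; rewrite subrK; clear; lra.
have hE : forall w, normc w < r -> derive1 h w = cmean (fun t => u t / (circ r t - w) ^+ 2).
  move=> w wr; rewrite derive1E.
  have D := transform_derive1 cu wr.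
  rewrite -(@derive_val _ _ _ _ _ _ _ D); apply: near_eq_derive.
  apply/nbhsCP; exists (r - normc w); split; first by rewrite subr_gt0.
  move=> v hv; rewrite (cauchy_formula dh _ rr) //.
  by move: hv; have := normcD (v - w) w; rewrite subrK; clear; lra.
apply: (@near_eq_derivable _ _ _ (fun w => cmean (fun t => u t / (circ r t - w) ^+ 2))).
  by apply: filterS nz => w /hE.
by have [] := transform_derive2 cu zr1.
Qed.

End CauchyFormula.

(** * Logarithmic derivatives of zero-free functions *)

Section ZeroFree.
Variable R : realType.
Notation C := (R[i] : numFieldType).
Notation ccont := (contin 0 (2 * pi)).
Notation rcont := (continR 0 (2 * pi)).
Implicit Types (F h g : C -> C) (z w D : C) (r s t e : R).

(** Componentwise, so that the real fundamental theorem of calculus and the real logarithm apply to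
    curves. *)
Definition cderiv (c : R -> C) t D :=
  is_derive t 1 (fun t => Re (c t)) (Re D) /\
  is_derive t 1 (fun t => Im (c t)) (Im D).

Lemma cderivP (c : R -> C) t D : (forall e, 0 < e -> exists2 del, 0 < del &
    forall k : R, `|k| < del -> normc (c (k + t) - c t - D * k%:C) <= e * `|k|) ->
  cderiv c t D.
Proof.
move=> hD; split; apply/is_derive_expansion => e e0; have [del del0 hdel] := hD e e0;
 apply/nbhs_ballP; exists del => // k; rewrite /ball /= sub0r normrN => /hdel hk;
 apply: le_trans hk.
- apply: le_trans (normc_Re _); rewrite le_eqVlt; apply/orP; left; apply/eqP.
  congr (`|_|); case: (c _) => ? ?; case: (c _) => ? ?.
  by case: (D) => ? ? /=; ring.
- apply: le_trans (normc_Im _); rewrite le_eqVlt; apply/orP; left; apply/eqP.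
  congr (`|_|); case: (c _) => ? ?; case: (c _) => ? ?.
  by case: (D) => ? ? /=; ring.
Qed.

Lemma cderiv_circ F r t D : 0 < r -> is_derive (circ r t) 1 F D ->
  cderiv (fun t => F (circ r t)) t (D * circ r t * 'i%C).
Proof.
move=> r0 hD; apply: cderivP => e e0; rewrite -(lnK r0) in hD.
have [del del0 h] := polar_deriv hD e0; exists del => // k hk.
have := h (ln r) (k + t); rewrite subrr normr0 addrK => /(_ del0 hk).
rewrite add0r (lnK r0) => h1.
suff -> : D * circ r t * 'i%C * k%:C = D * circ r t * ci 0 k by [].
rewrite -[LHS]mulrA; congr (_ * _).
by apply/eqP; rewrite eq_complex /=; apply/andP; split; apply/eqP; ring.
Qed.

Lemma cderiv_ray F z s D : is_derive (s%:C * z : C) 1 F D ->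
  cderiv (fun s => F (s%:C * z)) s (D * z).
Proof.
move=> /is_deriveCP hD; apply: cderivP => e e0.
have n0 : 0 < normc z + 1 by rewrite ltr_wpDl // normc_ge0.
have e1 : 0 < e / (normc z + 1) by rewrite divr_gt0.
have [del del0 h] := hD _ e1; exists (del / (normc z + 1)); first by rewrite divr_gt0.
move=> k hk; have kz : (k + s)%:C * z - s%:C * z = k%:C * z.
  by rewrite -mulrBl -rmorphB addrK.
have nk : normc ((k + s)%:C * z - s%:C * z) <= `|k| * (normc z + 1).
  by rewrite kz normcM normcR ler_wpM2l // lerDl.
have lt : normc ((k + s)%:C * z - s%:C * z) < del.
  by apply: le_lt_trans nk _; rewrite -ltr_pdivlMr.
have hh := h _ lt; rewrite {1}kz in hh.
have -> : D * z * k%:C = D * (k%:C * z) by ring.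
apply: le_trans hh _.
apply: le_trans (ler_wpM2l (ltW e1) nk) _.
by rewrite [`|k| * _]mulrC mulrA divfK // gt_eqF.
Qed.

Lemma normc_sq w : normc w ^+ 2 = Re w ^+ 2 + Im w ^+ 2.
Proof. by case: w => a b; rewrite sqr_sqrtr // addr_ge0 // sqr_ge0. Qed.

Lemma ln_normc w : ln (normc w) = 2^-1 * ln (Re w ^+ 2 + Im w ^+ 2).
Proof.
rewrite -normc_sq; have [->|w0] := eqVneq w 0.
  by rewrite (normc0 R) expr0n /= ln0 // mulr0.
by rewrite lnXn ?normc_gt0 // -[ln _ *+ 2]mulr_natl mulKf.
Qed.

Lemma rdM (u v : R -> R) t (du dv : R) : is_derive t 1 u du -> is_derive t 1 v dv ->
  is_derive t 1 (fun s => u s * v s : R) (u t * dv + v t * du).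
Proof. exact: is_deriveM. Qed.

Lemma rdD (u v : R -> R) t (du dv : R) : is_derive t 1 u du -> is_derive t 1 v dv ->
  is_derive t 1 (fun s => u s + v s : R) (du + dv).
Proof. exact: is_deriveD. Qed.

Lemma rd_ln (v : R -> R) t (dv : R) : 0 < v t -> is_derive t 1 v dv ->
  is_derive t 1 (fun s => ln (v s)) (dv / v t).
Proof.
move=> v0 hv; rewrite mulrC.
exact: (@is_derive1_comp _ (@ln R) v t _ _ (is_derive1_ln v0) hv).
Qed.

Lemma cderiv_ln_normc (c : R -> C) t D : cderiv c t D -> c t != 0 ->
  is_derive t 1 (fun t => ln (normc (c t))) (Re (D / c t)).
Proof.
move=> [hR hI] c0.
have -> : (fun t => ln (normc (c t))) =
   (fun t => 2^-1 * ln (Re (c t) * Re (c t) + Im (c t) * Im (c t))).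
  by apply/funext => s; rewrite ln_normc !expr2.
have pos : 0 < Re (c t) * Re (c t) + Im (c t) * Im (c t).
  by rewrite -!expr2 -normc_sq exprn_gt0 // normc_gt0.
have h1 := rd_ln (v := fun s => Re (c s) * Re (c s) + Im (c s) * Im (c s)) pos
  (rdD (rdM hR hR) (rdM hI hI)).
apply: is_derive_eq (is_deriveZ 2^-1 h1) _; rewrite /GRing.scale /=.
case: (c t) pos => a b /= pos; case: (D) => p q /=.
rewrite !expr2; have ab : a * a + b * b != 0 by rewrite gt_eqF.
by field.
Qed.

Lemma rder_cc (v : R -> R) t (dv : R) : is_derive t 1 v dv -> {for t, continuous v}.
Proof. by move=> [h _]; apply: differentiable_continuous; exact/derivable1_diffP. Qed.

Lemma rint_FTC (v v' : R -> R) a b : a < b -> (forall t, is_derive t 1 v (v' t)) ->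
  continR a b v' -> rint a b v' = v b - v a.
Proof.
move=> ab dv cv.
have cc t : {for t, continuous v} := rder_cc (dv t).
rewrite /rint /Rintegral (@continuous_FTC2 R v' v a b ab) //.
- by apply: continuous_in_subspaceT => x /[!inE]/=; rewrite in_itv /=; exact: cv.
- split; first by move=> x _; have [] := dv x.
    by apply: cvg_at_right_filter; exact: cc.
  by apply: cvg_at_left_filter; exact: cc.
- by move=> x _; rewrite derive1E; have [_ ->] := dv x.
Qed.

Lemma cint_FTC (c c' : R -> C) a b : a < b -> (forall t, cderiv c t (c' t)) ->
  contin a b c' -> cint a b c' = c b - c a.
Proof.
move=> ab dc cc; rewrite /cint.
rewrite (rint_FTC ab (fun t => (dc t).1) (contin_Re cc)).
rewrite (rint_FTC ab (fun t => (dc t).2) (contin_Im cc)).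
by case: (c b) => ? ?; case: (c a) => ? ?.
Qed.

Definition rmean (u : R -> R) : R := (2 * pi)^-1 * rint 0 (2 * pi) u.

Lemma Re_cmean (u : R -> C) : Re (cmean u) = rmean (fun t => Re (u t)).
Proof. by rewrite /cmean /cint /rmean /= mul0r subr0. Qed.

Lemma rmeanD u v : rcont u -> rcont v ->
  rmean (fun t => u t + v t) = rmean u + rmean v.
Proof. by move=> hu hv; rewrite /rmean rintD // mulrDr. Qed.

Lemma rmeanZ k u : rcont u -> rmean (fun t => k * u t) = k * rmean u.
Proof. by move=> hu; rewrite /rmean rintZ // mulrCA. Qed.

Lemma rmean_cst k : rmean (fun=> k) = k.
Proof.
rewrite /rmean rint_cst ?twopi_ge0 // subr0 mulrA mulVf ?mul1r //.
by rewrite gt_eqF // twopi_gt0.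
Qed.

Lemma rmean_le u v : rcont u -> rcont v ->
  (forall t, 0 <= t <= 2 * pi -> u t <= v t) -> rmean u <= rmean v.
Proof.
move=> hu hv h; rewrite /rmean ler_pM2l; first exact: rint_le.
by rewrite invr_gt0 twopi_gt0.
Qed.

Lemma eq_rmean u v : (forall t, 0 <= t <= 2 * pi -> u t = v t) -> rmean u = rmean v.
Proof. by move=> h; rewrite /rmean (eq_rint h). Qed.

Lemma normc_cmean_le u : ccont u ->
  normc (cmean u) <= 2 * rmean (fun t => normc (u t)).
Proof.
move=> hu; rewrite /cmean normcM normcR ger0_norm ?invr_ge0 ?twopi_ge0 //.
rewrite /rmean mulrCA ler_pM2l; last by rewrite invr_gt0 twopi_gt0.
exact: normc_cint_le.
Qed.

Lemma Re_RC (x : R) w : Re (x%:C * w) = x * Re w.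
Proof. by case: w => a b /=; ring. Qed.

Lemma Im_RC (x : R) w : Im (x%:C * w) = x * Im w.
Proof. by case: w => a b /=; ring. Qed.

Lemma is_derive_inv_sub (z w : C) : w - z != 0 ->
  is_derive w 1 (fun v : C => (v - z)^-1 : C) (- (w - z) ^- 2).
Proof.
move=> h; have dw := derB (der_id w) (der_cst z w).
have dv := derV (F := fun v : C => v - z) h dw.
have e1 : 'D_1 (fun v : C => v - z : C) w = 1.
  have := deriveB (der_id w) (der_cst z w); rewrite derive_id derive_cst subr0.
  exact.
have e2 := deriveV (f := fun v : C => v - z) h dw.
rewrite e1 in e2; apply: (DeriveDef dv).
by rewrite e2 [LHS]mulr1.
Qed.

Section OneFunction.
Variables (g : C -> C) (rho : R).
Hypothesis dg : forall w, normc w < rho -> derivable g w 1.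
Hypothesis g0 : forall w, normc w < rho -> g w != 0.

Let L w := 'D_1 g w / g w.

Let dL w : normc w < rho -> derivable L w 1.
Proof.
move=> hw; apply: derM; last by apply: derV; [exact: g0|exact: dg].
have -> : (fun w => 'D_1 g w) = derive1 g by apply/funext => v; rewrite derive1E.
exact: derivable_derive1 hw.
Qed.

Let on_circ r t : 0 < r -> r < rho -> normc (circ r t) < rho.
Proof. by move=> r0; rewrite normc_circ gtr0_norm. Qed.

Definition logn g r t := ln (normc (g (circ r t))).

Let log_deriv_circ r t : 0 < r -> r < rho ->
  is_derive t 1 (logn g r) (- Im (circ r t * L (circ r t))).
Proof.
move=> r0 rr; have hz := on_circ t r0 rr.
have h1 := cderiv_circ r0 (derivableP (dg hz)).
apply: is_derive_eq (cderiv_ln_normc h1 (g0 hz)) _.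
have -> : 'D_1 g (circ r t) * circ r t * 'i%C / g (circ r t) =
   (circ r t * L (circ r t)) * 'i%C by rewrite /L mulrAC [in RHS]mulrA [circ r t * _]mulrC.
exact: ReiNIm.
Qed.

Lemma cc_logn r t : 0 < r -> r < rho -> {for t, continuous (logn g r)}.
Proof.
move=> r0 rr; exact: rder_cc (log_deriv_circ t r0 rr).
Qed.

(** Put [W] = w L(w) on the circle, where L = g'/g. Cauchy's formula makes L z the mean of [W] over
    w - z, and the conjugate of [W] gives mean 0; so only Im [W] matters. It is minus the derivative
    of log |g| in the angle, and integration by parts moves that derivative onto the kernel. The
    result is the derivative of Schwarz's formula for log g, obtained without a logarithm of g. *)
Lemma log_deriv_formula r z : normc z < r -> r < rho ->
  'D_1 g z / g z =
  2 * cmean (fun t => (logn g r t)%:C * circ r t / (circ r t - z) ^+ 2).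
Proof.
move=> zr rr; have r0 : 0 < r by apply: le_lt_trans zr; exact: normc_ge0.
have zrho := lt_trans zr rr.
pose W t : C := circ r t * L (circ r t).
have cW : ccont W.
  apply: ccontM; first exact: ccont_id.
  by apply: ccont_circ => t; apply: derivable_cc; apply: dL; exact: on_circ.
have cJ : ccont (fun t => conjc (W t) : C).
  by move=> t ht; apply: cvg_conjc; exact: cW.
have cu : ccont (fun t => (logn g r t)%:C : C).
  by move=> t _; apply: cvg_RC; exact: cc_logn.
have i1 : cmean (fun t => W t / (circ r t - z)) = L z.
  by rewrite -(cauchy_formula dL zr rr); apply: eq_cmean => t; rewrite /W [circ r t * _]mulrC.
(* On the circle this is the conjugate of [F], which is holomorphic on a larger disc and vanishes at
   0. *)
have i2 : cmean (fun t => conjc (W t) / (circ r t - z)) = 0.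
  have [rho2 rrho2 den] := conj_den zr.
  pose F w : C := w ^+ 2 * L w / ((r ^+ 2)%:C - conjc z * w).
  pose rm := Num.min rho rho2.
  have dF w : normc w < rm -> derivable F w 1.
    rewrite lt_min => /andP[w1 w2]; apply: derM.
      by apply: derM; [exact: derX (der_id _)|exact: dL].
    by apply: derV; [exact: den|exact: derivable_den].
  have cF w : normc w < rm -> {for w, continuous F} by move=> /dF; exact: derivable_cc.
  have m1 : cmean (fun t => F (circ r t)) = 0.
    rewrite (@cmean_center _ F rm 0 (lexx _) cF (fun v hv _ _ => dF v hv)).
      by rewrite /F expr0n /= !mul0r.
    by rewrite r0 lt_min rr.
  have -> : 0 = conjc 0 :> C by rewrite conjc0.
  rewrite -m1 conj_cmean; last first.
    by apply: ccont_circ => t; apply: cF; rewrite normc_circ gtr0_norm // lt_min rr.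
  apply: eq_cmean => t.
  have r2 : (r ^+ 2)%:C != 0 :> C by rewrite -normc_eq0 normcR normr_eq0 expf_neq0 // gt_eqF.
  have -> : F (circ r t) = W t * (circ r t / (r ^+ 2)%:C) *
       ((r ^+ 2)%:C / ((r ^+ 2)%:C - conjc z * circ r t)).
    have d0 := den (circ r t); rewrite normc_circ gtr0_norm // in d0; have rr2 := rrho2.
    move: (d0 rr2) r2; rewrite /F /W; move: ((r ^+ 2)%:C) => q q1 q2.
    by field; rewrite q1 q2.
  rewrite conjcM conj_kernel ?gt_eqF // conjcM -mulrA; congr (_ * _).
  rewrite conjcM conjc_inv conjc_real mulrA [conjc _ * _ * _]mulrAC [conjc _ * _]mulrC.
  by rewrite conj_circ mulfV // mul1r.
have k1 := ccont_kernel 1 cW zr; have k2 := ccont_kernel 1 cJ zr.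
have k3 := ccont_kernel 2 (ccontM cu (ccont_id r)) zr.
pose k t : C := (circ r t - z)^-1.
(* The boundary term of the integration by parts: [V] is periodic, so the mean of [V'] is 0. *)
pose V t : C := (logn g r t)%:C * k t.
pose V' t : C := (- Im (W t))%:C * k t +
  (logn g r t)%:C * (- (circ r t * 'i%C) / (circ r t - z) ^+ 2).
have dV t : cderiv V t (V' t).
  have h1 := log_deriv_circ t r0 rr.
  have hk := is_derive_inv_sub (circ_neq t zr).
  have [hR hI] := cderiv_circ r0 hk.
  have kE : - (circ r t - z) ^- 2 * circ r t * 'i%C =
            - (circ r t * 'i%C) / (circ r t - z) ^+ 2 by ring.
  rewrite kE in hR hI; split.
    have -> : (fun t => Re (V t)) = (fun t => logn g r t * Re (k t)).
      by apply/funext => s; rewrite /V Re_RC.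
    apply: is_derive_eq (rdM h1 hR) _; rewrite /V' raddfD /= !Re_RC -/(k t) -/(W t).
    by rewrite addrC [_ * - _]mulrC.
  have -> : (fun t => Im (V t)) = (fun t => logn g r t * Im (k t)).
    by apply/funext => s; rewrite /V Im_RC.
  apply: is_derive_eq (rdM h1 hI) _; rewrite /V' raddfD /= !Im_RC -/(k t) -/(W t).
  by rewrite addrC [_ * - _]mulrC.
pose X := cmean (fun t => (logn g r t)%:C * circ r t / (circ r t - z) ^+ 2).
have k4 : ccont (fun t => W t / (circ r t - z) - conjc (W t) / (circ r t - z)).
  exact: continB k1 k2.
have k5 := ccontM (ccont_cst ('i%C / 2)) k4; have k6 := ccontM (ccont_cst 'i%C) k3.
have VE t : V' t = 'i%C / 2 * (W t / (circ r t - z) - conjc (W t) / (circ r t - z))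
     - 'i%C * ((logn g r t)%:C * circ r t / (circ r t - z) ^+ 2).
  rewrite /V' /k; have -> : (- Im (W t))%:C = 'i%C / 2 * (W t - conjc (W t)).
    have -> : W t - conjc (W t) = 2 * ('i%C * (Im (W t))%:C).
      case: (W t) => a b; apply/eqP; rewrite -[2]/(1 + 1) mulrDl mul1r eq_complex /=.
      by apply/andP; split; apply/eqP; ring.
    have -> : 'i%C / 2 * (2 * ('i%C * (Im (W t))%:C)) = 'i%C ^+ 2 * (Im (W t))%:C by field.
    rewrite sqr_i mulN1r.
    by apply/eqP; rewrite eq_complex /= oppr0 !eqxx.
  by field; exact: circ_neq.
have V'E : V' = fun t => 'i%C / 2 * (W t / (circ r t - z) - conjc (W t) / (circ r t - z))
     - 'i%C * ((logn g r t)%:C * circ r t / (circ r t - z) ^+ 2) by apply/funext.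
have cV' : ccont V' by rewrite V'E; exact: continB k5 k6.
have : cmean V' = 0.
  by rewrite /cmean (cint_FTC (twopi_gt0 R) dV cV') /V /k /logn circ_2pi subrr mulr0.
rewrite V'E (cmeanB k5 k6) (cmeanZ _ k4) (cmeanZ _ k3) (cmeanB k1 k2) i1 i2 subr0 -/X.
move/eqP; rewrite subr_eq0 mulrAC => /eqP h.
have i0 : 'i%C != 0 :> C by rewrite eq_complex /= oner_eq0 andbF.
have := congr1 (fun x => 2 * ('i%C)^-1 * x) h.
have -> : 2 * ('i%C)^-1 * ('i%C * L z / 2) = L z by field.
by have -> : 2 * ('i%C)^-1 * ('i%C * X) = 2 * X by field.
Qed.

Lemma normc_log_deriv r z : normc z < r -> r < rho ->
  normc ('D_1 g z / g z) <=
  4 * (r / (r - normc z) ^+ 2) * rmean (fun t => `|logn g r t|).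
Proof.
move=> zr rr; have r0 : 0 < r by apply: le_lt_trans zr; exact: normc_ge0.
have d0 : 0 < r - normc z by rewrite subr_gt0.
have cl : rcont (logn g r) by move=> t _; exact: cc_logn.
have cal : rcont (fun t => `|logn g r t|).
  by move=> t ht; exact: (cvg_norm (cl t ht)).
have cu : ccont (fun t => (logn g r t)%:C : C).
  by move=> t ht; apply: cvg_RC; exact: cl.
have k3 := ccont_kernel 2 (ccontM cu (ccont_id r)) zr.
rewrite (log_deriv_formula zr rr) normcM.
have -> : normc (2 : C) = 2 by rewrite (_ : (2 : C) = 2%:C) ?normcR ?ger0_norm // rmorph_nat.
(* One factor 2 is that of the formula, the other the loss in [normc_cmean_le]. *)
apply: le_trans (_ : 2 * (2 * rmean (fun t => (r / (r - normc z) ^+ 2) * `|logn g r t|)) <= _).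
  rewrite ler_pM2l //; apply: le_trans (normc_cmean_le k3) _.
  rewrite ler_pM2l //; apply: rmean_le => [|t ht|t ht].
  - exact: contin_normc.
  - by apply: cvgM; [exact: cvg_cst|exact: cal].
  rewrite !normcM normcV normcX normcR normc_circ (gtr0_norm r0).
  rewrite [X in X <= _](_ : _ = `|logn g r t| * (r / normc (circ r t - z) ^+ 2)); last by ring.
  rewrite [X in _ <= X](_ : _ = `|logn g r t| * (r / (r - normc z) ^+ 2)); last by ring.
  apply: ler_wpM2l => //; apply: ler_wpM2l; first exact: ltW.
  have h := normc_circB r z t; have h0 := lt_le_trans d0 h.
  rewrite lef_pV2 ?posrE ?exprn_gt0 //.
  by apply: lerXn2r; rewrite ?nnegrE // ltW.
rewrite rmeanZ // le_eqVlt; apply/orP; left; apply/eqP; ring.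
Qed.

End OneFunction.
End ZeroFree.

(** * The circle mean of log |g| *)

Section MeanLog.
Variable R : realType.
Notation C := (R[i] : numFieldType).
Notation ccont := (contin 0 (2 * pi)).
Notation rcont := (continR 0 (2 * pi)).
Implicit Types (F h g : C -> C) (z w D : C) (r s t e : R).

(** A primitive F of g'/g acts as a logarithm of g: along each ray from the origin, log |g| - Re F
    has derivative 0. *)
Lemma cst_on_ray (F g : C -> C) rho :
  (forall w, normc w < rho -> g w != 0) ->
  (forall w, normc w < rho -> derivable g w 1) ->
  (forall w, normc w < rho -> is_derive w 1 F ('D_1 g w / g w)) ->
  forall z, normc z < rho -> ln (normc (g z)) - Re (F z) = ln (normc (g 0)) - Re (F 0).
Proof.
move=> g0 dg dF z hz.
pose v (s : R) : R := ln (normc (g (s%:C * z))) - Re (F (s%:C * z)).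
have small s : 0 <= s <= 1 -> normc (s%:C * z : C) < rho.
  move=> /andP[s0 s1]; rewrite normcM normcR ger0_norm //.
  by apply: le_lt_trans hz; rewrite ler_piMl // normc_ge0.
have dv s : 0 <= s <= 1 -> is_derive s 1 v 0.
  move=> hs; have hw := small s hs.
  have h1 := cderiv_ln_normc (cderiv_ray (derivableP (dg _ hw))) (g0 _ hw).
  have [h2 _] := cderiv_ray (dF _ hw).
  apply: is_derive_eq (is_deriveB h1 h2) _.
  by rewrite mulrAC subrr.
have [| |c hc hE] := @MVT_segment R v (fun=> 0) 0 1 ler01.
- by move=> x; rewrite in_itv /= => /andP[x0 x1]; apply: dv; rewrite !ltW.
- apply: continuous_in_subspaceT => x /[!inE]/=; rewrite in_itv /= => hx.
  exact: rder_cc (dv x hx).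
move: hE; rewrite mul0r => /eqP; rewrite subr_eq0 /v => /eqP.
by rewrite mul1r mul0r.
Qed.

(** [S] is the Schwarz integral of log |g| over the larger circle [r2]. By [log_deriv_formula] it is
    a primitive of g'/g, so log |g| is Re S up to a constant, and S has the mean value property. *)
Lemma mean_logn g rho r :
  (forall w, normc w < rho -> derivable g w 1) ->
  (forall w, normc w < rho -> g w != 0) ->
  0 < r -> r < rho -> rmean (logn g r) = ln (normc (g 0)).
Proof.
move=> dg g0 r0 rr; pose r2 := (r + rho) / 2.
have rr2 : r < r2 by rewrite /r2; lra.
have r2r : r2 < rho by rewrite /r2; lra.
have r20 : 0 < r2 by exact: lt_trans rr2.
have cu : ccont (fun t => (logn g r2 t)%:C * circ r2 t : C).
  apply: ccontM; last exact: ccont_id.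
  by move=> t ht; apply: cvg_RC; exact: (cc_logn dg g0).
pose S w : C := 2 * cmean (fun t => (logn g r2 t)%:C * circ r2 t / (circ r2 t - w)).
have dS w : normc w < r2 -> is_derive w 1 S ('D_1 g w / g w).
  move=> hw; rewrite (log_deriv_formula dg g0 hw r2r).
  have h1 := transform_derive1 cu hw.
  have D := is_deriveZ (2 : C) h1.
  exact: D.
have g0' w : normc w < r2 -> g w != 0 by move=> h; apply: g0; exact: lt_trans r2r.
have dg' w : normc w < r2 -> derivable g w 1 by move=> h; apply: dg; exact: lt_trans r2r.
have cst := cst_on_ray g0' dg' dS.
have derS w : normc w < r2 -> derivable S w 1 by move=> /dS [].
have cS w : normc w < r2 -> {for w, continuous S} by move=> /derS; exact: derivable_cc.
have cSc : ccont (fun t => S (circ r t)).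
  by apply: ccont_circ => t; apply: cS; rewrite normc_circ gtr0_norm.
have mS : cmean (fun t => S (circ r t)) = S 0.
  apply: (@cmean_center _ S r2 0 (lexx _) cS (fun v hv _ _ => derS v hv)).
  by rewrite r0.
have -> : rmean (logn g r) = rmean (fun t => Re (S (circ r t)) + (ln (normc (g 0)) - Re (S 0))).
  apply: eq_rmean => t _; rewrite -(cst (circ r t)) ?normc_circ ?gtr0_norm //.
  by rewrite addrC subrK.
rewrite rmeanD; [|exact: contin_Re|by move=> t _; exact: cvg_cst].
by rewrite rmean_cst -Re_cmean mS addrC subrK.
Qed.

End MeanLog.

(** * Orders of meromorphic functions *)

Section Local.
Variable R : realType.
Notation C := (R[i] : numFieldType).
Notation ccont := (contin 0 (2 * pi)).
Implicit Types (F G h g k : C -> C) (z w D : C) (r s t e rho : R).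

Lemma is_derive_shift F z w D : is_derive (w + z : C) 1 F D <->
  is_derive w 1 (fun v => F (v + z)) D.
Proof.
rewrite !is_deriveCP; split=> H e e0; have [del del0 hd] := H e e0; exists del => // v hv.
  have := hd (v + z); rewrite opprD addrACA subrr addr0 => /(_ hv).
  exact.
have := hd (v - z); rewrite subrK (_ : v - z - w = v - (w + z)); last by ring.
by move=> /(_ hv).
Qed.

Lemma derivable_shift F z w : derivable F (w + z) 1 -> derivable (fun v => F (v + z)) w 1.
Proof. by move=> /derivableP /is_derive_shift []. Qed.

Lemma derivable_unshift F z w : derivable (fun v => F (v + z)) w 1 -> derivable F (w + z) 1.
Proof. by move=> /derivableP /is_derive_shift []. Qed.

Lemma derive1_shift F z w : derivable F (w + z) 1 ->
  derive1 (fun v => F (v + z)) w = derive1 F (w + z).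
Proof. by move=> /derivableP /is_derive_shift [_]; rewrite !derive1E. Qed.

Lemma der_ext F G z : (\forall w \near z, F w = G w) ->
  derivable F z 1 -> derivable G z 1.
Proof. exact: near_eq_derivable. Qed.

Lemma holP F z : holomorphic_at F z <->
  exists e, 0 < e /\ forall w, normc (w - z) < e -> derivable F w 1.
Proof. exact: nbhsCP. Qed.

Lemma hol_derivable F z : holomorphic_at F z -> derivable F z 1.
Proof. by move=> /holP [e [e0]]; apply; rewrite subrr (normc0 R). Qed.

Lemma hol_cc F z : holomorphic_at F z -> {for z, continuous F}.
Proof. by move=> /hol_derivable; exact: derivable_cc. Qed.

Lemma hol_near F z : holomorphic_at F z -> \forall w \near z, holomorphic_at F w.
Proof. by move=> h; have := nbhs_interior h; apply: filterS. Qed.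

Lemma hol_cst (c : C) z : holomorphic_at (fun _ : C => c) z.
Proof. by apply: filterE => w; exact: der_cst. Qed.

Lemma hol_id z : holomorphic_at (fun w : C => w) z.
Proof. by apply: filterE => w; exact: der_id. Qed.

Lemma holD F G z : holomorphic_at F z -> holomorphic_at G z ->
  holomorphic_at (fun w => F w + G w) z.
Proof. by move=> hF hG; apply: filterS2 hF hG => w; exact: derD. Qed.

Lemma holB F G z : holomorphic_at F z -> holomorphic_at G z ->
  holomorphic_at (fun w => F w - G w) z.
Proof. by move=> hF hG; apply: filterS2 hF hG => w; exact: derB. Qed.

Lemma holM F G z : holomorphic_at F z -> holomorphic_at G z ->
  holomorphic_at (fun w => F w * G w) z.
Proof. by move=> hF hG; apply: filterS2 hF hG => w; exact: derM. Qed.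

Lemma holX F z n : holomorphic_at F z -> holomorphic_at (fun w => F w ^+ n) z.
Proof. by move=> hF; apply: filterS hF => w; exact: derX. Qed.

Lemma cc_neq0 F z : {for z, continuous F} -> F z != 0 -> \forall w \near z, F w != 0.
Proof.
move=> /ccP cF F0; have n0 : 0 < normc (F z) by rewrite normc_gt0.
have [del d0 hd] := cF _ n0; apply/nbhsCP; exists del; split => // w /hd.
by case: eqP => // ->; rewrite sub0r normcN ltxx.
Qed.

Lemma holV F z : F z != 0 -> holomorphic_at F z ->
  holomorphic_at (fun w => (F w)^-1) z.
Proof.
move=> F0 hF; have := cc_neq0 (hol_cc hF) F0.
by apply: filterS2 hF => w; move=> h1 h2; exact: derV.
Qed.

Lemma hol_ext F G z : (\forall w \near z, F w = G w) ->
  holomorphic_at F z -> holomorphic_at G z.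
Proof.
move=> FG hF; have := nbhs_interior FG; apply: filterS2 hF => w dF FGw.
exact: der_ext FGw dF.
Qed.

Lemma hol_sub z0 z : holomorphic_at (fun w : C => w - z0) z.
Proof. exact: holB (hol_id z) (hol_cst z0 z). Qed.

Lemma hol_exprz z0 z (n : int) : z != z0 -> holomorphic_at (fun w : C => (w - z0) ^ n) z.
Proof.
move=> zz0; have h := holX `|n| (hol_sub z0 z).
case: (intP n) h => [|m|m] h; first exact: hol_cst.
  exact: h.
apply: hol_ext (holV _ h); last by rewrite expf_neq0 // subr_eq0.
by apply: filterE => w; rewrite exprnN abszN.
Qed.

Lemma hol_derive1 F z : holomorphic_at F z -> holomorphic_at (derive1 F) z.
Proof.
move=> /holP [e [e0 he]].
have d1 w : normc w < e -> derivable (fun v => F (v + z)) w 1.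
  by move=> hw; apply: derivable_shift; apply: he; rewrite addrK.
apply/holP; exists e; split; [exact: e0|move=> w hw].
have hin : \forall v \near (w - z : C), derive1 (fun v => F (v + z)) v = derive1 F (v + z).
  apply/nbhsCP; exists (e - normc (w - z)); split; first by rewrite subr_gt0.
  move=> v hv; apply: derive1_shift; apply: he; rewrite addrK.
  have := normcD (v - (w - z)) (w - z); rewrite subrK.
  by move: hv; clear; lra.
have H := der_ext hin (derivable_derive1 d1 hw).
have := derivable_unshift (F := derive1 F) H.
by rewrite subrK.
Qed.

Lemma punct_eq F G z : {for z, continuous F} -> {for z, continuous G} ->
  (\forall w \near z^', F w = G w) -> F z = G z.
Proof.
move=> /ccP cF /ccP cG /dnbhsCP [d [d0 hd]].
apply/eqP; rewrite -subr_eq0 -normc_eq0 eq_le normc_ge0 andbT.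
apply/ler_addgt0Pr => e e0; rewrite add0r.
have e2 : 0 < e / 2 by rewrite divr_gt0.
have [d1 d10 h1] := cF _ e2; have [d2 d20 h2] := cG _ e2.
pose m := Num.min d (Num.min d1 d2) / 2.
have m0 : 0 < m by rewrite divr_gt0 // !lt_min d0 d10.
have nm : normc (z + m%:C - z) = m by rewrite addrAC subrr add0r normcR gtr0_norm.
have mm : m < Num.min d (Num.min d1 d2) by rewrite /m in m0 *; lra.
move: mm; rewrite !lt_min => /and3P[l l1 l2].
have E := hd (z + m%:C) _ _; rewrite nm in E.
have := h1 (z + m%:C); have := h2 (z + m%:C); rewrite nm => /(_ l2) k2 /(_ l1) k1.
rewrite E // in k1; last by rewrite -subr_eq0 -normc_eq0 nm gt_eqF.
have -> : F z - G z = (G (z + m%:C) - G z) - (G (z + m%:C) - F z) by ring.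
apply: le_trans (normcB_le _ _) _; rewrite (splitr e) lerD //; exact: ltW.
Qed.

Section Expansion.
Variables (h : C -> C) (rho r : R).
Hypotheses (dh : forall w, normc w < rho -> derivable h w 1) (r0 : 0 < r) (rr : r < rho).

Let u n t : C := h (circ r t) * circ r t / circ r t ^+ n.
(** [T n 0] is the n-th Taylor coefficient of h, and [T n] the remainder after n terms divided by
    [z ^+ n]; [TS] peels off one coefficient. *)
Let T n z : C := cmean (fun t => u n t / (circ r t - z)).

Let cneq t : circ r t != 0.
Proof. by rewrite -normc_eq0 normc_circ normr_eq0 gt_eqF. Qed.

Let cu n : ccont (u n).
Proof.
apply: ccontM.
  apply: ccontM; last exact: ccont_id.
  apply: ccont_circ => t; apply: derivable_cc; apply: dh.
  by rewrite normc_circ gtr0_norm.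
by move=> t _; apply: ccV; [apply: expf_neq0; exact: cneq|apply: ccX; exact: cc_circ].
Qed.

Let T0 z : normc z < r -> h z = T 0 z.
Proof.
move=> hz; rewrite -(cauchy_formula dh hz rr); apply: eq_cmean => t.
by rewrite /u expr0 divr1.
Qed.

Let TS n z : normc z < r -> T n z = T n 0 + z * T n.+1 z.
Proof.
move=> hz; have n0 : normc (0 : C) < r by rewrite (normc0 R).
have k1 := ccont_kernel 1 (@cu n) n0; have k2 := ccont_kernel 1 (@cu n.+1) hz.
rewrite /T -(cmeanZ z k2) -(cmeanD k1 (ccontM (ccont_cst z) k2)).
apply: eq_cmean => t; have d1 := cneq t; have d2 := circ_neq t hz.
have p0 : circ r t ^+ n != 0 by rewrite expf_neq0.
rewrite /u subr0 ?expr1 [circ r t ^+ n.+1]exprS; move: (circ r t ^+ n) p0 => p p0.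
by field; rewrite d1 d2 p0.
Qed.

Let dT n z : normc z < r -> derivable (T n) z 1.
Proof. by move=> hz; have [] := transform_derive1 (@cu n) hz. Qed.

(** If all Taylor coefficients vanish, h z equals [z ^+ n * T n z] for every n, which is
    O((|z|/r)^n) and so 0. Otherwise g is the remainder at the first nonzero coefficient. *)
Lemma ball_expansion : (forall z, normc z < r -> h z = 0) \/
  exists n g, [/\ forall z, normc z < r -> derivable g z 1, g 0 != 0 &
     forall z, normc z < r -> h z = z ^+ n * g z].
Proof.
have fact n : (forall j, (j < n)%N -> T j 0 = 0) -> forall z, normc z < r -> h z = z ^+ n * T n z.
  elim: n => [|n IH] hn z hz; first by rewrite expr0 mul1r T0.
  rewrite (IH _ z hz); last by move=> j jn; apply: hn; exact: ltnW.
  by rewrite TS // hn // add0r exprSr mulrA.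
have [[n hn]|hn] := pselect (exists n, T n 0 != 0); last first.
  have all0 n : T n 0 = 0.
    by apply/eqP/negPn/negP => hT; apply: hn; exists n.
  left=> z hz; apply/eqP; rewrite -normc_eq0 eq_le normc_ge0 andbT.
  have [M hM] := contin_bounded (twopi_ge0 R) (@cu 0).
  have M0 : 0 <= M by apply: le_trans (hM 0 _); [exact: normc_ge0|rewrite lexx twopi_ge0].
  have d0 : 0 < r - normc z by rewrite subr_gt0.
  pose q := normc z / r; have q0 : 0 <= q by rewrite divr_ge0 ?normc_ge0 ?ltW.
  have q1 : q < 1 by rewrite ltr_pdivrMr // mul1r.
  have bnd n : normc (h z) <= 2 * (M / (r - normc z)) * q ^+ n.
    rewrite (fact n) // normcM normcX.
    have : normc (T n z) <= 2 * (M / (r - normc z) / r ^+ n).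
      apply: normc_cmean; first exact: (ccont_kernel 1 (@cu n) hz).
      move=> t ht; rewrite /u !normcM !normcV normcX normc_circ (gtr0_norm r0).
      have := hM t ht; rewrite /u expr0 divr1 normcM normc_circ (gtr0_norm r0) => hMt.
      rewrite mulrAC ler_pM2r ?invr_gt0 ?exprn_gt0 //.
      apply: ler_pM => //; rewrite ?invr_ge0 ?normc_ge0 ?mulr_ge0 ?normc_ge0 ?(ltW r0) //.
      have le := normc_circB r z t.
      by rewrite lef_pV2 ?posrE //; exact: lt_le_trans le.
    move=> hT; apply: le_trans (ler_wpM2l (exprn_ge0 n (normc_ge0 z)) hT) _.
    rewrite le_eqVlt; apply/orP; left; apply/eqP.
    by rewrite /q expr_div_n; ring.
  have cv : (fun n => 2 * (M / (r - normc z)) * q ^+ n) @ \oo --> 2 * (M / (r - normc z)) * 0.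
    by apply: cvgM; [exact: cvg_cst|apply: cvg_expr; rewrite ger0_norm].
  rewrite mulr0 in cv.
  rewrite -(cvg_lim (@Rhausdorff R) cv); apply: limr_ge; first by apply/cvg_ex; exists 0.
  by apply: nearW => n; exact: bnd.
right; have [m hm hmin] := ex_minnP (ex_intro (fun n => T n 0 != 0) n hn).
exists m, (T m); split; [exact: dT|exact: hm|].
apply: fact => j jm; apply/eqP/negPn/negP => /hmin.
by rewrite leqNgt jm.
Qed.

End Expansion.

Lemma hol_expansion F z0 : holomorphic_at F z0 ->
  (\forall z \near z0, F z = 0) \/
  exists n g, [/\ holomorphic_at g z0, g z0 != 0 &
    \forall z \near z0, F z = (z - z0) ^+ n * g z].
Proof.
move=> /holP [e [e0 he]].
have d1 w : normc w < e -> derivable (fun v => F (v + z0)) w 1.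
  by move=> hw; apply: derivable_shift; apply: he; rewrite addrK.
have e2 : 0 < e / 2 by rewrite divr_gt0.
have ee : e / 2 < e by move: e0; clear; lra.
have [h0|[n [g [dg g0 hg]]]] := ball_expansion d1 e2 ee; [left|right].
  by apply/nbhsCP; exists (e / 2); split => // z /h0; rewrite subrK.
exists n, (fun z => g (z - z0)); split; last first.
- by apply/nbhsCP; exists (e / 2); split => // z /hg; rewrite subrK.
- by rewrite subrr.
apply/holP; exists (e / 2); split; [exact: e2|move=> w hw].
have := derivable_shift (F := g) (z := - z0) (w := w); apply.
exact: dg.
Qed.

End Local.

(** * Germs, orders and the identity theorem *)

Section Orders.
Variable R : realType.
Notation C := (R[i] : numFieldType).
Implicit Types (F G h g k : C -> C) (z w D : C) (r s t e rho : R) (n m : int).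

(** Equality of germs on a punctured neighbourhood, the only equality that ignores arbitrary values
    at poles; the explicit radius makes combining two of them a minimum. *)
Definition punct F G z := exists2 e : R, 0 < e &
  forall w, w != z -> normc (w - z) < e -> F w = G w.

Lemma punctP F G z : (\forall w \near z^', F w = G w) <-> punct F G z.
Proof.
split=> [/dnbhsCP [e [e0 h]]|[e e0 h]]; first by exists e.
by apply/dnbhsCP; exists e.
Qed.

Lemma near_punct F G z : (\forall w \near z, F w = G w) -> punct F G z.
Proof. by move=> /nbhsCP [e [e0 h]]; exists e => // w _ /h. Qed.

Lemma punct_refl F z : punct F F z.
Proof. by exists 1. Qed.

Lemma punct_sym F G z : punct F G z -> punct G F z.
Proof. by move=> [e e0 h]; exists e => // w wz hw; rewrite h. Qed.

Lemma punct_trans F G h z : punct F G z -> punct G h z -> punct F h z.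
Proof.
move=> [e e0 h1] [d d0 h2]; exists (Num.min e d); first by rewrite lt_min e0.
by move=> w wz; rewrite lt_min => /andP[we wd]; rewrite h1 // h2.
Qed.

Lemma punct2 (op : C -> C -> C) F F' G G' z : punct F F' z -> punct G G' z ->
  punct (fun w => op (F w) (G w)) (fun w => op (F' w) (G' w)) z.
Proof.
move=> [e e0 h1] [d d0 h2]; exists (Num.min e d); first by rewrite lt_min e0.
by move=> w wz; rewrite lt_min => /andP[we wd]; rewrite h1 // h2.
Qed.

Lemma punct1 (op : C -> C) F F' z : punct F F' z ->
  punct (fun w => op (F w)) (fun w => op (F' w)) z.
Proof. by move=> [e e0 h1]; exists e => // w wz we; rewrite h1. Qed.

Lemma has_orderP h z n : has_order h z n <-> exists g,
  [/\ holomorphic_at g z, g z != 0 & punct h (fun w => (w - z) ^ n * g w) z].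
Proof.
by split=> [] [g [h1 h2 h3]]; exists g; split => //; apply/punctP.
Qed.

Lemma ho_ext h k z n : punct h k z -> has_order h z n -> has_order k z n.
Proof.
move=> hk /has_orderP [g [g1 g2 g3]]; apply/has_orderP; exists g; split => //.
exact: punct_trans (punct_sym hk) g3.
Qed.

Lemma punct_val F G z : holomorphic_at F z -> holomorphic_at G z -> punct F G z -> F z = G z.
Proof. move=> hF hG /punctP; exact: (punct_eq (hol_cc hF) (hol_cc hG)). Qed.

Lemma ho_unique h z n m : has_order h z n -> has_order h z m -> n = m.
Proof.
wlog nm : n m / (n < m)%R => [hw hn hm|].
  by case: (ltgtP n m) => // nm; [exact: hw|symmetry; exact: hw].
move=> /has_orderP [g [g1 g2 g3]] /has_orderP [g' [g'1 g'2 g'3]].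
have [p mE] : exists p : nat, m = n + p.+1%:Z.
  exists `|m - n|.-1; rewrite prednK ?absz_gt0 ?subr_eq0 ?gt_eqF // gez0_abs ?subr_ge0 1?ltW //.
  by ring.
have h1 : holomorphic_at (fun w => (w - z) ^+ p.+1 * g' w) z.
  exact: holM (holX p.+1 (hol_sub z z)) g'1.
have : g z = (z - z) ^+ p.+1 * g' z.
  apply: (punct_val g1 h1).
  have [e e0 he] := punct_trans (punct_sym g3) g'3; exists e => // w wz we.
  have wz' : w - z != 0 by rewrite subr_eq0.
  apply: (mulfI (expfz_neq0 n wz')).
  by rewrite he // mE expfzDr // mulrA.
by rewrite subrr expr0n /= mul0r => gz; rewrite gz eqxx in g2.
Qed.

Lemma ho_hol F z : holomorphic_at F z -> F z != 0 -> has_order F z 0.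
Proof.
move=> hF F0; apply/has_orderP; exists F; split => //.
by exists 1 => // w _ _; rewrite expr0z mul1r.
Qed.

Lemma ho_cst (c z : C) : c != 0 -> has_order (fun _ : C => c) z 0.
Proof. by move=> c0; apply: ho_hol => //; exact: hol_cst. Qed.

Lemma ho_sub z : has_order (fun w : C => w - z) z 1.
Proof.
apply/has_orderP; exists (fun=> 1); split; [exact: hol_cst|exact: oner_neq0|].
by exists 1 => // w _ _; rewrite mulr1 expr1z.
Qed.

Lemma ho_M h k z n m : has_order h z n -> has_order k z m ->
  has_order (fun w => h w * k w) z (n + m).
Proof.
move=> /has_orderP [g [g1 g2 g3]] /has_orderP [g' [g'1 g'2 g'3]].
apply/has_orderP; exists (fun w => g w * g' w); split; [exact: holM g1 g'1|exact: mulf_neq0|].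
have [e e0 he] := punct2 *%R g3 g'3; exists e => // w wz we.
by rewrite he // expfzDr ?subr_eq0 // mulrACA.
Qed.

Lemma ho_V h z n : has_order h z n -> has_order (fun w => (h w)^-1) z (- n).
Proof.
move=> /has_orderP [g [g1 g2 g3]]; apply/has_orderP; exists (fun w => (g w)^-1).
split; [exact: holV g2 g1|by rewrite invr_eq0|].
have [e e0 he] := punct1 GRing.inv g3; exists e => // w wz we.
by rewrite he // invfM invr_expz.
Qed.

Lemma ho_X h z n (j : nat) : has_order h z n -> has_order (fun w => h w ^+ j) z (n *+ j).
Proof.
move=> hn; elim: j => [|j IH].
  rewrite mulr0n; apply: (@ho_ext (fun=> 1 : C)); last exact: ho_cst (oner_neq0 _).
  by exists 1 => // w _ _; rewrite expr0.
rewrite mulrS; apply: ho_ext (ho_M hn IH).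
by exists 1 => // w _ _; rewrite exprS.
Qed.

Lemma ho_prod (I : eqType) (s : seq I) (h : I -> C -> C) (n : I -> int) z :
  (forall i, i \in s -> has_order (h i) z (n i)) ->
  has_order (fun w => \prod_(i <- s) h i w) z (\sum_(i <- s) n i).
Proof.
elim: s => [|i s IH] hs.
  rewrite big_nil; apply: (@ho_ext (fun=> 1 : C)); last exact: ho_cst (oner_neq0 _).
  by exists 1 => // w _ _; rewrite big_nil.
rewrite big_cons.
have hs' j : j \in s -> has_order (h j) z (n j).
  by move=> js; apply: hs; rewrite inE js orbT.
apply: ho_ext (ho_M (hs i (mem_head _ _)) (IH hs')).
by exists 1 => // w _ _; rewrite big_cons.
Qed.

Lemma punct_near_near F G z : punct F G z -> exists2 e : R, 0 < e &
  forall w, w != z -> normc (w - z) < e -> \forall v \near w, F v = G v.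
Proof.
move=> [e e0 he]; exists e => // w wz we.
have wz0 : 0 < normc (w - z) by rewrite normc_gt0 subr_eq0.
apply/nbhsCP; exists (Num.min (normc (w - z)) (e - normc (w - z))).
split; first by rewrite lt_min wz0 subr_gt0.
move=> v; rewrite lt_min => /andP[v1 v2]; apply: he.
  by apply: contraTneq v1 => ->; rewrite normcBC ltxx.
have := normcD (v - w) (w - z); rewrite addrA subrK.
by move: v2; clear; lra.
Qed.

Lemma ho_near h z n : has_order h z n -> exists2 e : R, 0 < e &
  forall w, w != z -> normc (w - z) < e -> holomorphic_at h w /\ h w != 0.
Proof.
move=> /has_orderP [g [g1 g2 g3]]; have [e e0 he] := punct_near_near g3.
have /nbhsCP [d1 [d10 hd1]] := hol_near g1.
have /nbhsCP [d2 [d20 hd2]] := cc_neq0 (hol_cc g1) g2.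
exists (Num.min e (Num.min d1 d2)); first by rewrite !lt_min e0 d10.
move=> w wz; rewrite !lt_min => /and3P[w1 w2 w3].
have wE := he _ wz w1; split.
  apply: (@hol_ext _ (fun w => (w - z) ^ n * g w)).
    by apply: filterS wE => v ->.
  exact: holM (hol_exprz n wz) (hd1 _ w2).
rewrite (nbhs_singleton wE); apply: mulf_neq0; last exact: hd2.
by rewrite expfz_neq0 // subr_eq0.
Qed.

Lemma idM F G z D E : is_derive z 1 F D -> is_derive z 1 G E ->
  is_derive z 1 (fun w : C => F w * G w : C) (F z * E + G z * D).
Proof. exact: is_deriveM. Qed.

Lemma idV F z D : F z != 0 -> is_derive z 1 F D ->
  is_derive z 1 (fun w : C => (F w)^-1 : C) (- (F z) ^- 2 * D).
Proof.
move=> F0 [dF <-]; apply: (DeriveDef (derV F0 dF)).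
exact: deriveV F0 dF.
Qed.

Lemma id_ext F G z D : (forall w, F w = G w) -> is_derive z 1 F D -> is_derive z 1 G D.
Proof. by move=> /funext ->. Qed.

Lemma id_near F G z D : (\forall w \near z, F w = G w) ->
  is_derive z 1 F D -> is_derive z 1 G D.
Proof. exact: near_eq_is_derive. Qed.

Lemma is_derive_expn z w (j : nat) :
  is_derive w 1 (fun v : C => (v - z) ^+ j : C) (j%:R * (w - z) ^+ j.-1).
Proof.
have d1 : is_derive w 1 (fun v : C => v - z : C) 1.
  apply/is_deriveCP => e e0; exists 1 => // v _.
  rewrite (_ : _ - _ - _ = 0) ?(normc0 R) ?mulr_ge0 ?normc_ge0 ?ltW //; ring.
elim: j => [|j IH].
  apply: (@id_ext (fun=> 1 : C)) => [v|]; first by rewrite expr0.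
  by apply: is_derive_eq (is_derive_cst _ _ _) _; rewrite mul0r.
apply: (@id_ext (fun v => (v - z) * (v - z) ^+ j)) => [v|]; first by rewrite exprS.
apply: is_derive_eq (idM d1 IH) _.
case: j {IH} => [|j]; first by rewrite !mul0r mulr0 add0r mulr1.
by rewrite /= [in RHS]mulrSr exprS; ring.
Qed.

Lemma is_derive_exprz z w n : w != z ->
  is_derive w 1 (fun v : C => (v - z) ^ n : C) (n%:~R * (w - z) ^ (n - 1)).
Proof.
move=> wz; have w0 : w - z != 0 by rewrite subr_eq0.
case: (intP n) => [|j|j].
- apply: (@id_ext (fun=> 1 : C)) => [v|]; first by rewrite expr0z.
  by apply: is_derive_eq (is_derive_cst _ _ _) _; rewrite mul0r.
- apply: is_derive_eq (is_derive_expn z w j.+1) _.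
  by have -> : j.+1%:Z - 1 = j%:Z by rewrite -addn1 PoszD addrK.
apply: (@id_ext (fun v => ((v - z) ^+ j.+1)^-1)) => [v|]; first by rewrite -exprnN.
have x0 : (w - z) ^+ j.+1 != 0 by rewrite expf_neq0.
have h := idV (F := fun v : C => (v - z) ^+ j.+1) x0 (is_derive_expn z w j.+1).
apply: is_derive_eq h _.
have -> : - j.+1%:Z - 1 = - (j.+2)%:Z by rewrite -opprD -PoszD addn1.
rewrite -exprnN rmorphN /= -pmulrn.
rewrite /= !exprS; have p0 : (w - z) ^+ j != 0 by rewrite expf_neq0.
by move: ((w - z) ^+ j) p0 => p p0; field; rewrite w0 p0.
Qed.

(** Unlike in [has_order], g may vanish at z. This makes the class stable under sums and derivatives
    and includes the zero germ; [laurent_cases] recovers the order afterwards. *)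
Definition laurent h z n g :=
  holomorphic_at g z /\ punct h (fun w => (w - z) ^ n * g w) z.

Definition germ h z := exists n g, laurent h z n g.

Definition null h z := punct h (fun=> 0) z.

Lemma laurent_derive h z n g : laurent h z n g ->
  laurent (derive1 h) z (n - 1) (fun w => n%:~R * g w + (w - z) * derive1 g w).
Proof.
move=> [g1 g3]; split.
  apply: holD; first exact: holM (hol_cst _ _) g1.
  exact: holM (hol_sub z z) (hol_derive1 g1).
have [e e0 he] := punct_near_near g3; have /nbhsCP [d [d0 hd]] := hol_near g1.
exists (Num.min e d); first by rewrite lt_min e0.
move=> w wz; rewrite lt_min => /andP[w1 w2]; have wE := he _ wz w1.
have wE' : \forall v \near w, (v - z) ^ n * g v = h v by apply: filterS wE => v ->.
have dg : is_derive w 1 g (derive1 g w).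
  by rewrite derive1E; exact: derivableP (hol_derivable (hd _ w2)).
have [_ hE] := id_near wE' (idM (is_derive_exprz n wz) dg).
rewrite derive1E hE.
have w0 : w - z != 0 by rewrite subr_eq0.
have -> : (w - z) ^ n = (w - z) ^ (n - 1) * (w - z).
  by rewrite -[X in _ * X]expr1z -expfzDr // subrK.
by ring.
Qed.

Lemma ho_derive h z n : n != 0 -> has_order h z n -> has_order (derive1 h) z (n - 1).
Proof.
move=> n0 /has_orderP [g [g1 g2 g3]].
have [h1 h2] := @laurent_derive h z n g (conj g1 g3).
apply/has_orderP; exists (fun w => n%:~R * g w + (w - z) * derive1 g w); split => //.
by rewrite subrr mul0r addr0 mulf_neq0 // intr_eq0.
Qed.

Lemma laurent_cases h z n g : laurent h z n g ->
  null h z \/ exists j : nat, has_order h z (n + j%:Z).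
Proof.
move=> [g1 g3]; have [/near_punct g0|[j [k [k1 k2 /near_punct k3]]]] := hol_expansion g1.
  left; apply: punct_trans g3 _; have [e e0 he] := g0.
  by exists e => // w wz we; rewrite he // mulr0.
right; exists j; apply/has_orderP; exists k; split => //.
apply: punct_trans g3 _; have [e e0 he] := k3.
by exists e => // w wz we; rewrite he // expfzDr ?subr_eq0 // mulrA.
Qed.

Lemma germ_cases h z : germ h z -> null h z \/ exists n, has_order h z n.
Proof. by move=> [n [g /laurent_cases [|[j]]]]; [left|right; exists (n + j%:Z)]. Qed.

Lemma ho_germ h z n : has_order h z n -> germ h z.
Proof. by move=> /has_orderP [g [g1 _ g3]]; exists n, g. Qed.

Lemma hol_laurent F z : holomorphic_at F z -> laurent F z 0 F.
Proof. by move=> hF; split => //; exists 1 => // w _ _; rewrite expr0z mul1r. Qed.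

Lemma hol_germ F z : holomorphic_at F z -> germ F z.
Proof. by move=> /hol_laurent; exists 0, F. Qed.

Lemma laurent_shift h z n m g : laurent h z n g -> (m <= n)%R ->
  laurent h z m (fun w => (w - z) ^+ `|n - m| * g w).
Proof.
move=> [g1 g3] mn; split; first exact: holM (holX _ (hol_sub z z)) g1.
apply: punct_trans g3 _; exists 1 => // w wz _.
have w0 : w - z != 0 by rewrite subr_eq0.
by rewrite mulrA exprnP -expfzDr // gez0_abs ?subr_ge0 // (addrC m) subrK.
Qed.

Lemma laurentD h k z n g g' : laurent h z n g -> laurent k z n g' ->
  laurent (fun w => h w + k w) z n (fun w => g w + g' w).
Proof.
move=> [g1 g3] [g'1 g'3]; split; first exact: holD g1 g'1.
have [e e0 he] := punct2 +%R g3 g'3; exists e => // w wz we.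
by rewrite he // mulrDr.
Qed.

Lemma germD h k z : germ h z -> germ k z -> germ (fun w => h w + k w) z.
Proof.
move=> [n [g hg]] [m [g' hg']].
have l1 : (Num.min n m <= n)%R by rewrite ge_min lexx.
have l2 : (Num.min n m <= m)%R by rewrite ge_min lexx orbT.
exists (Num.min n m); eexists.
exact: laurentD (laurent_shift hg l1) (laurent_shift hg' l2).
Qed.

Lemma germ_derive h z : germ h z -> germ (derive1 h) z.
Proof. by move=> [n [g /laurent_derive hg]]; exists (n - 1); eexists; exact: hg. Qed.

Lemma germ_ext h k z : punct h k z -> germ h z -> germ k z.
Proof.
move=> hk [n [g [g1 g3]]]; exists n, g; split; first exact: g1.
exact: punct_trans (punct_sym hk) g3.
Qed.

Lemma ho_D_lt h k z n m : has_order h z n -> has_order k z m -> (n < m)%R ->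
  has_order (fun w => h w + k w) z n.
Proof.
move=> /has_orderP [g [g1 g2 g3]] /has_orderP [g' [g'1 _ g'3]] nm.
have L1 : laurent h z n g := conj g1 g3.
have L2 := @laurent_shift k z m n g' (conj g'1 g'3) (ltW nm).
have [h1 h2] := laurentD L1 L2; apply/has_orderP.
exists (fun w => g w + (w - z) ^+ `|m - n| * g' w); split; [exact: h1| |exact: h2].
have -> : (z - z) ^+ `|m - n| = 0 :> C.
  by rewrite subrr expr0n absz_eq0 subr_eq0 (gt_eqF nm).
rewrite mul0r addr0.
exact: g2.
Qed.

Lemma null_not_ho h z n : null h z -> ~ has_order h z n.
Proof.
move=> [e e0 he] /ho_near [d d0 hd].
pose x := Num.min e d / 2; have x0 : 0 < x by rewrite divr_gt0 // lt_min e0.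
have nx : normc (z + x%:C - z) = x by rewrite addrAC subrr add0r normcR gtr0_norm.
have xz : z + x%:C != z by rewrite -subr_eq0 -normc_eq0 nx gt_eqF.
have : x < Num.min e d by rewrite /x in x0 *; lra.
rewrite lt_min => /andP[xe xd].
rewrite -nx in xe xd; have [_] := hd _ xz xd.
by rewrite (he _ xz xe) eqxx.
Qed.

Lemma null_near h z : null h z -> exists2 e : R, 0 < e &
  forall w, w != z -> normc (w - z) < e -> null h w.
Proof.
move=> /punct_near_near [e e0 he]; exists e => // w wz /(he _ wz).
exact: near_punct.
Qed.

Definition mero h := forall z, germ h z.

(** The identity theorem, proved along the segment from [z0] to [z1]: the parameters at which h has
    an order form an open and closed set, and a supremum argument carries the property from 0 to
    1. *)
Lemma mero_dichotomy h : mero h ->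
  (forall z, null h z) \/ (forall z, exists n, has_order h z n).
Proof.
move=> hm; have [[z0 [n0 h0]]|none] := pselect (exists z n, has_order h z n); last first.
  left=> z; have [//|[n hn]] := germ_cases (hm z).
  by exfalso; apply: none; exists z, n.
right=> z1; have [nz1|//] := germ_cases (hm z1); exfalso.
pose c (t : R) : C := z0 + t%:C * (z1 - z0).
pose P (t : R) := exists n, has_order h (c t) n.
have cE (s t : R) : normc (c s - c t) = `|s - t| * normc (z1 - z0).
  rewrite /c opprD addrACA subrr add0r -mulrBl normcM.
  by rewrite -rmorphB normcR.
(* Next to a null germ all germs are null; next to a germ that has an order all other germs have
   order 0. *)
have loc t : exists2 e : R, 0 < e & forall s : R, `|s - t| < e -> (P s <-> P t).
  have L : 0 < normc (z1 - z0) + 1 by rewrite ltr_wpDl // normc_ge0.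
  have small (e s : R) : `|s - t| < e / (normc (z1 - z0) + 1) -> normc (c s - c t) < e.
    rewrite cE ltr_pdivlMr // => hs; apply: le_lt_trans hs.
    by rewrite ler_wpM2l // lerDl.
  have [n0' | [n hn]] := germ_cases (hm (c t)).
    have [e e0 he] := null_near n0'; exists (e / (normc (z1 - z0) + 1)); first by rewrite divr_gt0.
    move=> s /small hs; have ns : null h (c s).
      by have [->//|hne] := eqVneq (c s) (c t); exact: he.
    by split=> [] [m hm']; exfalso; [exact: null_not_ho ns hm'|exact: null_not_ho n0' hm'].
  have [e e0 he] := ho_near hn; exists (e / (normc (z1 - z0) + 1)); first by rewrite divr_gt0.
  move=> s /small hs; split=> _; first by exists n.
  have [E|hne] := eqVneq (c s) (c t); first by exists n; rewrite E.
  by have [h1 h2] := he _ hne hs; exists 0; exact: ho_hol.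
pose A := [set t : R | 0 <= t <= 1 /\ forall s, 0 <= s <= t -> P s].
have c0E : c 0 = z0 by rewrite /c mul0r addr0.
have c1E : c 1 = z1 by rewrite /c mul1r addrC subrK.
have A0 : A 0.
  split; first by rewrite lexx ler01.
  move=> s /andP[s0 s1]; have -> : s = 0 by apply/le_anti; rewrite s0 s1.
  by exists n0; rewrite c0E.
have hs : has_sup A by split; [exists 0|exists 1 => x [/andP[_ ]]].
have s0 : 0 <= sup A by apply: sup_upper_bound.
have s1 : sup A <= 1 by apply: sup_le_ub; [exists 0|move=> x [/andP[_ ]]].
have [e e0 he] := loc (sup A).
have [x [[/andP[x0 x1] hx] xs]] : exists x, A x /\ sup A - e < x.
  by have [x Ax xs] := sup_adherent e0 hs; exists x.
have xsup : x <= sup A by apply: sup_upper_bound => //; split => //; rewrite x0.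
have hPx : P x by apply: hx; rewrite x0 lexx.
have dx : `|x - sup A| < e.
  by rewrite ler0_norm ?subr_le0 // opprB; move: xs; clear; lra.
have Psup : P (sup A) := (he x dx).1 hPx.
(* [y] stays in the neighbourhood controlled by [loc], so it belongs to [A]; if it were not 1 it
   would exceed [sup A]. *)
pose y := Num.min 1 (sup A + e / 2).
have ysup : sup A <= y by rewrite le_min s1 lerDl ltW // divr_gt0.
have ye : y <= sup A + e / 2 by rewrite ge_min lexx orbT.
have Ay : A y.
  split; first by rewrite (le_trans s0) // ge_min lexx.
  move=> s /andP[q0 q1]; have [sx|xls] := leP s x; first by apply: hx; rewrite q0.
  have ds : `|s - sup A| < e.
    by rewrite ltr_norml; move: q1 xls xs ye e0; clear; lra.
  exact: (he s ds).2 Psup.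
have y1 : y = 1.
  have : y <= sup A by apply: sup_upper_bound.
  rewrite /y ge_min => /orP[h1|]; last by move: e0; clear; lra.
  by apply/le_anti; rewrite ge_min lexx /= le_min lexx (le_trans h1) // lerDl ltW // divr_gt0.
have [n hn] : P 1 by rewrite -y1; apply: Ay.2; rewrite (le_trans s0 ysup) lexx.
by rewrite c1E in hn; exact: null_not_ho nz1 hn.
Qed.

End Orders.

(** * Divisors, removable singularities and Blaschke factors *)

Section Divisors.
Import finmap.finmap.
Variable R : realType.
Notation C := (R[i] : numFieldType).
Implicit Types (F G h g k : C -> C) (z w D a : C) (r s t e rho : R) (n m : int).

(** The second branch of [mero_dichotomy]: meromorphic and not identically zero, without any claim
    on the values of h at singular points. *)
Definition allord h := forall z, exists n, has_order h z n.

Definition ord h z : int := xget 0 [set n | has_order h z n].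

Lemma ordP h z : allord h -> has_order h z (ord h z).
Proof.
by move=> /(_ z) [n hn]; exact: (xgetPex 0 (ex_intro [set n | has_order h z n] n hn)).
Qed.

Lemma ord_eq h z n : has_order h z n -> ord h z = n.
Proof.
move=> hn; apply: (ho_unique _ hn).
exact: (xgetPex 0 (ex_intro [set n | has_order h z n] n hn)).
Qed.

Definition regular h z := holomorphic_at h z /\ h z != 0.

Lemma regular_ord h z : regular h z -> ord h z = 0.
Proof. by move=> [h1 h2]; apply: ord_eq; exact: ho_hol. Qed.

(** A closed square, the continuous image of a product of segments; it contains the disc of radius
    r, which is all that [discrete_finite] asks. *)
Lemma disc_compact r : compact (((fun p : R * R => p.1 +i* p.2 : C) @`
  ([set` `[- r, r]] `*` [set` `[- r, r]])) : set C).
Proof.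
apply: continuous_compact; last by apply: compact_setX; exact: segment_compact.
apply: continuous_subspaceT => p.
by apply: cvg_Complex; [exact: cvg_fst|exact: cvg_snd].
Qed.

Lemma discrete_finite (S : set C) r :
  (forall z, exists2 e : R, 0 < e & forall w, w != z -> normc (w - z) < e -> ~ S w) ->
  finite_set (S `&` [set z | normc z <= r]).
Proof.
move=> hS; pose e z := sval (cid2 (hS z)).
have e0 z : 0 < e z by rewrite /e; case: (cid2 _).
have he z w : w != z -> normc (w - z) < e z -> ~ S w.
  by rewrite /e; case: (cid2 _) => x /= _; apply.
have := @disc_compact r; rewrite compact_cover => cK.
pose c (p : R * R) : C := p.1 +i* p.2.
have [|z _|D' _ hD'] := cK (R * R)%type setT (fun p => ball (c p) (e (c p))%:C).
- by move=> p _; exact: ball_open.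
- exists (Re z, Im z) => //; rewrite [c _](_ : _ = z); last by case: (z).
  by apply: ballxx; rewrite ltcR.
have : finite_set (c @` [set` D']) by apply: finite_image; exact: finite_fset.
apply: sub_finite_set => z [Sz zr]; have [|p pD wz] := hD' z.
- exists (Re z, Im z); last by case: (z).
  split => /=; rewrite in_itv /= -ler_norml; apply: le_trans zr.
    exact: normc_Re.
  exact: normc_Im.
exists p => //; have [->//|wz'] := eqVneq z (c p); exfalso; apply: (he (c p) z wz' _ Sz).
by move: wz; rewrite /ball /= normc_norm ltcR normcBC.
Qed.

Lemma bad_finite h r : allord h ->
  finite_set ([set z | ~ regular h z] `&` [set z | normc z <= r]).
Proof.
move=> hh; apply: discrete_finite => z; have [n hn] := hh z.
have [e e0 he] := ho_near hn; exists e => // w wz we; apply.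
exact: he.
Qed.

(* The value at z after removing a removable singularity. *)
Definition reg h z : C := xget 0 [set v | exists g, [/\ holomorphic_at g z, punct h g z & g z = v]].

Lemma reg_val h g z : holomorphic_at g z -> punct h g z -> reg h z = g z.
Proof.
move=> hg hp; have [g' [g1 g2 g3]] := xgetPex 0
  (ex_intro [set v | exists g, [/\ holomorphic_at g z, punct h g z & g z = v]] (g z)
    (ex_intro _ g (And3 hg hp erefl))).
rewrite /reg -g3; apply: punct_val g1 hg _; exact: punct_trans (punct_sym g2) hp.
Qed.

Lemma reg_near h g z : holomorphic_at g z -> punct h g z ->
  \forall w \near z, reg h w = g w.
Proof.
move=> hg hp; have [e e0 he] := punct_near_near hp.
have /nbhsCP [d [d0 hd]] := hol_near hg.
apply/nbhsCP; exists (Num.min e d); split; first by rewrite lt_min e0.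
move=> w; rewrite lt_min => /andP[we wd].
have [->|wz] := eqVneq w z; first exact: reg_val.
apply: reg_val; first exact: hd.
by apply: near_punct; exact: he.
Qed.

Lemma reg_hol h z : has_order h z 0 -> regular (reg h) z.
Proof.
move=> /has_orderP [g [g1 g2 g3]].
have hp : punct h g z.
  apply: punct_trans g3 _; exists 1 => // w _ _; by rewrite expr0z mul1r.
have rn := reg_near g1 hp; split.
  by apply: hol_ext g1; apply: filterS rn => w ->.
by rewrite (nbhs_singleton rn).
Qed.

Lemma reg_id h z : holomorphic_at h z -> reg h z = h z.
Proof. by move=> hh; apply: reg_val => //; exact: punct_refl. Qed.

Lemma ho_exprz h z n (j : int) : has_order h z n -> has_order (fun w => h w ^ j) z (n * j).
Proof.
have E (i : nat) : n * i.+1%:Z = n *+ i.+1 by rewrite -mulr_natr natz.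
case: (intP j) => [|i|i] hn.
- rewrite mulr0; apply: (@ho_ext _ (fun=> 1 : C)); last exact: ho_cst (oner_neq0 _).
  by exists 1 => // w _ _; rewrite expr0z.
- rewrite E; exact: ho_X.
rewrite mulrN E; apply: ho_ext (ho_V (ho_X i.+1 hn)).
by exists 1 => // w _ _; rewrite exprnN.
Qed.

(** D is the logarithmic derivative of F at z. The multiplicative form turns products and integer
    powers of F into sums and multiples of D. *)
Definition isld F z D := [/\ derivable F z 1, F z != 0 & 'D_1 F z = F z * D].

Lemma isldE F z D : isld F z D -> 'D_1 F z / F z = D.
Proof. by move=> [_ F0 ->]; rewrite mulrAC mulfV // mul1r. Qed.

Lemma isld_self F z : derivable F z 1 -> F z != 0 -> isld F z ('D_1 F z / F z).
Proof. by move=> dF F0; split; [exact: dF|exact: F0|rewrite mulrC divfK]. Qed.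

Lemma isld_M F G z D D' : isld F z D -> isld G z D' ->
  isld (fun w => F w * G w) z (D + D').
Proof.
move=> [dF F0 eF] [dG G0 eG].
have [d1 d2] := idM (derivableP dF) (derivableP dG).
split; [exact: d1|exact: mulf_neq0|].
by rewrite d2 eF eG; ring.
Qed.

Lemma isld_V F z D : isld F z D -> isld (fun w => (F w)^-1) z (- D).
Proof.
move=> [dF F0 eF]; have [d1 d2] := idV F0 (derivableP dF).
split; [exact: d1|by rewrite invr_eq0|].
by rewrite d2 eF; field.
Qed.

Lemma isld_1 z : isld (fun=> 1) z 0.
Proof.
split; [exact: der_cst|exact: oner_neq0|].
by rewrite mulr0; have [_ ->] := is_derive_cst (1 : C) (z : C) (1 : C).
Qed.

Lemma isld_ext F G z D : (\forall w \near z, F w = G w) -> isld F z D -> isld G z D.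
Proof.
move=> FG [dF F0 eF]; have [d1 d2] := id_near FG (derivableP dF).
by split; [exact: d1|rewrite -(nbhs_singleton FG)|rewrite d2 -(nbhs_singleton FG)].
Qed.

Lemma isld_X F z D (j : nat) : isld F z D -> isld (fun w => F w ^+ j) z (D *+ j).
Proof.
move=> hF; elim: j => [|j IH].
  by rewrite mulr0n; apply: isld_ext (isld_1 z); apply: filterE => w; rewrite expr0.
by rewrite mulrS; apply: isld_ext (isld_M hF IH); apply: filterE => w; rewrite exprS.
Qed.

Lemma isld_exprz F z D (j : int) : isld F z D -> isld (fun w => F w ^ j) z (j%:~R * D).
Proof.
case: (intP j) => [|i|i] hF.
- by rewrite mul0r; apply: isld_ext (isld_1 z); apply: filterE => w; rewrite expr0z.
- by have := isld_X i.+1 hF; rewrite -mulr_natl.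
rewrite mulrNz mulNr; have := isld_V (isld_X i.+1 hF); rewrite -mulr_natl => H.
by apply: isld_ext H; apply: filterE => w; rewrite exprnN.
Qed.

Lemma isld_prod (I : eqType) (s : seq I) (F : I -> C -> C) (D : I -> C) z :
  (forall i, i \in s -> isld (F i) z (D i)) ->
  isld (fun w => \prod_(i <- s) F i w) z (\sum_(i <- s) D i).
Proof.
elim: s => [|i s IH] hs.
  rewrite big_nil; apply: isld_ext (isld_1 z).
  by apply: filterE => w; rewrite big_nil.
have hs' j : j \in s -> isld (F j) z (D j) by move=> js; apply: hs; rewrite inE js orbT.
rewrite big_cons; apply: isld_ext (isld_M (hs i (mem_head _ _)) (IH hs')).
by apply: filterE => w; rewrite big_cons.
Qed.

Section Blaschke.
Variable rho : R.
Hypothesis rho0 : 0 < rho.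

Definition blaschke a z : C := rho%:C * (z - a) / ((rho ^+ 2)%:C - conjc a * z).

(** A bound on the product, because for |a| < rho it still holds slightly outside the circle |z| =
    rho, where [disc_decomp] needs it. *)
Lemma blaschke_den a z : normc a * normc z < rho ^+ 2 ->
  (rho ^+ 2)%:C - conjc a * z != 0.
Proof.
move=> h; rewrite -normc_gt0; apply: lt_le_trans (ler_normcB _ _).
by rewrite subr_gt0 normcM normc_conj normcR ger0_norm ?sqr_ge0.
Qed.

Let rhoC0 : rho%:C != 0 :> C.
Proof. by rewrite -normc_eq0 normcR normr_eq0 gt_eqF. Qed.

Lemma blaschke_hol a z : normc a * normc z < rho ^+ 2 -> holomorphic_at (blaschke a) z.
Proof.
move=> h; apply: holM.
  exact: holM (hol_cst _ _) (hol_sub a z).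
apply: holV; first exact: blaschke_den.
exact: holB (hol_cst _ _) (holM (hol_cst _ _) (hol_id z)).
Qed.

Lemma blaschke_neq0 a z : normc a * normc z < rho ^+ 2 -> z != a -> blaschke a z != 0.
Proof.
move=> h za; rewrite /blaschke !mulf_neq0 //; first by rewrite subr_eq0.
by rewrite invr_eq0 blaschke_den.
Qed.

Lemma blaschke_ord a z : normc a * normc z < rho ^+ 2 ->
  has_order (blaschke a) z (z == a)%:Z.
Proof.
move=> h; case: eqP => [za|/eqP za]; last first.
  by apply: ho_hol; [exact: blaschke_hol|exact: blaschke_neq0].
have h0 : has_order (fun w : C => rho%:C / ((rho ^+ 2)%:C - conjc a * w)) z 0.
  apply: ho_hol.
    apply: holM; first exact: hol_cst.
    apply: holV; first exact: blaschke_den.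
    exact: holB (hol_cst _ _) (holM (hol_cst _ _) (hol_id z)).
  by rewrite mulf_neq0 // invr_eq0 blaschke_den.
subst z; have H := ho_M (ho_sub a) h0; rewrite addr0 in H.
apply: ho_ext H; exists 1 => // w _ _; rewrite /blaschke mulrA.
by congr (_ / _); rewrite mulrC.
Qed.

Lemma normc_blaschke a t : normc a < rho -> normc (blaschke a (circ rho t)) = 1.
Proof.
move=> ar; have c0 : circ rho t - a != 0 by exact: circ_neq.
have cc : circ rho t != 0 by rewrite -normc_eq0 normc_circ normr_eq0 gt_eqF.
rewrite /blaschke -(conj_circ rho t) mulrC [conjc a * _]mulrC -mulrBr -conjcB.
rewrite normcM normcV !normcM normc_conj normc_circ normcR gtr0_norm //.
by rewrite mulrC divff // mulf_neq0 ?gt_eqF // normc_gt0.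
Qed.

Lemma blaschke_isld a z : normc a * normc z < rho ^+ 2 -> z != a ->
  isld (blaschke a) z ((rho ^+ 2 - normc a ^+ 2)%:C / ((z - a) * ((rho ^+ 2)%:C - conjc a * z))).
Proof.
move=> h za; have d0 := blaschke_den h; have z0 : z - a != 0 by rewrite subr_eq0.
have L1 : isld (fun w : C => rho%:C * (w - a)) z ((z - a)^-1).
  have d1 := derM (der_cst rho%:C z) (derB (der_id z) (der_cst a z)).
  split; [exact: d1|exact: mulf_neq0|].
  have [_ ->] : is_derive z 1 (fun w : C => rho%:C * (w - a) : C) rho%:C.
    apply/is_deriveCP => e e0; exists 1 => // v _.
    by rewrite (_ : _ - _ - _ = 0) ?(normc0 R) ?mulr_ge0 ?normc_ge0 ?ltW //; ring.
  by rewrite mulfK.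
have L2 : isld (fun w : C => (rho ^+ 2)%:C - conjc a * w) z
    (- conjc a / ((rho ^+ 2)%:C - conjc a * z)).
  split; [exact: derivable_den|exact: d0|].
  have [_ ->] : is_derive z 1 (fun w : C => (rho ^+ 2)%:C - conjc a * w : C) (- conjc a).
    apply/is_deriveCP => e e0; exists 1 => // v _.
    by rewrite (_ : _ - _ - _ = 0) ?(normc0 R) ?mulr_ge0 ?normc_ge0 ?ltW //; ring.
  by rewrite mulrC divfK.
have := isld_M L1 (isld_V L2); congr (isld _ _ _).
have -> : (rho ^+ 2 - normc a ^+ 2)%:C = (rho ^+ 2)%:C - a * conjc a :> C.
  by rewrite mulc_conj rmorphB.
move: d0; move: ((rho ^+ 2)%:C) (conjc a) => p q d0.
by field; rewrite z0 d0.
Qed.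

End Blaschke.
End Divisors.

(** * Jensen's formula and the first main theorem *)

Section Decomposition.
Variable R : realType.
Notation C := (R[i] : numFieldType).
Notation rcont := (continR 0 (2 * pi)).
Implicit Types (F G h g k : C -> C) (z w D a : C) (r s t e rho : R) (n m : int).

(* Fails only for countably many radii when h is meromorphic and not identically 0. *)
Definition goodr h rho := forall z, normc z = rho -> regular h z.

(* The weight of a point in Jensen's formula: N(r) counts the origin with weight log r. *)
Definition lg rho z : R := if z == 0 then ln rho else ln (rho / normc z).

(* The leading Laurent coefficient at the origin. *)
Definition lead h : C := reg (fun z => h z / z ^ ord h 0) 0.

Lemma normcXz z n : normc (z ^ n) = normc z ^ n.
Proof.
case: (intP n) => [|j|j]; first by rewrite !expr0z (normc1 R).
  exact: normcX.
by rewrite -!exprnN normcV normcX.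
Qed.

Lemma lnXz (x : R) n : 0 < x -> ln (x ^ n) = n%:~R * ln x.
Proof.
move=> x0; case: (intP n) => [|j|j]; first by rewrite expr0z ln1 mul0r.
  by have := lnXn j.+1 x0; rewrite -mulr_natl.
by rewrite -exprnN lnV ?posrE ?exprn_gt0 // lnXn // mulrNz mulNr -mulr_natl.
Qed.

Lemma ln_normc_prod (s : seq C) (F : C -> C) : (forall a, a \in s -> F a != 0) ->
  ln (normc (\prod_(a <- s) F a)) = \sum_(a <- s) ln (normc (F a)).
Proof.
elim: s => [|a s IH] hs; first by rewrite !big_nil (normc1 R) ln1.
have hs' b : b \in s -> F b != 0 by move=> bs; apply: hs; rewrite inE bs orbT.
have p0 : \prod_(b <- s) F b != 0.
  by rewrite prodf_seq_neq0; apply/allP => b /hs'.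
by rewrite !big_cons normcM lnM ?posrE ?normc_gt0 ?hs ?mem_head // IH.
Qed.

Lemma finite_points (S : set C) : finite_set S ->
  exists X : seq C, uniq X /\ forall z, (z \in X) <-> S z.
Proof.
move=> /finite_seqP [s sE]; exists (undup s); split; first exact: undup_uniq.
by move=> z; rewrite mem_undup sE.
Qed.

Lemma ord_points h rho : allord h -> exists X : seq C, uniq X /\
  forall z, (z \in X) <-> (normc z <= rho /\ ord h z != 0).
Proof.
move=> hh; apply: (@finite_points [set z | normc z <= rho /\ ord h z != 0]).
apply: sub_finite_set (bad_finite rho hh) => z [zr zo]; split; last exact: zr.
by move=> /regular_ord; move/eqP: zo.
Qed.

Lemma exists_gap (T : eqType) (Y : seq T) (P : T -> R -> Prop) rho :
  (forall y, y \in Y -> exists2 x : R, rho < x & forall x', x' <= x -> P y x') ->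
  exists2 x : R, rho < x & forall y, y \in Y -> forall x', x' <= x -> P y x'.
Proof.
elim: Y => [|y Y IH] hY; first by exists (rho + 1) => //; rewrite ltrDl.
have [|x1 hx1 H1] := IH; first by move=> y' yY; apply: hY; rewrite inE yY orbT.
have [x2 hx2 H2] := hY y (mem_head _ _).
exists (Num.min x1 x2); first by rewrite lt_min hx1.
move=> y'; rewrite inE => /predU1P[-> x'|yY x']; rewrite le_min => /andP[h1 h2].
  exact: H2.
exact: H1 yY _ h1.
Qed.

Lemma goodr_gap h rho : allord h -> goodr h rho -> exists2 rho', rho < rho' &
  forall z, rho <= normc z -> normc z < rho' -> regular h z.
Proof.
move=> hh hg; have [Y [_ hY]] := finite_points (bad_finite (rho + 1) hh).
have [|x rx hx] := @exists_gap C Y (fun y x => rho < normc y -> x <= normc y) rho.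
  move=> y _; have [h1|h1] := ltP rho (normc y); first by exists (normc y).
  by exists (rho + 1); [rewrite ltrDl|].
exists (Num.min x (rho + 1)); first by rewrite lt_min rx ltrDl ltr01.
move=> z z1; rewrite lt_min => /andP[z2 z3].
have [//|nz] := pselect (regular h z); exfalso.
have zY : z \in Y by apply/hY; split => //=; exact: ltW.
move: z1; rewrite le_eqVlt => /predU1P[zr|z1]; first by apply: nz; exact: hg.
by have := hx z zY x (lexx _) z1; rewrite leNgt z2.
Qed.

Lemma blaschke0 rho a : 0 < rho -> normc (blaschke rho a 0) = normc a / rho.
Proof.
move=> r0; rewrite /blaschke sub0r mulr0 subr0 normcM normcV !normcM normcN !normcR.
rewrite !gtr0_norm ?exprn_gt0 //.
by field; rewrite gt_eqF.
Qed.

(* g is h divided by Blaschke factors, so it is zero-free with the same modulus on the circle. *)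
Lemma disc_decomp h rho : allord h -> 0 < rho -> goodr h rho ->
  forall X : seq C, uniq X -> 
  (forall z, (z \in X) <-> (normc z <= rho /\ ord h z != 0)) ->
  exists g rho', [/\ rho < rho',
    forall w, normc w < rho' -> regular g w,
    forall t, normc (g (circ rho t)) = normc (h (circ rho t)),
    forall z, normc z < rho -> regular h z ->
      'D_1 h z / h z = 'D_1 g z / g z + \sum_(a <- X) (ord h a)%:~R *
        ((rho ^+ 2 - normc a ^+ 2)%:C / ((z - a) * ((rho ^+ 2)%:C - conjc a * z))) &
    ln (normc (g 0)) = ln (normc (lead h)) + \sum_(a <- X) (ord h a)%:~R * lg rho a].
Proof.
move=> hh rho0 hg X uX hX.
have Xlt a : a \in X -> normc a < rho.
  move=> /hX [ar a0]; rewrite lt_neqAle ar andbT; apply: contra a0 => /eqP /hg /regular_ord ->.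
  exact: eqxx.
have [rho1 rr1 hr1] := goodr_gap hh hg.
(* Up to [rho2] no Blaschke denominator vanishes: the reflections of the finitely many points of [X]
   all lie beyond it. *)
have [|rho2 rr2 hr2] := @exists_gap C X (fun a x => normc a * x <= rho ^+ 2) rho.
  move=> a /Xlt ar; have [->|a0] := eqVneq a 0.
    by exists (rho + 1); [rewrite ltrDl|move=> x _; rewrite (normc0 R) mul0r sqr_ge0].
  have na : 0 < normc a by rewrite normc_gt0.
  exists (rho ^+ 2 / normc a); first by rewrite ltr_pdivlMr // expr2 ltr_pM2l.
  by move=> x; rewrite ler_pdivlMr // mulrC.
pose rho' := Num.min rho1 rho2.
have rr' : rho < rho' by rewrite lt_min rr1.
have Xden a z : a \in X -> normc z < rho' -> normc a * normc z < rho ^+ 2.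
  move=> aX; rewrite lt_min => /andP[_ z2].
  have [->|a0] := eqVneq a 0; first by rewrite (normc0 R) mul0r exprn_gt0.
  apply: lt_le_trans (hr2 a aX rho2 (lexx _)); rewrite ltr_pM2l //.
  by rewrite normc_gt0.
pose P z := \prod_(a <- X) blaschke rho a z ^ ord h a.
have ordX z : normc z < rho' -> z \notin X -> ord h z = 0.
  rewrite lt_min => /andP[z1 _] /negP zX0; have zX := fun H => zX0 ((hX z).2 H); have [zr|zr] := leP (normc z) rho.
    by apply/eqP/negPn/negP => z0; apply: zX.
  by apply: regular_ord; apply: hr1 => //; exact: ltW.
(* P has the divisor of h on the enlarged disc, so h / P has order 0 everywhere and [reg] makes it
   zero-free and holomorphic. *)
have oP z : normc z < rho' -> has_order P z (ord h z).
  move=> hz.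
  have H a : a \in X -> has_order (fun w => blaschke rho a w ^ ord h a) z ((z == a)%:Z * ord h a).
    by move=> aX; apply: ho_exprz; apply: blaschke_ord => //; exact: Xden.
  have := ho_prod H; congr (has_order _ _ _).
  have [zX|zX] := boolP (z \in X); last first.
    rewrite ordX // big_seq big1 // => a aX.
    by case: eqP => [E|_]; [rewrite -E (negbTE zX) in aX|rewrite mul0r].
  rewrite (bigD1_seq z) //= eqxx mul1r big1 ?addr0 // => a.
  by rewrite eq_sym => /negbTE ->; rewrite mul0r.
pose q z := h z / P z.
have oq z : normc z < rho' -> has_order q z 0.
  by move=> hz; have := ho_M (ordP z hh) (ho_V (oP z hz)); rewrite subrr.
have Pn0 z : normc z < rho' -> z \notin X -> P z != 0.
  move=> hz zX; rewrite /P prodf_seq_neq0; apply/allP => a aX /=.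
  apply: expfz_neq0; apply: blaschke_neq0 => //; first exact: Xden.
  by apply: contra zX => /eqP ->.
have ldP z : normc z < rho' -> z \notin X -> isld P z
    (\sum_(a <- X) (ord h a)%:~R *
        ((rho ^+ 2 - normc a ^+ 2)%:C / ((z - a) * ((rho ^+ 2)%:C - conjc a * z)))).
  move=> hz zX; apply: isld_prod => a aX; apply: isld_exprz.
  apply: blaschke_isld => //; first exact: Xden.
  by apply: contra zX => /eqP ->.
have regX z : regular h z -> z \notin X.
  by move=> /regular_ord z0; apply/negP => /hX [_]; rewrite z0 eqxx.
have holP z : normc z < rho' -> z \notin X -> holomorphic_at P z.
  move=> hz zX; have n1 : \forall w \near z, normc w < rho' /\ w \notin X.
    apply/nbhsCP.
    have [|x x0 hx] := @exists_gap C X (fun a x => x <= normc (a - z)) 0.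
      move=> a aX; exists (normc (a - z)); last by [].
      by rewrite normc_gt0 subr_eq0; apply: contraNneq zX => <-.
    exists (Num.min x (rho' - normc z)); split; first by rewrite lt_min x0 subr_gt0.
    move=> w; rewrite lt_min => /andP[w1 w2]; split.
      by have := normcD (w - z) z; rewrite subrK; move: w2; clear; lra.
    by apply/negP => wX; have := hx w wX x (lexx _); rewrite leNgt w1.
  by apply: filterS n1 => w [w1 w2]; have [] := ldP w w1 w2.
have regq z : normc z < rho' -> regular h z -> regular q z.
  move=> hz [h1 h2]; have zX := regX z (conj h1 h2); split.
    exact: holM h1 (holV (Pn0 z hz zX) (holP z hz zX)).
  by rewrite mulf_neq0 // invr_eq0; exact: Pn0.
exists (reg q), rho'; split.
- exact: rr'.
- by move=> w hw; apply: reg_hol; exact: oq.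
- move=> t; have nc : normc (circ rho t) = rho by rewrite normc_circ gtr0_norm.
  have hc := hg _ nc; have hc' : normc (circ rho t) < rho' by rewrite nc.
  rewrite (reg_id (regq _ hc' hc).1) normcM normcV.
  rewrite (_ : normc (P _) = 1) ?invr1 ?mulr1 // /P.
  have -> : forall s : seq C, {subset s <= X} ->
      normc (\prod_(a <- s) blaschke rho a (circ rho t) ^ ord h a) = 1 => //.
  elim=> [|a s IH] sX; first by rewrite big_nil (normc1 R).
  rewrite big_cons normcM normcXz normc_blaschke ?exp1rz ?mul1r //.
    by apply: IH => b bs; apply: sX; rewrite inE bs orbT.
  by apply: Xlt; apply: sX; exact: mem_head.
- move=> z hz rz; have hz' := lt_trans hz rr'; have zX := regX z rz.
  have Lh := isld_self (hol_derivable rz.1) rz.2.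
  have Lq := isld_M Lh (isld_V (ldP z hz' zX)).
  have rn := reg_near (regq z hz' rz).1 (punct_refl q z).
  have rn' : \forall w \near z, q w = reg q w by apply: filterS rn => w ->.
  have Lr := isld_ext rn' Lq.
  by move: (isldE Lr) => /esym/eqP; rewrite subr_eq => /eqP.
have z0' : normc (0 : C) < rho' by rewrite (normc0 R) (lt_trans rho0).
have [c [c1 c2 c3]] := (has_orderP _ _ _).1 (ordP 0 hh).
have leadE : lead h = c 0.
  apply: reg_val c1 _; have [e e0 he] := c3; exists e => // w w0 we.
  by rewrite he // subr0 mulrAC mulfV ?mul1r // expfz_neq0.
(* The factor of the origin is z / rho and is split off: its power of z cancels the one in the
   Laurent expansion of h, and the remaining power of rho is the weight ln rho that [lg] gives to
   the origin. *)
pose X' := [seq a <- X | a != 0].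
have X'X a : a \in X' -> a \in X /\ a != 0 by rewrite mem_filter => /andP[].
pose P' z := \prod_(a <- X') blaschke rho a z ^ ord h a.
have rC0 : rho%:C != 0 :> C by rewrite -normc_eq0 normcR normr_eq0 gt_eqF.
have holP' : regular P' 0.
  split.
    have n1 : \forall w \near (0 : C), normc w < rho' /\ w \notin X'.
      apply/nbhsCP.
      have [|x x0 hx] := @exists_gap C X' (fun a x => x <= normc a) 0.
        by move=> a /X'X [_ a0]; exists (normc a); rewrite ?normc_gt0.
      exists (Num.min x rho'); split; first by rewrite lt_min x0 (lt_trans rho0).
      move=> w; rewrite subr0 lt_min => /andP[w1 w2]; split; first exact: w2.
      by apply/negP => wX; have := hx w wX x (lexx _); rewrite leNgt w1.
    apply: filterS n1 => w [w1 w2].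
    have L : isld P' w (\sum_(a <- X') (ord h a)%:~R *
        ((rho ^+ 2 - normc a ^+ 2)%:C / ((w - a) * ((rho ^+ 2)%:C - conjc a * w)))).
      apply: isld_prod => a aX; apply: isld_exprz; apply: blaschke_isld => //.
        by apply: Xden => //; have [] := X'X a aX.
      by apply: contra w2 => /eqP ->.
    by have [] := L.
  rewrite /P' prodf_seq_neq0; apply/allP => a /X'X [aX a0] /=.
  apply: expfz_neq0; apply: blaschke_neq0 => //; first exact: Xden.
  by rewrite eq_sym.
have PE z : P z = (z / rho%:C) ^ ord h 0 * P' z.
  rewrite /P /P' big_filter; have [X0|X0] := boolP (0 \in X).
    have B0 : blaschke rho 0 z = z / rho%:C.
      rewrite /blaschke subr0 conjc0 mul0r subr0 expr2 rmorphM.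
      by field.
    rewrite -B0; exact: (bigD1_seq 0 X0 uX).
  rewrite (ordX 0) // expr0z mul1r [RHS]big_mkcond /=; apply: eq_big_seq => a aX.
  by rewrite ifT //; apply: contraNneq X0 => <-.
pose Q z : C := c z * (rho%:C ^ ord h 0 / P' z).
have Qhol : holomorphic_at Q 0.
  exact: holM c1 (holM (hol_cst _ _) (holV holP'.2 holP'.1)).
have -> : reg q 0 = Q 0.
  apply: reg_val Qhol _; have [e e0 he] := c3; exists e => // w w0 we.
  rewrite /q /Q PE he // subr0 expfzMl -expfV.
  have w1 : w ^ ord h 0 != 0 by rewrite expfz_neq0.
  have r1 : rho%:C ^ ord h 0 != 0 :> C by rewrite expfz_neq0.
  move: (w ^ ord h 0) w1 (rho%:C ^ ord h 0) r1 (c w) (P' w) => A A0 B B0 u p.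
  rewrite !invfM invrK; move: p^-1 => p'.
  by field.
rewrite /Q normcM lnM ?posrE ?normc_gt0 //; last first.
  rewrite mulf_neq0 ?expfz_neq0 //; first by rewrite invr_eq0; exact: holP'.2.
rewrite leadE normcM normcXz normcV normcR gtr0_norm //.
rewrite lnM ?posrE ?exprz_gt0 ?invr_gt0 ?normc_gt0 //; last exact: holP'.2.
rewrite lnV ?posrE ?normc_gt0 //; last exact: holP'.2.
rewrite lnXz // /P' ln_normc_prod; last first.
  move=> a /X'X [aX a0]; apply: expfz_neq0; apply: blaschke_neq0 => //; first exact: Xden.
  by rewrite eq_sym.
congr (_ + _).
have E : \sum_(a <- X') ln (normc (blaschke rho a 0 ^ ord h a)) =
    - \sum_(a <- X | a != 0) (ord h a)%:~R * lg rho a.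
  rewrite big_filter -sumrN; apply: eq_bigr => a a0.
  rewrite normcXz blaschke0 // lnXz ?divr_gt0 ?normc_gt0 // /lg (negbTE a0) -mulrN.
  by rewrite !ln_div ?posrE ?normc_gt0 // opprB.
rewrite E opprK; have [X0|X0] := boolP (0 \in X).
  by rewrite [RHS](bigD1_seq 0) //= {2}/lg eqxx.
rewrite (ordX 0) // mul0r add0r [LHS]big_mkcond /=; apply: eq_big_seq => a aX.
by rewrite ifT //; apply: contraNneq X0 => <-.
Qed.

End Decomposition.

(** * Counting functions as weighted sums over divisors *)

Section Counting.
Variable R : realType.
Notation C := (R[i] : numFieldType).
Notation rcont := (continR 0 (2 * pi)).
Notation mu := (@lebesgue_measure R).
Implicit Types (F G h g k : C -> C) (z w a : C) (r s t e rho : R) (n m : int) (D : C -> R).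

Definition lf D := forall r, finite_set ([set z | D z != 0] `&` [set z | normc z <= r]).

(** The integrated counting function of a real-valued divisor D, with the integral already
    evaluated. In this form it is linear in D and, for [1 <= rho], monotone, so pointwise
    inequalities between divisors can be summed; [integrated_countingE] links it to the integral. *)
Definition ND D rho : R := \sum_(a \in [set a : C | normc a <= rho]) D a * lg rho a.

Lemma fsum_seq (X : seq C) (F : C -> R) rho : uniq X ->
  (forall z, z \in X -> normc z <= rho) ->
  (forall z, normc z <= rho -> z \notin X -> F z = 0) ->
  \sum_(z \in [set z : C | normc z <= rho]) F z = \sum_(z <- X) F z.
Proof.
move=> uX hX h0; rewrite (fsbigE X) //.
rewrite [LHS]big_seq_cond [RHS]big_seq; apply: eq_bigl => z.
by case zX: (z \in X) => //=; rewrite mem_set //=; exact: hX.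
Qed.

Lemma ND_seq D rho (X : seq C) : uniq X ->
  (forall z, z \in X -> normc z <= rho) ->
  (forall z, normc z <= rho -> z \notin X -> D z = 0) ->
  ND D rho = \sum_(z <- X) D z * lg rho z.
Proof. by move=> uX hX h0; apply: fsum_seq => // z z1 z2; rewrite h0 // mul0r. Qed.

Lemma lf_points D rho : lf D -> exists X : seq C, [/\ uniq X,
  forall z, z \in X -> normc z <= rho &
  forall z, normc z <= rho -> z \notin X -> D z = 0].
Proof.
move=> /(_ rho) /finite_points [X [uX hX]]; exists X; split => //.
  by move=> z /hX [].
by move=> z zr zX; apply/eqP/negPn/negP => z0; move/negP: zX; apply; apply/hX.
Qed.

Lemma lf_sub2 D1 D2 (D : C -> R) : lf D1 -> lf D2 ->
  (forall z, D1 z = 0 -> D2 z = 0 -> D z = 0) -> lf D.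
Proof.
move=> l1 l2 h r; apply: (@sub_finite_set _ _
  (([set z | D1 z != 0] `&` [set z | normc z <= r]) `|`
   ([set z | D2 z != 0] `&` [set z | normc z <= r]))%classic).
  move=> z [Dz zr]; have [d1|d1] := eqVneq (D1 z) 0; last by left.
  right; split => //=; apply: contra Dz => /eqP d2; apply/eqP; exact: h.
by rewrite finite_setU; split; [exact: l1|exact: l2].
Qed.

Lemma lf_sub D1 D : lf D1 -> (forall z, D1 z = 0 -> D z = 0) -> lf D.
Proof. by move=> l1 h; apply: (lf_sub2 l1 l1) => z z0 _; exact: h. Qed.

Lemma lfD D1 D2 : lf D1 -> lf D2 -> lf (fun z => D1 z + D2 z).
Proof. by move=> l1 l2; apply: (lf_sub2 l1 l2) => z -> ->; rewrite addr0. Qed.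

Lemma lfZ (c : R) D : lf D -> lf (fun z => c * D z).
Proof. by move=> l; apply: (lf_sub l) => z ->; rewrite mulr0. Qed.

Lemma lf_points2 D1 D2 rho : lf D1 -> lf D2 -> exists X : seq C, [/\ uniq X,
  forall z, z \in X -> normc z <= rho,
  forall z, normc z <= rho -> z \notin X -> D1 z = 0 &
  forall z, normc z <= rho -> z \notin X -> D2 z = 0].
Proof.
move=> l1 l2; pose D z := `|D1 z| + `|D2 z|.
have lD : lf D by apply: (lf_sub2 l1 l2) => z; rewrite /D => -> ->; rewrite normr0 addr0.
have [X [uX hX h0]] := lf_points rho lD; exists X; split => // z z1 z2.
- by have /eqP := h0 z z1 z2; rewrite /D paddr_eq0 // normr_eq0 => /andP[/eqP].
- by have /eqP := h0 z z1 z2; rewrite /D paddr_eq0 // !normr_eq0 => /andP[_ /eqP].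
Qed.

Lemma NDD D1 D2 rho : lf D1 -> lf D2 ->
  ND (fun z => D1 z + D2 z) rho = ND D1 rho + ND D2 rho.
Proof.
move=> l1 l2; have [X [uX hX h1 h2]] := lf_points2 rho l1 l2.
rewrite !(ND_seq uX hX) //; last by move=> z z1 z2; rewrite h1 // h2 // addr0.
by rewrite -big_split /=; apply: eq_bigr => z _; rewrite mulrDl.
Qed.

Lemma NDZ (c : R) D rho : lf D -> ND (fun z => c * D z) rho = c * ND D rho.
Proof.
move=> l1; have [X [uX hX h1]] := lf_points rho l1.
rewrite !(ND_seq uX hX) //; last by move=> z z1 z2; rewrite h1 // mulr0.
by rewrite big_distrr /=; apply: eq_bigr => z _; rewrite mulrA.
Qed.

(** The origin has weight ln rho, which is where [1 <= rho] enters; monotonicity of [ND] inherits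
    this condition. *)
Lemma lg_ge0 rho z : 1 <= rho -> normc z <= rho -> 0 <= lg rho z.
Proof.
move=> r1 zr; rewrite /lg; case: eqP => [_|/eqP z0]; first exact: ln_ge0.
by apply: ln_ge0; rewrite ler_pdivlMr ?normc_gt0 // mul1r.
Qed.

Lemma ND_le D1 D2 rho : 1 <= rho -> lf D1 -> lf D2 -> (forall z, D1 z <= D2 z) ->
  ND D1 rho <= ND D2 rho.
Proof.
move=> r1 l1 l2 h; have [X [uX hX h1 h2]] := lf_points2 rho l1 l2.
rewrite !(ND_seq uX hX) // big_seq [leRHS]big_seq; apply: ler_sum => z zX.
by rewrite ler_wpM2r // lg_ge0 // hX.
Qed.

Lemma ND_ge0 D rho : 1 <= rho -> lf D -> (forall z, 0 <= D z) -> 0 <= ND D rho.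
Proof.
move=> r1 l1 h; have [X [uX hX h1]] := lf_points rho l1.
rewrite (ND_seq uX hX) // big_seq; apply: sumr_ge0 => z zX.
by rewrite mulr_ge0 // lg_ge0 // hX.
Qed.

(** The contribution of one point a to n(t)/t; away from the origin it integrates over ]0, r] to
    ln(r/|a|). *)
Definition step_kernel a t : R := if normc a <= t then t^-1 else 0.

Let mitv (i : interval R) : measurable [set` i].
Proof. exact: measurable_itv. Qed.

Lemma inv_integrable x y : 0 < x -> mu.-integrable `[x, y] (EFin \o (fun t : R => t^-1)).
Proof.
move=> x0; apply: continR_integrable => t /andP[xt _].
by apply: cvgV; [rewrite gt_eqF // (lt_le_trans x0)|exact: cvg_id].
Qed.

Lemma inv_integral x y : 0 < x -> x <= y ->
  \int[mu]_(t in `[x, y]) t^-1 = ln (y / x).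
Proof.
move=> x0; rewrite le_eqVlt => /predU1P[<-|xy].
  by rewrite set_itv1 Rintegral_set1 divff ?ln1 // gt_eqF.
have y0 := lt_trans x0 xy.
rewrite /Rintegral (@continuous_FTC2 R (fun t => t^-1) (@ln R) x y xy) //.
- by rewrite /= ln_div ?posrE.
- apply: continuous_in_subspaceT => t /[!inE]/=; rewrite in_itv /= => /andP[xt _].
  by apply: cvgV; [rewrite gt_eqF // (lt_le_trans x0)|exact: cvg_id].
- split.
  + move=> t; rewrite in_itv /= => /andP[xt _].
    by have [] := is_derive1_ln (lt_trans x0 xt).
  + by apply: cvg_at_right_filter; exact: continuous_ln.
  + by apply: cvg_at_left_filter; exact: continuous_ln.
- move=> t; rewrite in_itv /= => /andP[xt _].
  by rewrite derive1E; have [_ ->] := is_derive1_ln (lt_trans x0 xt).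
Qed.

Lemma step_kernelE a r : a != 0 -> normc a <= r ->
  mu.-integrable `]0, r] (EFin \o step_kernel a) /\
  \int[mu]_(t in `]0, r]) step_kernel a t = lg r a.
Proof.
move=> a0 ar; have na : 0 < normc a by rewrite normc_gt0.
have E : [set` `]0, r]] `&` [set` `[normc a, r]] = [set` `[normc a, r]].
  apply/seteqP; split => [x [] //|x xr]; split => //; move: xr => /=.
  by rewrite !in_itv /= => /andP[h ->]; rewrite (lt_le_trans na h).
have P t : `]0, r]%classic t -> step_kernel a t = ((fun t : R => t^-1) \_ `[normc a, r]) t.
  rewrite /= in_itv /= => /andP[t0 tr]; rewrite /step_kernel patchE.
  case: ifPn => h; first by rewrite mem_set //= in_itv /= h tr.
  by rewrite memNset //= in_itv /= (negbTE h).
have Pin : {in [set` `]0, r]], step_kernel a =1 ((fun t : R => t^-1) \_ `[normc a, r])}.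
  by move=> t /[!inE]; exact: P.
split; last first.
  rewrite (eq_Rintegral mu Pin) -Rintegral_mkcondr E inv_integral //.
  by rewrite /lg (negbTE a0).
have i1 : mu.-integrable [set` `]0, r]] ((EFin \o (fun t : R => t^-1)) \_ [set` `[normc a, r]]).
  apply/integrable_restrict; [exact: measurable_itv|exact: measurable_itv|].
  by rewrite E; exact: inv_integrable.
apply: eq_integrable i1; first exact: measurable_itv.
by move=> t tD; rewrite restrict_EFin /= Pin.
Qed.

Lemma integrated_countingE (mult : C -> nat) r : 0 < r -> lf (fun z => (mult z)%:R) ->
  integrated_counting mult r = ND (fun z => (mult z)%:R) r.
Proof.
move=> r0 l; have [X [uX hX h0]] := lf_points r l.
have nE t : t <= r -> unintegrated_counting mult t =
    \sum_(a <- X) (mult a)%:R * (if normc a <= t then 1 else 0).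
  move=> tr; rewrite /unintegrated_counting.
  rewrite (@fsum_seq [seq a <- X | normc a <= t]) ?filter_uniq //.
  - rewrite big_filter big_mkcond /=; apply: eq_bigr => a _.
    by case: ifP; rewrite ?mulr1 ?mulr0.
  - by move=> z; rewrite mem_filter => /andP[].
  - move=> z zt; rewrite mem_filter zt /= => zX; apply: h0 => //.
    exact: le_trans tr.
rewrite /integrated_counting (ND_seq uX hX) //.
pose X' := [seq a <- X | a != 0].
have X'X a : a \in X' -> a != 0 /\ normc a <= r.
  by rewrite mem_filter => /andP[a0 /hX].
have dE t : `]0, r]%classic t ->
   (unintegrated_counting mult t - unintegrated_counting mult 0) / t =
   \sum_(a <- X') (mult a)%:R * step_kernel a t.
  rewrite /= in_itv /= => /andP[t0 tr]; rewrite !nE ?(ltW r0) // -sumrB big_distrl /=.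
  rewrite /X' big_filter [RHS]big_mkcond /=; apply: eq_bigr => a _.
  rewrite /step_kernel; have [->|a0] := eqVneq a 0.
    by rewrite (normc0 R) lexx (ltW t0) subrr mul0r.
  rewrite [normc a <= 0]leNgt normc_gt0 a0 /= mulr0 subr0.
  by case: ifP; rewrite ?mulr1 ?mulr0 ?mul0r.
(* The origin is excluded since 1/t is not integrable at 0; subtracting n(0) has removed it from the
   integrand, and it returns through the term n(0) ln r. *)
have key (s : seq C) : (forall a, a \in s -> a != 0 /\ normc a <= r) ->
    mu.-integrable `]0, r] (EFin \o (fun t => \sum_(a <- s) (mult a)%:R * step_kernel a t)) /\
    \int[mu]_(t in `]0, r]) (\sum_(a <- s) (mult a)%:R * step_kernel a t) =
    \sum_(a <- s) (mult a)%:R * lg r a.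
  elim: s => [|a s IH] hs.
    rewrite (_ : (fun t => _) = (fun=> 0)); last by apply/funext => t; rewrite big_nil.
    by rewrite big_nil Rintegral_cst // mul0r; split => //; exact: integrable0.
  have [i1 e1] := IH (fun b bs => hs b ltac:(by rewrite inE bs orbT)).
  have [a0 ar] := hs a (mem_head _ _); have [i2 e2] := step_kernelE a0 ar.
  have i3 : mu.-integrable `]0, r] (EFin \o (fun t => (mult a)%:R * step_kernel a t)).
    rewrite (_ : _ \o _ = (fun t => ((mult a)%:R)%:E * (EFin \o step_kernel a) t)%E).
      exact: integrableZl.
    by apply/funext => t.
  rewrite (_ : (fun t => \sum_(b <- a :: s) _) =
     (fun t => (mult a)%:R * step_kernel a t + \sum_(b <- s) (mult b)%:R * step_kernel b t)).
    split; last by rewrite RintegralD // RintegralZl // e1 e2 big_cons.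
    move: i3 i1; set F1 := (fun t => _ * _); set F2 := (fun t => \sum_(b <- s) _) => i3 i1.
    rewrite (_ : EFin \o _ = ((EFin \o F1) \+ (EFin \o F2))%E) //.
    by apply: integrableD => //; exact: measurable_itv.
  by apply/funext => t; rewrite big_cons.
have [_ kE] := key X' X'X.
have dEin : {in [set` `]0, r]], (fun t => (unintegrated_counting mult t -
   unintegrated_counting mult 0) / t) =1 (fun t => \sum_(a <- X') (mult a)%:R * step_kernel a t)}.
  by move=> t /[!inE]; exact: dE.
rewrite (eq_Rintegral mu dEin) kE nE ?(ltW r0) // /X' big_filter.
have -> : \sum_(a <- X) (mult a)%:R * (if normc a <= 0 then 1 else 0) =
     \sum_(a <- X) (mult a)%:R * (if a == 0 then 1 else 0 : R).
  by apply: eq_bigr => a _; rewrite leNgt normc_gt0; case: eqP.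
have [X0|X0] := boolP (0 \in X).
  have -> : \sum_(a <- X) (mult a)%:R * (if a == 0 then 1 else 0 : R) = (mult 0)%:R.
    rewrite (bigD1_seq 0) //= eqxx mulr1 big1 ?addr0 // => a /negbTE ->.
    by rewrite mulr0.
  rewrite [RHS](bigD1_seq 0 X0 uX) /= addrC.
  by have -> : lg r 0 = ln r by rewrite /lg eqxx.
have -> : \sum_(a <- X) (mult a)%:R * (if a == 0 then 1 else 0 : R) = 0.
  rewrite big_seq big1 // => a aX; rewrite ifF ?mulr0 //; apply/negbTE.
  by apply: contraNneq X0 => <-.
rewrite mul0r addr0 big_mkcond /=; apply: eq_big_seq => a aX.
by rewrite ifT //; apply: contraNneq X0 => <-.
Qed.

End Counting.

(** * Circle means of log |h| and the first main theorem *)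

Section Jensen.
Variable R : realType.
Notation C := (R[i] : numFieldType).
Notation rcont := (continR 0 (2 * pi)).
Implicit Types (F G h g k : C -> C) (z w a : C) (r s t e rho : R) (n m : int).

Definition zm h z : R := (zero_mult h z)%:R.
Definition pm h z : R := (pole_mult h z)%:R.
Definition ordR h z : R := (ord h z)%:~R.

Lemma zero_mult_ord h z n : has_order h z n -> (zero_mult h z)%:Z = Num.max n 0.
Proof.
move=> hn; rewrite /zero_mult; case: (leP 0 n) => n0.
  have hs : [set m : nat | has_order h z m%:Z] `|n|%N by rewrite /= gez0_abs.
  have := xgetPex 0%N (ex_intro [set m : nat | has_order h z m%:Z] _ hs).
  by move=> /ho_unique /(_ hn) ->.
rewrite xgetPN // => m hm.
by have E := ho_unique hm hn; rewrite -E in n0.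
Qed.

Lemma pole_mult_ord h z n : has_order h z n -> (pole_mult h z)%:Z = Num.max (- n) 0.
Proof.
move=> hn; rewrite /pole_mult; case: (leP 0 (- n)) => n0.
  have hs : [set m : nat | has_order h z (- m%:Z)] `|n|%N.
    by rewrite /= lez0_abs ?opprK // -oppr_ge0.
  have := xgetPex 0%N (ex_intro [set m : nat | has_order h z (- m%:Z)] _ hs).
  by move=> /ho_unique /(_ hn) /(congr1 (fun x => - x)); rewrite opprK.
rewrite xgetPN // => m hm.
by have E := ho_unique hm hn; rewrite -E opprK in n0.
Qed.

Lemma zm_ord h z : allord h -> zm h z = Num.max (ordR h z) 0.
Proof.
move=> hh; rewrite /zm /ordR; have /(congr1 (fun x : int => x%:~R : R)) := zero_mult_ord (ordP z hh).
rewrite -pmulrn => ->; case: leP => h0; first by rewrite max_r // lerz0.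
by rewrite max_l // ler0z ltW.
Qed.

Lemma pm_ord h z : allord h -> pm h z = Num.max (- ordR h z) 0.
Proof.
move=> hh; rewrite /pm /ordR -rmorphN; have /(congr1 (fun x : int => x%:~R : R)) := pole_mult_ord (ordP z hh).
rewrite -pmulrn => ->; case: leP => h0; first by rewrite max_r // lerz0.
by rewrite max_l // ler0z ltW.
Qed.

Lemma zm_ge0 h z : 0 <= zm h z. Proof. exact: ler0n. Qed.
Lemma pm_ge0 h z : 0 <= pm h z. Proof. exact: ler0n. Qed.

Lemma ordR_zp h z : allord h -> ordR h z = zm h z - pm h z.
Proof.
move=> hh; rewrite zm_ord // pm_ord //.
by case: (leP (ordR h z) 0) => h1; case: (leP (- ordR h z) 0) => h2; lra.
Qed.

Lemma absord_zp h z : allord h -> `|ordR h z| = zm h z + pm h z.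
Proof.
move=> hh; rewrite zm_ord // pm_ord //.
case: (leP (ordR h z) 0) => h1; case: (leP (- ordR h z) 0) => h2.
- by rewrite ler0_norm //; lra.
- by rewrite ler0_norm //; lra.
- by rewrite gtr0_norm //; lra.
- by rewrite gtr0_norm //; lra.
Qed.

Lemma lf_ord h : allord h -> lf (ordR h).
Proof.
move=> hh r; apply: sub_finite_set (bad_finite r hh) => z [zo zr]; split; last exact: zr.
by move=> /regular_ord E; move: zo; rewrite /= /ordR E eqxx.
Qed.

Lemma lf_zm h : allord h -> lf (zm h).
Proof. by move=> hh; apply: (lf_sub (lf_ord hh)) => z E; rewrite zm_ord // E maxxx. Qed.

Lemma lf_pm h : allord h -> lf (pm h).
Proof. by move=> hh; apply: (lf_sub (lf_ord hh)) => z E; rewrite pm_ord // E oppr0 maxxx. Qed.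

Lemma counting_zerosE h r : allord h -> 0 < r -> counting_zeros r h = ND (zm h) r.
Proof. by move=> hh r0; apply: integrated_countingE => //; exact: lf_zm. Qed.

Lemma counting_polesE h r : allord h -> 0 < r -> counting_poles r h = ND (pm h) r.
Proof. by move=> hh r0; apply: integrated_countingE => //; exact: lf_pm. Qed.

(** Reduces the continuity of log+ |h| on a good circle to that of log |h|. *)
Lemma logplusE (x : R) : logplus x = (ln x + `|ln x|) / 2.
Proof.
rewrite /logplus; case: leP => h; first by rewrite ger0_norm //; lra.
by rewrite ltr0_norm //; lra.
Qed.

Lemma proximityE h r : proximity r h = rmean (fun t => logplus (normc (h (circ r t)))).
Proof. by []. Qed.

Lemma logn_cont h rho : 0 < rho -> goodr h rho -> rcont (logn h rho).
Proof.
move=> r0 hg t _; have [h1 h2] := hg (circ rho t) ltac:(by rewrite normc_circ gtr0_norm).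
have c1 : {for t, continuous (fun t => h (circ rho t))}.
  by apply: cc_circ_comp; exact: hol_cc.
have c2 : {for normc (h (circ rho t)), continuous (@ln R)}.
  by apply: continuous_ln; rewrite normc_gt0.
have c3 := cvg_normc c1.
exact: (@continuous_comp _ _ _ (fun t => normc (h (circ rho t))) (@ln R) t (c3 _) c2).
Qed.

Lemma rcont_abs (u : R -> R) : rcont u -> rcont (fun t => `|u t|).
Proof. by move=> hu t ht; exact: (cvg_norm (hu t ht)). Qed.

Lemma rcontD (u v : R -> R) : rcont u -> rcont v -> rcont (fun t => u t + v t).
Proof. by move=> hu hv t ht; exact: (cvgD (hu t ht) (hv t ht)). Qed.

Lemma rcontZ (c : R) (u : R -> R) : rcont u -> rcont (fun t => c * u t).
Proof. by move=> hu t ht; apply: cvgM; [exact: cvg_cst|exact: hu]. Qed.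

Lemma rcont_cst (c : R) : rcont (fun=> c).
Proof. by move=> t ht; exact: cvg_cst. Qed.

Lemma eq_rcont (u v : R -> R) : u =1 v -> rcont u -> rcont v.
Proof. by move=> /funext ->. Qed.

Definition lplus h rho t := logplus (normc (h (circ rho t))).
Definition lminus h rho t := logplus (normc (h (circ rho t)))^-1.

Lemma lminusE h rho t : lminus h rho t = (- logn h rho t + `|logn h rho t|) / 2.
Proof.
rewrite /lminus logplusE /logn; set x := normc _.
have x0 : 0 <= x by exact: normc_ge0.
move: x0; rewrite le_eqVlt => /predU1P[<-|x0]; first by rewrite invr0 ln0 // oppr0.
by rewrite lnV ?posrE // normrN.
Qed.

Lemma lplus_cont h rho : 0 < rho -> goodr h rho -> rcont (lplus h rho).
Proof.
move=> r0 /(logn_cont r0) hc.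
apply: (@eq_rcont (fun t => 2^-1 * (logn h rho t + `|logn h rho t|))).
  by move=> t; rewrite /lplus logplusE mulrC.
by apply: rcontZ; apply: rcontD => //; exact: rcont_abs.
Qed.

Lemma lminus_cont h rho : 0 < rho -> goodr h rho -> rcont (lminus h rho).
Proof.
move=> r0 /(logn_cont r0) hc.
apply: (@eq_rcont (fun t => 2^-1 * (-1 * logn h rho t + `|logn h rho t|))).
  by move=> t; rewrite lminusE mulN1r mulrC.
by apply: rcontZ; apply: rcontD; [exact: rcontZ|exact: rcont_abs].
Qed.

Lemma jensen h rho : allord h -> 0 < rho -> goodr h rho ->
  rmean (logn h rho) = ln (normc (lead h)) + ND (ordR h) rho.
Proof.
move=> hh r0 hg; have [X [uX hX]] := ord_points rho hh.
have [g [rho' [rr hreg hn _ hl]]] := disc_decomp hh r0 hg uX hX.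
have dg w : normc w < rho' -> derivable g w 1 by move=> /hreg [/hol_derivable].
have g0 w : normc w < rho' -> g w != 0 by move=> /hreg [].
have := mean_logn dg g0 r0 rr; rewrite hl.
rewrite (ND_seq uX).
- by move=> <-; apply: eq_rmean => t _; rewrite /logn hn.
- by move=> z /hX [].
- move=> z zr zX; apply/eqP/negPn/negP => z0; move/negP: zX; apply; apply/hX; split => //.
  by apply: contra z0 => /eqP; rewrite /ordR => ->.
Qed.

Lemma mean_lplus_lminus h rho : 0 < rho -> goodr h rho ->
  rmean (lplus h rho) - rmean (lminus h rho) = rmean (logn h rho) /\
  rmean (lplus h rho) + rmean (lminus h rho) = rmean (fun t => `|logn h rho t|).
Proof.
move=> r0 hg; have c1 := lplus_cont r0 hg; have c2 := lminus_cont r0 hg.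
have E t : lplus h rho t = (logn h rho t + `|logn h rho t|) / 2 by rewrite /lplus logplusE.
split; last by rewrite -rmeanD //; apply: eq_rmean => t _; rewrite E lminusE; lra.
rewrite -mulN1r -rmeanZ // -rmeanD //; last exact: rcontZ.
by apply: eq_rmean => t _; rewrite E lminusE; lra.
Qed.

Lemma first_main h rho : allord h -> 0 < rho -> goodr h rho ->
  rmean (lminus h rho) + ND (zm h) rho = characteristic rho h - ln (normc (lead h)).
Proof.
move=> hh r0 hg; have [E _] := mean_lplus_lminus r0 hg.
rewrite (jensen hh r0 hg) in E; rewrite /characteristic proximityE counting_polesE //.
have EN : ND (ordR h) rho = ND (zm h) rho - ND (pm h) rho.
  have := NDD rho (lf_zm hh) (lfZ (-1) (lf_pm hh)); rewrite (NDZ (-1) rho (lf_pm hh)) mulN1r => <-.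
  by congr ND; apply/funext => z; rewrite ordR_zp // mulN1r.
rewrite EN in E; rewrite -/(lplus h rho).
move: E; rewrite -/(lplus h rho).
generalize (rmean (lplus h rho)) (rmean (lminus h rho)) (ND (zm h) rho) (ND (pm h) rho)
  (ln (normc (lead h))) => p q u v w E.
by clear -E; lra.
Qed.

Lemma total_mean h rho : allord h -> 0 < rho -> goodr h rho ->
  rmean (fun t => `|logn h rho t|) + (ND (zm h) rho + ND (pm h) rho) =
  2 * characteristic rho h - ln (normc (lead h)).
Proof.
move=> hh r0 hg; have [_ E] := mean_lplus_lminus r0 hg.
have F := first_main hh r0 hg; rewrite -E; move: F.
rewrite /characteristic proximityE counting_polesE // -/(lplus h rho).
generalize (rmean (lplus h rho)) (rmean (lminus h rho)) (ND (zm h) rho) (ND (pm h) rho)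
  (ln (normc (lead h))) => p q u v w F.
by clear -F; lra.
Qed.

Lemma ND_abs h rho : allord h ->
  ND (fun z => `|ordR h z|) rho = ND (zm h) rho + ND (pm h) rho.
Proof.
move=> hh; rewrite -NDD; [|exact: lf_zm|exact: lf_pm].
by congr ND; apply/funext => z; rewrite absord_zp.
Qed.

(** By [total_mean], one quantity dominating both the mean of |log |h|| and the counting function of
    all zeros and poles. The 1 makes it at least 1 on good circles, as Borel's lemma requires. *)
Definition Theta h rho := 2 * characteristic rho h + `|ln (normc (lead h))| + 1.

Lemma Theta_bounds h rho : allord h -> 1 <= rho -> goodr h rho ->
  [/\ 1 <= Theta h rho, rmean (fun t => `|logn h rho t|) <= Theta h rho &
      ND (fun z => `|ordR h z|) rho <= Theta h rho].
Proof.
move=> hh r1 hg; have r0 : 0 < rho by exact: lt_le_trans r1.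
have E := total_mean hh r0 hg; rewrite -ND_abs // in E.
have m0 : 0 <= rmean (fun t => `|logn h rho t|).
  rewrite -(rmean_cst (0 : R)); apply: rmean_le => //; first exact: rcont_cst.
  by apply: rcont_abs; exact: logn_cont.
have n0 : 0 <= ND (fun z => `|ordR h z|) rho.
  by apply: ND_ge0 => //; apply: (lf_sub (lf_ord hh)) => z ->; rewrite normr0.
have := ler_norm (- ln (normc (lead h))); rewrite normrN /Theta.
move: E m0 n0.
generalize (rmean (fun t => `|logn h rho t|)) (ND (fun z => `|ordR h z|) rho)
  (characteristic rho h) (ln (normc (lead h))) => p q u v E m0 n0 k.
by clear -E m0 n0 k; split; lra.
Qed.

End Jensen.

(** * The lemma on the logarithmic derivative *)

Section LogDerivative.
Variable R : realType.
Notation C := (R[i] : numFieldType).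
Implicit Types (F G h g k : C -> C) (z w a : C) (r s t e rho : R) (n m : int).

Lemma ln_ge_1BV (x : R) : 0 < x -> 1 - x^-1 <= ln x.
Proof.
move=> x0; have x1 : 0 < x^-1 by rewrite invr_gt0.
have := @le_ln1Dx R (x^-1 - 1); rewrite (_ : 1 + (x^-1 - 1) = x^-1) ?lnV ?posrE //; last by ring.
move=> H.
have : -1 < x^-1 - 1 by clear -x1; lra.
by move=> /H; clear; lra.
Qed.

Lemma lg_ge rho a : 1 <= rho -> 0 < normc a -> 1 - normc a / rho <= lg rho a.
Proof.
move=> r1 a0; rewrite /lg ifF; last by apply/negbTE; rewrite -normc_gt0.
have r0 : 0 < rho by exact: lt_le_trans r1.
by have := @ln_ge_1BV (rho / normc a); rewrite divr_gt0 // invf_div; apply.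
Qed.

(** By ln x >= 1 - 1/x, points up to the middle radius have weight at least (rho - r)/(2 rho); hence
    [ND] bounds their number. At the origin, [1 <= r] gives the same bound. *)
Lemma lg_lower rho r a : 1 <= r -> r < rho -> normc a <= (r + rho) / 2 ->
  1 <= 2 * (rho / (rho - r)) * lg rho a.
Proof.
move=> r1 rr ar; have rho1 : 1 <= rho by exact: le_trans (ltW rr).
have rho0 : 0 < rho by exact: lt_le_trans rho1.
have d0 : 0 < rho - r by rewrite subr_gt0.
have H : (rho - r) / (2 * rho) <= lg rho a.
  have [->|a0] := eqVneq a 0.
    rewrite /lg eqxx; apply: le_trans (ln_ge_1BV rho0).
    rewrite -(@ler_pM2r _ (2 * rho)); last by clear -rho0; lra.
    have E : (1 - rho^-1) * (2 * rho) = 2 * rho - 2 by field; rewrite gt_eqF.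
    by rewrite E divfK; [clear -r1 rr; lra|rewrite gt_eqF //; clear -rho0; lra].
  rewrite -normc_gt0 in a0; apply: le_trans (lg_ge rho1 a0).
  rewrite -(@ler_pM2r _ (2 * rho)); last by clear -rho0; lra.
  have E : (1 - normc a / rho) * (2 * rho) = 2 * rho - 2 * normc a by field; rewrite gt_eqF.
  by rewrite E divfK; [clear -ar; lra|rewrite gt_eqF //; clear -rho0; lra].
rewrite mulrAC -mulrA -(@ler_pM2r _ ((rho - r) / (2 * rho))); last first.
  by rewrite divr_gt0 // mulr_gt0.
rewrite mul1r; apply: le_trans H _; move: (lg rho a) => L.
rewrite le_eqVlt; apply/orP; left; apply/eqP; field.
by rewrite !gt_eqF.
Qed.

(** Here u = |a|, d = |z - a|, v is the modulus of the Blaschke denominator and L the weight of a.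
    Factoring [rho ^+ 2 - u ^+ 2] as (rho - u)(rho + u) keeps a factor L, so that the sum over a
    becomes a counting function instead of the number of points up to rho. *)
Lemma ld_term_real (r rho u d v L : R) : 0 < rho -> r < rho -> 0 <= u -> u <= rho -> 0 < d ->
  rho * (rho - r) <= v -> 1 - u / rho <= L ->
  (rho ^+ 2 - u ^+ 2) / (d * v) <= 2 * (rho / (rho - r)) * L * d^-1.
Proof.
move=> r0 rr u0 ur d0 hv hL; have e0 : 0 < rho - r by rewrite subr_gt0.
have v0 : 0 < v by apply: lt_le_trans hv; rewrite mulr_gt0.
rewrite ler_pdivrMr ?mulr_gt0 //.
have -> : 2 * (rho / (rho - r)) * L * d^-1 * (d * v) = 2 * rho * L * (v / (rho - r)).
  by field; rewrite !gt_eqF.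
have hv' : rho <= v / (rho - r) by rewrite ler_pdivlMr.
have L0 : 0 <= L by apply: le_trans hL; rewrite subr_ge0 ler_pdivrMr // mul1r.
have L1 : rho - u <= rho * L.
  have := ler_wpM2l (ltW r0) hL; rewrite mulrBr mulr1 mulrCA divff ?mulr1 //.
  by rewrite gt_eqF.
apply: (@le_trans _ _ (2 * rho * L * rho)).
  have -> : rho ^+ 2 - u ^+ 2 = (rho - u) * (rho + u) by ring.
  have -> : 2 * rho * L * rho = (rho * L) * (2 * rho) by ring.
  by apply: ler_pM => //; [rewrite subr_ge0|apply: addr_ge0 => //; exact: ltW|clear -ur; lra].
by rewrite ler_wpM2l // !mulr_ge0 // ltW.
Qed.

Lemma ld_term rho r z a : normc z = r -> 1 <= r -> r < rho -> 0 < normc a -> normc a <= rho ->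
  z != a ->
  normc ((rho ^+ 2 - normc a ^+ 2)%:C / ((z - a) * ((rho ^+ 2)%:C - conjc a * z))) <=
  2 * (rho / (rho - r)) * lg rho a * (normc (z - a))^-1.
Proof.
move=> zr r1 rr a0 ar za; have r0 : 0 < rho by apply: lt_trans rr; exact: lt_le_trans r1.
have rho1 : 1 <= rho by exact: le_trans (ltW rr).
rewrite normcM normcV [normc (_ * _)]normcM normcR ger0_norm; last first.
  by rewrite subr_ge0 ler_sqr ?nnegrE ?normc_ge0 // ltW.
apply: ld_term_real => //; first exact: ltW.
- by rewrite normc_gt0 subr_eq0.
- apply: le_trans (ler_normcB _ _); rewrite normcM normc_conj zr normcR ger0_norm ?sqr_ge0 //.
  have : normc a * r <= rho * r by rewrite ler_wpM2r // (le_trans ler01).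
  by rewrite expr2 mulrBr; clear; lra.
- exact: lg_ge.
Qed.

Definition cnt h t : R := \sum_(a \in [set a : C | normc a <= t]) `|ordR h a|.

Lemma normR_ordR h a : ord h a != 0 -> 1 <= `|ordR h a|.
Proof. by move=> h0; rewrite /ordR -intr_norm ler1z -gtz0_ge1 normr_gt0. Qed.

Lemma cnt_seq h (X : seq C) rho t : uniq X -> t <= rho ->
  (forall z, (z \in X) <-> (normc z <= rho /\ ord h z != 0)) ->
  cnt h t = \sum_(a <- X | normc a <= t) `|ordR h a|.
Proof.
move=> uX tr hX; rewrite /cnt (@fsum_seq _ [seq a <- X | normc a <= t]) ?filter_uniq ?big_filter //.
- by move=> z; rewrite mem_filter => /andP[].
- move=> z zt; rewrite mem_filter zt /= => zX; apply/eqP/negPn/negP => z0; move/negP: zX; apply.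
  apply/hX; split; first exact: le_trans tr.
  by apply: contra z0 => /eqP E; rewrite /ordR E mulr0z normr0.
Qed.

Lemma cnt_bound h r rho : allord h -> 1 <= r -> r < rho -> goodr h rho ->
  cnt h ((r + rho) / 2) <= 2 * (rho / (rho - r)) * Theta h rho.
Proof.
move=> hh r1 rr hg; have rho1 : 1 <= rho by exact: le_trans (ltW rr).
have rho0 : 0 < rho by exact: lt_le_trans rho1.
have d0 : 0 < rho - r by rewrite subr_gt0.
have [X [uX hX]] := ord_points rho hh.
have [_ _ H] := Theta_bounds hh rho1 hg.
have x0 : 0 <= 2 * (rho / (rho - r)) by rewrite !mulr_ge0 // ?invr_ge0 ltW.
apply: le_trans (ler_wpM2l x0 H).
rewrite (cnt_seq uX _ hX); last by clear -rr; lra.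
rewrite (ND_seq uX).
- rewrite big_distrr /= big_mkcond /= big_seq [leRHS]big_seq; apply: ler_sum => a aX.
  have [ar _] := (hX a).1 aX; case: ifPn => [h1|_].
    rewrite mulrCA -[leLHS]mulr1 ler_wpM2l //.
    exact: lg_lower.
  by rewrite mulr_ge0 // mulr_ge0 // lg_ge0.
- by move=> z /hX [].
- move=> z zr zX; apply/eqP/negPn/negP => z0; move/negP: zX; apply; apply/hX; split => //.
  by apply: contra z0 => /eqP E; rewrite /ordR E mulr0z normr0.
Qed.

Lemma normc_sum_le (s : seq C) (F : C -> C) (B : C -> R) :
  (forall a, a \in s -> normc (F a) <= B a) -> normc (\sum_(a <- s) F a) <= \sum_(a <- s) B a.
Proof.
elim: s => [|a s IH] hs; first by rewrite !big_nil (normc0 R).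
rewrite !big_cons; apply: le_trans (normcD _ _) _; apply: lerD; first exact: hs (mem_head _ _).
by apply: IH => b bs; apply: hs; rewrite inE bs orbT.
Qed.

(** The three terms come from the zero-free quotient, the origin, and the other zeros and poles. [B]
    is a bound for 1/|z - a| over the points up to the middle radius; it has to come from outside,
    as nothing else keeps them away from z. *)
Lemma ldl_pointwise h r rho z (B x : R) : allord h -> 1 <= r -> r < rho -> goodr h rho ->
  normc z = r -> regular h z -> 0 <= B ->
  (forall a, ord h a != 0 -> normc a <= (r + rho) / 2 -> 1 <= normc (z - a) * B) ->
  x = rho / (rho - r) ->
  normc ('D_1 h z / h z) <=
  4 * x ^+ 2 * Theta h rho + `|ordR h 0| + 2 * x * (B + 2 * x) * Theta h rho.
Proof.
move=> hh r1 rr hg zr hz B0 hB xE; have rho1 : 1 <= rho by exact: le_trans (ltW rr).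
have rho0 : 0 < rho by exact: lt_le_trans rho1.
have d0 : 0 < rho - r by rewrite subr_gt0.
have x0 : 0 < x by rewrite xE divr_gt0.
have [X [uX hX]] := ord_points rho hh.
have [g [rho' [rr' hreg hn hld _]]] := disc_decomp hh rho0 hg uX hX.
have dg w : normc w < rho' -> derivable g w 1 by move=> /hreg [/hol_derivable].
have g0 w : normc w < rho' -> g w != 0 by move=> /hreg [].
have [T1 Tm TN] := Theta_bounds hh rho1 hg.
have zrho : normc z < rho by rewrite zr.
rewrite (hld z zrho hz); apply: le_trans (normcD _ _) _; rewrite -addrA.
apply: lerD.
  apply: le_trans (normc_log_deriv dg g0 zrho rr') _; rewrite zr.
  have -> : rmean (fun t => `|logn g rho t|) = rmean (fun t => `|logn h rho t|).
    by apply: eq_rmean => t _; rewrite /logn hn.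
  apply: ler_pM => //.
  - by rewrite mulr_ge0 // divr_ge0 ?sqr_ge0 // ltW.
  - rewrite -(rmean_cst (0 : R)); apply: rmean_le => //; first exact: rcont_cst.
    by apply: rcont_abs; exact: logn_cont.
  - rewrite ler_wpM2l // xE expr_div_n ler_wpM2r ?invr_ge0 ?sqr_ge0 //.
    by rewrite expr2 ler_peMl // ltW.
have hza a : a \in X -> z != a.
  move=> /hX [_ oa]; apply: contraNneq oa => <-; apply/eqP; exact: regular_ord.
have xB0 : 0 <= 2 * x * (B + 2 * x).
  by rewrite mulr_ge0 // ?addr_ge0 // mulr_ge0 // ltW.
apply: le_trans (@normc_sum_le X _
  (fun a => (if a == 0 then `|ordR h 0| else 0) + `|ordR h a| * lg rho a * (2 * x * (B + 2 * x))) _) _.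
  move=> a aX; have [ar oa] := (hX a).1 aX; have za := hza a aX.
  have no : normc ((ord h a)%:~R : C) = `|ordR h a|.
    by rewrite -(rmorph_int (real_complex R)) normcR.
  (* The Blaschke term of the origin is exactly 1/z, at most 1 in modulus because [1 <= r]. *)
  rewrite normcM no; have [a0|a0] := eqVneq a 0.
    rewrite a0 (normc0 R) expr0n subr0 subr0 rmorph0 mul0r subr0 [X in normc X](_ : _ = z^-1).
      rewrite normcV zr -[leLHS]addr0; apply: lerD.
        by rewrite -[leRHS]mulr1 ler_wpM2l // invf_le1 // (lt_le_trans ltr01).
      by rewrite !mulr_ge0 // ?addr_ge0 // ?mulr_ge0 // ?lg_ge0 ?(normc0 R) // ltW.
    have p0 : (rho ^+ 2)%:C != 0 :> C.
      by rewrite -normc_eq0 normcR gt_eqF // normr_gt0 gt_eqF // exprn_gt0.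
    by rewrite invfM mulrCA divff // mulr1.
  rewrite add0r; have na0 : 0 < normc a by rewrite normc_gt0.
  rewrite -mulrA ler_wpM2l //; apply: le_trans (ld_term zr r1 rr na0 ar za) _.
  rewrite -xE (_ : 2 * x * lg rho a * (normc (z - a))^-1 = lg rho a * (2 * x * (normc (z - a))^-1)); last by ring.
  apply: ler_wpM2l; first exact: lg_ge0.
  apply: ler_wpM2l; first by rewrite mulr_ge0 // ltW.
  have dz : 0 < normc (z - a) by rewrite normc_gt0 subr_eq0.
  rewrite -[leLHS]mul1r ler_pdivrMr // mulrDl.
  (* Points beyond the middle radius are at distance at least (rho - r)/2 from z, so [2 * x] bounds
     1/|z - a| there, since [1 <= rho]. *)
  have [h1|h1] := leP (normc a) ((r + rho) / 2).
    have := hB a oa h1; rewrite mulrC => H; apply: le_trans H _.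
    by rewrite lerDl mulr_ge0 ?(ltW dz) // mulr_ge0 // ltW.
  apply: le_trans (_ : 2 * x * normc (z - a) <= _); last first.
    by rewrite lerDr mulr_ge0 // ltW.
  have : normc a - r <= normc (z - a) by rewrite normcBC -zr; exact: ler_normcB.
  move=> h2; have h3 : (rho - r) / 2 <= normc (z - a) by clear -h1 h2; lra.
  apply: le_trans (_ : 2 * x * ((rho - r) / 2) <= _); last first.
    by rewrite ler_wpM2l // mulr_ge0 // ltW.
  have -> : 2 * x * ((rho - r) / 2) = rho by rewrite xE; field; rewrite gt_eqF.
  exact: rho1.
rewrite big_split /=; apply: lerD.
  have [X0|X0] := boolP (0 \in X).
    rewrite (bigD1_seq 0) //= eqxx big1 ?addr0 // => a /negbTE -> //.
  rewrite big_seq big1 // => a aX; rewrite ifF //; apply/negbTE.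
  by apply: contraNneq X0 => <-.
rewrite -big_distrl /= mulrC; apply: ler_wpM2l => //.
apply: le_trans TN; rewrite (ND_seq uX) //.
- by move=> w /hX [].
- move=> w wr wX; apply/eqP/negPn/negP => w0; move/negP: wX; apply; apply/hX; split => //.
  by apply: contra w0 => /eqP E; rewrite /ordR E mulr0z normr0.
Qed.

End LogDerivative.

(** * Exceptional sets and Borel's growth lemma *)

Section Thin.
Variable R : realType.
Implicit Types (r s t : R) (E : set R).
Notation mu := (@lebesgue_measure R).

(** E only has to lie in a measurable set of finite measure, so exceptional sets described by
    quantifiers need no measurability proof. *)
Definition thin E := exists F : set R, [/\ measurable F, (mu F < +oo)%E & E `<=` F].

Lemma thinU E1 E2 : thin E1 -> thin E2 -> thin (E1 `|` E2).
Proof.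
move=> [F1 [m1 f1 s1]] [F2 [m2 f2 s2]]; exists (F1 `|` F2); split; last exact: setUSS.
  exact: measurableU.
apply: le_lt_trans (measureU2 mu m1 m2) _; exact: lte_add_pinfty.
Qed.

Lemma thin0 : thin set0.
Proof. by exists set0; split => //; rewrite measure0. Qed.

Lemma thin_countable E : countable E -> thin E.
Proof.
move=> cE; exists E; split => //; first by apply: countable_measurable => // t; exact: measurable_set1.
by rewrite countable_lebesgue_measure0.
Qed.

Lemma thin_balls (x c : nat -> R) (M : R) : (forall n, 0 <= c n) ->
  (forall n, \sum_(0 <= i < n) c i <= M) -> thin [set r | exists n, `|r - x n| <= c n].
Proof.
move=> c0 hM; pose F n := [set` `[x n - c n, x n + c n]].
have mF n : measurable (F n) by exact: measurable_itv.
exists (\bigcup_n F n); split; first exact: bigcup_measurable.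
  apply: le_lt_trans (measure_sigma_subadditive mu mF (bigcup_measurable (fun k _ => mF k)) (@subset_refl _ _)) _.
  apply: (@le_lt_trans _ _ ((2 * M)%:E)); last exact: ltry.
  apply: lime_le; first by apply: is_cvg_nneseries => n _ _; exact: measure_ge0.
  apply: nearW => n; apply: (@le_trans _ _ (\sum_(0 <= i < n) (2 * c i)%:E)%E).
    apply: lee_sum => i _; rewrite [leLHS](lebesgue_measure_itv `[x i - c i, x i + c i]) /= lte_fin.
    case: ifP => _; last by rewrite lee_fin mulr_ge0.
    by rewrite -EFinB lee_fin; have := c0 i; clear; lra.
  by rewrite sumEFin lee_fin -mulr_sumr ler_wpM2l.
move=> r [n hn]; exists n => //; rewrite /F /= in_itv /=.
by move: hn; rewrite ler_norml; clear; lra.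
Qed.

Lemma thin_unbounded E r : thin E -> exists2 s, r <= s & ~ E s.
Proof.
move=> [F [mF fF sF]]; apply: contrapT => h.
have sub : [set` `[r, +oo[] `<=` F.
  move=> s; rewrite /= in_itv /= andbT => rs; apply: contrapT => Fs; apply: h.
  by exists s => // /sF.
have := le_measure mu (mem_set (measurable_itv `[r, +oo[)) (mem_set mF) sub.
by rewrite [leLHS](lebesgue_measure_itv `[r, +oo[) /= ltry => /le_lt_trans /(_ fF).
Qed.

Lemma sum_inv_prod n : \sum_(0 <= i < n) ((i.+1%:R * i.+2%:R)^-1 : R) = 1 - n.+1%:R^-1.
Proof.
elim: n => [|n IH]; first by rewrite big_nil invr1 subrr.
rewrite big_nat_recr //= IH -[n.+2%:R]natr1; have : 0 < n.+1%:R :> R by rewrite ltr0n.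
by move: (n.+1%:R) => y y0; field; rewrite !gt_eqF // addr_gt0.
Qed.

Lemma sum_inv_2exp n : \sum_(0 <= i < n) ((2 ^+ i)^-1 : R) = 2 - 2 / 2 ^+ n.
Proof.
elim: n => [|n IH]; first by rewrite big_nil expr0 divr1 subrr.
rewrite big_nat_recr //= IH exprS; have : 0 < 2 ^+ n :> R by rewrite exprn_gt0.
by move: (2 ^+ n) => y y0; field; rewrite gt_eqF.
Qed.

Section Borel.
Variables (Th : R -> R) (good : R -> Prop).
Hypothesis good_ub : forall r, exists2 s, r <= s & good s.
Hypothesis Th_ge1 : forall r, 1 <= r -> good r -> 1 <= Th r.

Let V r := [set x | exists s, [/\ r <= s, good s & Th s = x]].
Let tau r := inf (V r).

Let V_inf r : 1 <= r -> has_inf (V r).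
Proof.
move=> r1; split; first by have [s rs gs] := good_ub r; exists (Th s), s.
by exists 1 => x [s [rs gs <-]]; apply: Th_ge1 => //; exact: le_trans rs.
Qed.

Let tau_ge1 r : 1 <= r -> 1 <= tau r.
Proof.
move=> r1; apply: lb_le_inf; first by case: (V_inf r1).
by move=> x [s [rs gs <-]]; apply: Th_ge1 => //; exact: le_trans rs.
Qed.

Let tau_le r : 1 <= r -> good r -> tau r <= Th r.
Proof. by move=> r1 gr; apply: ge_inf; [case: (V_inf r1)|exists r]. Qed.

Lemma dyadic_level (x : R) : 1 <= x -> exists n, 2 ^+ n <= x < 2 ^+ n.+1.
Proof.
move=> x1; have hex : exists n, x < 2 ^+ n.
  exists (Num.bound x); apply: lt_trans (archi_boundP _) _; first exact: le_trans x1.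
  by rewrite -natrX ltr_nat; exact: ltn_expl.
have := ex_minnP hex; case=> -[|m] hm1 hm2; first by move: hm1; rewrite expr0 ltNge x1.
exists m; rewrite hm1 andbT leNgt; apply/negP => /hm2; by rewrite ltnn.
Qed.

(* Borel's growth lemma.  [Th] is only controlled at good radii, where it need not be monotone, so
   the dyadic level sets are those of its infimum [tau] over larger good radii. *)
Lemma borel_growth : exists E, thin E /\ forall r, 1 <= r -> ~ E r -> good r ->
  exists s, [/\ good s, r + (Th r)^-1 <= s & Th s <= 2 * Th r].
Proof.
pose A n := [set r | 1 <= r /\ 2 ^+ n <= tau r < 2 ^+ n.+1].
exists [set r | exists n, `|r - sup (A n)| <= (2 ^+ n)^-1]; split.
  apply: (@thin_balls _ _ 2); first by move=> n; rewrite invr_ge0 exprn_ge0.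
  move=> n; rewrite sum_inv_2exp lerBlDr lerDl divr_ge0 // exprn_ge0 //.
move=> r r1 hE gr; have [n hn] := dyadic_level (tau_ge1 r1).
have rA : A n r by split.
(* Otherwise [A n] is bounded and its supremum lies within [(2 ^+ n)^-1] of r, against [hE]. For an
   unbounded [A n] the value of [sup] is a dummy, which does no harm. Then [tau r' < 2 ^+ n.+1]
   supplies s, and [2 ^+ n <= tau r <= Th r] gives both estimates. *)
have [r' [r1' /andP[_ rn']] rr'] : exists2 r', A n r' & r + (2 ^+ n)^-1 < r'.
  apply: contrapT => h; apply: hE; exists n.
  have ubA : ubound (A n) (r + (2 ^+ n)^-1).
    by move=> s As; rewrite leNgt; apply/negP => rs; apply: h; exists s.
  have h1 : sup (A n) <= r + (2 ^+ n)^-1 by apply: ge_sup => //; exists r.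
  have h2 : r <= sup (A n) by apply: ub_le_sup => //; exists (r + (2 ^+ n)^-1).
  have h3 : 0 < (2 ^+ n)^-1 :> R by rewrite invr_gt0 exprn_gt0.
  by rewrite ler_norml; move: (sup _) (_^-1) h1 h2 h3 => u v; lra.
have [x [s [rs gs <-]] hx] := inf_lt (V_inf r1').1 rn'.
case/andP: hn => hn _; have hT := tau_le r1 gr; exists s; split => //.
  apply: le_trans rs; apply: le_trans (ltW rr'); rewrite lerD2l.
  by rewrite lef_pV2 ?posrE ?exprn_gt0 // ?(le_trans hn) // (lt_le_trans ltr01 (Th_ge1 r1 gr)).
apply: le_trans (ltW hx) _; rewrite exprS ler_wpM2l //; exact: le_trans hT.
Qed.

End Borel.

End Thin.

(** * Exceptional radii and the bound for h'/h *)

Section Exceptional.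
Variable R : realType.
Notation C := (R[i] : numFieldType).
Implicit Types (F G h g k : C -> C) (z w a : C) (r s t e rho : R) (n m : int).

(** A bad circle passes through a bad point, and these are finite in number in each disc; so the bad
    radii are countable, hence null. *)
Lemma thin_bad h : allord h -> thin [set r | ~ goodr h r].
Proof.
move=> hh; apply: thin_countable.
have : countable (\bigcup_(j in [set: nat])
    (@normc R @` ([set z | ~ regular h z] `&` [set z | normc z <= j%:R]))).
  apply: bigcup_countable => // j _; apply: finite_set_countable.
  by apply: finite_image; exact: bad_finite.
apply: sub_countable; apply: subset_card_le => r hr.
have [z zr hz] : exists2 z, normc z = r & ~ regular h z.
  apply: contrapT => hc; apply: hr => z zr; apply: contrapT => hz.
  by apply: hc; exists z.
exists (Num.bound r) => //; exists z => //; split => //=.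
by rewrite zr; apply: ltW; apply: archi_boundP; rewrite -zr normc_ge0.
Qed.

Lemma goodr_unbounded h r : allord h -> exists2 s, r <= s & goodr h s.
Proof.
by move=> /thin_bad /(thin_unbounded r) [s rs hs]; exists s => //; apply: contrapT.
Qed.

Lemma cnt_nat h t : allord h -> exists j : nat, cnt h t = j%:R.
Proof.
move=> hh; have [X [uX hX]] := ord_points t hh.
exists (\sum_(a <- X | (normc a <= t)%R) `|ord h a|%N)%N.
rewrite (cnt_seq uX (lexx t) hX) natr_sum; apply: eq_bigr => a _.
by rewrite /ordR -intr_norm -abszE -pmulrn.
Qed.

Lemma cnt_mono h s t : allord h -> s <= t -> cnt h s <= cnt h t.
Proof.
move=> hh st; have [X [uX hX]] := ord_points t hh.
rewrite (cnt_seq uX (lexx t) hX) (cnt_seq uX st hX) big_mkcond [leRHS]big_mkcond /=.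
apply: ler_sum => a _; case: ifP => h1; last by case: ifP.
by rewrite (le_trans h1 st).
Qed.

Lemma cnt_step h s a : allord h -> ord h a != 0 -> s < normc a -> cnt h s + 1 <= cnt h (normc a).
Proof.
move=> hh oa sa; have [X [uX hX]] := ord_points (normc a) hh.
have aX : a \in X by apply/hX.
rewrite (cnt_seq uX (lexx _) hX) (cnt_seq uX (ltW sa) hX) big_mkcond [leRHS]big_mkcond /=.
rewrite (bigD1_seq a aX uX) /= [leRHS](bigD1_seq a aX uX) /= lexx (leNgt (normc a) s) sa /= add0r addrC.
apply: lerD; last exact: normR_ordR.
apply: ler_sum => b _; case: ifP => h1; last by case: ifP.
by rewrite (le_trans h1 (ltW sa)).
Qed.

Lemma cnt_ge0 h t : allord h -> 0 <= cnt h t.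
Proof. by move=> /(cnt_nat t) [j ->]; exact: ler0n. Qed.

Lemma cnt_ge1 h a : allord h -> ord h a != 0 -> 1 <= cnt h (normc a).
Proof.
move=> hh oa; have := @cnt_step h (normc a - 1) a hh oa ltac:(by rewrite ltrBlDr ltrDl).
by apply: le_trans; rewrite lerDr cnt_ge0.
Qed.

(* If a is the point of modulus |a| and n = cnt |a|, the removed interval around |a| has radius
   1/(n(n+1)); distinct moduli have distinct n, so the lengths are summable. *)
Lemma thin_moduli h : allord h -> exists E, thin E /\ forall z a, ~ E (normc z) ->
  ord h a != 0 -> 1 <= normc (z - a) * (2 * cnt h (normc a) ^+ 2).
Proof.
move=> hh; pose P (j : nat) := [set t | (exists2 a, ord h a != 0 & normc a = t) /\ cnt h t = j.+1%:R].
pose x j := xget 0 (P j).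
exists [set r | exists j, `|r - x j| <= (j.+1%:R * j.+2%:R)^-1]; split.
  apply: (@thin_balls _ _ _ 1); first by move=> j; rewrite invr_ge0 mulr_ge0 // ler0n.
  by move=> j; rewrite sum_inv_prod lerBlDr lerDl invr_ge0 ler0n.
move=> z a hz oa; have [[|j] hj] := cnt_nat (normc a) hh.
  by have := cnt_ge1 hh oa; rewrite hj ler10.
have Pa : P j (normc a) by split; [exists a|].
have xa : x j = normc a.
  have [[b ob bx] xj] : P j (x j) by exact: xgetPex (ex_intro _ _ Pa).
  apply/eqP; rewrite eq_le !leNgt; apply/andP; split; apply/negP => lt.
    have := cnt_step hh ob; rewrite bx => /(_ _ lt); rewrite hj xj.
    by rewrite gerDl ler10.
  by have := cnt_step hh oa lt; rewrite hj xj gerDl ler10.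
have h1 : (j.+1%:R * j.+2%:R)^-1 < normc (z - a).
  rewrite ltNge; apply/negP => h2; apply: hz; exists j; rewrite xa.
  apply: le_trans h2; rewrite ler_norml ler_normcB andbT lerNl opprB normcBC.
  exact: ler_normcB.
rewrite hj; have p0 : 0 < j.+1%:R * j.+2%:R :> R by rewrite mulr_gt0 // ltr0n.
apply: (@le_trans _ _ (normc (z - a) * (j.+1%:R * j.+2%:R))).
  by rewrite -ler_pdivrMr // mul1r ltW.
rewrite ler_wpM2l ?normc_ge0 // expr2 mulrCA ler_wpM2l ?ler0n //.
by rewrite -natrM ler_nat mul2n doubleS !ltnS -addnn leq_addr.
Qed.

(** Everything is dominated by the cube of [y = x * Th]; the three terms without [o] contribute 4 +
    16 + 4 = 24. *)
Lemma ldl_real (x Th o N : R) : 1 <= x -> 1 <= Th -> 0 <= o -> 0 <= N -> N <= 2 * x * Th ->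
  4 * x ^+ 2 * Th + o + 2 * x * (2 * N ^+ 2 + 2 * x) * Th <= (24 + o) * (x * Th) ^+ 3.
Proof.
move=> x1 T1 o0 N0 hN; pose y := x * Th.
have x0 : 0 <= x by exact: le_trans x1.
have T0 : 0 <= Th by exact: le_trans T1.
have y1 : 1 <= y by rewrite -[1]mulr1; exact: ler_pM.
have xy : x <= y by rewrite ler_peMr.
have y0 : 0 <= y by exact: le_trans y1.
have e1 : x ^+ 2 * Th <= y ^+ 3.
  have -> : x ^+ 2 * Th = x * y * 1 by rewrite /y; ring.
  have -> : y ^+ 3 = y * y * y by ring.
  by apply: ler_pM => //; [rewrite mulr_ge0|apply: ler_pM].
have e2 : x * N ^+ 2 * Th <= 4 * y ^+ 3.
  have -> : x * N ^+ 2 * Th = y * N ^+ 2 by rewrite /y; ring.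
  have -> : 4 * y ^+ 3 = y * (2 * x * Th) ^+ 2 by rewrite /y; ring.
  by rewrite ler_wpM2l // ler_sqr ?nnegrE // (le_trans N0).
have e3 : o <= o * y ^+ 3 by rewrite ler_peMr // exprn_ege1.
rewrite -/y; move: e1 e2 e3.
have -> : 2 * x * (2 * N ^+ 2 + 2 * x) * Th = 4 * (x * N ^+ 2 * Th) + 4 * (x ^+ 2 * Th) by ring.
rewrite -(mulrA 4) mulrDl.
move: (x ^+ 2 * Th) (x * N ^+ 2 * Th) (o * y ^+ 3) (y ^+ 3) => p q u v; clear; lra.
Qed.

(** Borel's lemma provides rho with [rho - r] at least [(Theta h r)^-1] while [Theta] at most
    doubles; the distance bound [B] comes from [thin_moduli]. The result is polynomial in r and
    [Theta h r], and only its logarithm matters, so the exponents are immaterial. *)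
Lemma log_derivative h : allord h -> exists E, thin E /\ exists K, 1 <= K /\
  forall r, 1 <= r -> ~ E r -> goodr h r /\ forall z, normc z = r ->
  normc ('D_1 h z / h z) <= K * (r * Theta h r ^+ 2) ^+ 3.
Proof.
move=> hh; have [E1 [tE1 hE1]] := thin_moduli hh.
have tE2 := thin_bad hh.
have Th1 r : 1 <= r -> goodr h r -> 1 <= Theta h r by move=> r1 hg; case: (Theta_bounds hh r1 hg).
have [E3 [tE3 hE3]] := borel_growth (fun r => goodr_unbounded r hh) Th1.
exists (E1 `|` ([set r | ~ goodr h r] `|` E3)); split; first by do 2!apply: thinU => //.
(* 64 is [4 ^+ 3]: [x] is at most [2 * (r * Theta h r)] and [Theta h rho] at most [2 * Theta h r],
   and [ldl_real] cubes their product. *)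
pose K := (24 + `|ordR h 0|) * 64; have K1 : 1 <= K.
  have := normr_ge0 (ordR h 0); rewrite /K; move: `|_| => o; clear; lra.
exists K; split => // r r1 hr.
have hg : goodr h r by apply: contrapT => hc; apply: hr; right; left.
split => // z zr.
have nE1 : ~ E1 (normc z) by rewrite zr => h1; apply: hr; left.
have [rho [hgrho rrho hT]] := hE3 r r1 (fun nE => hr (or_intror (or_intror nE))) hg.
have T1 := Th1 r r1 hg; have T0 : 0 < Theta h r by exact: lt_le_trans T1.
have iT0 : 0 < (Theta h r)^-1 by rewrite invr_gt0.
have rr : r < rho by apply: lt_le_trans rrho; rewrite ltrDl.
have d0 : 0 < rho - r by rewrite subr_gt0.
have rho0 : 0 < rho by apply: lt_trans rr; exact: lt_le_trans r1.
have T1' := Th1 rho (le_trans r1 (ltW rr)) hgrho.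
pose x := rho / (rho - r); have x1 : 1 <= x.
  by rewrite ler_pdivlMr // mul1r gerBl (le_trans ler01).
have hx : x <= 2 * (r * Theta h r).
  have -> : x = 1 + r / (rho - r) by rewrite /x; field; rewrite gt_eqF.
  have : r / (rho - r) <= r * Theta h r.
    rewrite ler_wpM2l ?(le_trans ler01) // -[leRHS]invrK lef_pV2 ?posrE //.
    by rewrite lerBrDl.
  have : 1 <= r * Theta h r by rewrite -[1]mulr1; exact: ler_pM.
  by move: (_ * Theta _ _) (r / _) => p q; clear; lra.
pose N := cnt h ((r + rho) / 2).
have N0 : 0 <= N by exact: cnt_ge0.
have hN : N <= 2 * x * Theta h rho by exact: cnt_bound.
have := @ldl_pointwise R h r rho z (2 * N ^+ 2) x hh r1 rr hgrho zr (hg z zr).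
have B0 : 0 <= 2 * N ^+ 2 by rewrite mulr_ge0 // sqr_ge0.
move=> /(_ B0) H; apply: le_trans (H _ erefl) _.
  move=> a oa ar; apply: le_trans (hE1 z a nE1 oa) _.
  rewrite ler_wpM2l ?normc_ge0 // ler_wpM2l // ler_sqr ?nnegrE //; last exact: cnt_ge0.
  exact: cnt_mono.
apply: le_trans (ldl_real x1 T1' (normr_ge0 _) N0 hN) _.
rewrite /K -(mulrA (24 + `|ordR h 0|)); apply: ler_wpM2l; first by rewrite addr_ge0.
have -> : 64 * (r * Theta h r ^+ 2) ^+ 3 = ((2 * (r * Theta h r)) * (2 * Theta h r)) ^+ 3 by ring.
have x0 : 0 <= x by exact: le_trans x1.
have T0' : 0 <= Theta h rho by exact: le_trans T1'.
have r0 : 0 <= r by exact: le_trans r1.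
apply: lerXn2r; rewrite ?nnegrE; first exact: mulr_ge0.
  by rewrite !mulr_ge0 // ltW.
by apply: ler_pM.
Qed.

End Exceptional.

(** * Growth of transcendental functions *)

Section Constants.
Variable R : realType.
Notation C := (R[i] : numFieldType).
Implicit Types (F G h g k : C -> C) (z w c : C) (r s t e rho : R) (n m : int).

Lemma idB F G z D E : is_derive z 1 F D -> is_derive z 1 G E ->
  is_derive z 1 (fun w : C => F w - G w : C) (D - E).
Proof. exact: is_deriveB. Qed.

Lemma idD F G z D E : is_derive z 1 F D -> is_derive z 1 G E ->
  is_derive z 1 (fun w : C => F w + G w : C) (D + E).
Proof. exact: is_deriveD. Qed.

Lemma derive1_val F z D : is_derive z 1 F D -> derive1 F z = D.
Proof. by move=> [_ <-]; rewrite derive1E. Qed.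

Lemma null_val F z : holomorphic_at F z -> null F z -> F z = 0.
Proof. by move=> hF; exact: (punct_val hF (hol_cst 0 z)). Qed.

Lemma germ_near h z : germ h z -> exists2 e : R, 0 < e &
  forall w, w != z -> normc (w - z) < e -> holomorphic_at h w.
Proof.
move=> /germ_cases [/punct_near_near [e e0 he]|[n /ho_near [e e0 he]]]; exists e => //.
  move=> w wz we; apply: hol_ext (hol_cst 0 w); have := he w wz we.
  by apply: filterS => v ->.
by move=> w wz we; case: (he w wz we).
Qed.

Lemma hol_ord_ge0 F z n : holomorphic_at F z -> has_order F z n -> 0 <= n.
Proof.
move=> hF hn; have [/null_not_ho /(_ hn) //|[j hj]] := laurent_cases (hol_laurent hF).
by rewrite (ho_unique hn hj) add0r.
Qed.

Lemma mero_null h : mero h -> null h 0 -> forall z, null h z.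
Proof.
move=> hm h0; have [//|hh] := mero_dichotomy hm.
by have [n /(null_not_ho h0)] := hh 0.
Qed.

Lemma meroB_cst h c : mero h -> mero (fun w => h w - c).
Proof. by move=> hm z; apply: germD (hm z) _; exact: hol_germ (hol_cst (- c) z). Qed.

Lemma derive1_sub_cst h c : derive1 (fun w => h w - c) = derive1 h.
Proof.
apply/funext => w.
have E : (fun x : C => x^-1 *: (h (x + w) - c - (h w - c))) = (fun x : C => x^-1 *: (h (x + w) - h w)).
  by apply/funext => x; congr (_ *: _); rewrite opprB addrA subrK.
by rewrite /derive1 E.
Qed.

(** A nonzero order n at the origin would give h' the order n - 1; so h has a value c there. For h -
    c the order cannot be nonzero for the same reason, nor 0, so its germ is null and [mero_null]
    spreads this over the plane. *)
Lemma null_derive_cst h : mero h -> null (derive1 h) 0 ->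
  exists c, forall z, null (fun w => h w - c) z.
Proof.
move=> hm d0; have [h0|[n hn]] := germ_cases (hm 0).
  exists 0; apply: mero_null; first exact: meroB_cst.
  by apply: punct_trans h0; exists 1 => // w _ _; rewrite subr0.
have [n0|n0] := eqVneq n 0; last by have /(null_not_ho d0) := ho_derive n0 hn.
rewrite n0 in hn; have /has_orderP [g [g1 g2 g3]] := hn.
have pg : punct h g 0.
  by apply: punct_trans g3 _; exists 1 => // w _ _; rewrite expr0z mul1r.
exists (g 0); apply: mero_null; first exact: meroB_cst.
have [//|[m hm']] := germ_cases (@meroB_cst h (g 0) hm 0).
have [m0|m0] := eqVneq m 0; last first.
  by have := ho_derive m0 hm'; rewrite derive1_sub_cst => /(null_not_ho d0).
exfalso; rewrite m0 in hm'; have /has_orderP [k [k1 k2 k3]] := hm'.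
have pk : punct (fun w => g w - g 0) k 0.
  apply: punct_trans (punct_sym (punct1 (fun v => v - g 0) pg)) _.
  apply: punct_trans k3 _; exists 1 => // w _ _; by rewrite expr0z mul1r.
have hg := holB g1 (hol_cst (g 0) 0).
by have := punct_val hg k1 pk; rewrite subrr => E; rewrite -E eqxx in k2.
Qed.

Lemma hol_eq F G z : F =1 G -> holomorphic_at F z -> holomorphic_at G z.
Proof. by move=> /funext ->. Qed.

Lemma hol_horner (p : {poly C}) z : holomorphic_at (fun w => p.[w]) z.
Proof.
elim/poly_ind: p => [|p c IH].
  apply: hol_eq (hol_cst 0 z) => w; by rewrite horner0.
apply: hol_eq (holD (holM IH (hol_id z)) (hol_cst c z)) => w.
by rewrite hornerMXaddC.
Qed.

Lemma antiderivative_sum (u : nat -> C) (j : nat) : exists P : {poly C}, forall w,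
  is_derive w 1 (fun v : C => P.[v] : C) (\sum_(0 <= i < j) u i * w ^+ i).
Proof.
elim: j => [|j [P hP]].
  exists 0 => w; rewrite big_nil; apply: id_ext (is_derive_cst (0 : C) w (1 : C)) => v.
  by rewrite horner0.
exists (P + (u j / j.+1%:R)%:P * 'X^(j.+1)) => w; rewrite big_nat_recr //=.
have := idD (hP w) (idM (is_derive_cst (u j / j.+1%:R : C) w (1 : C)) (is_derive_expn 0 w j.+1)).
rewrite /= subr0 => H; apply: is_derive_eq (id_ext _ H) _.
  by move=> v; rewrite hornerD hornerM hornerC hornerXn subr0.
congr (_ + _); rewrite mulr0 addr0 mulrA divfK // pnatr_eq0 //.
Qed.

Lemma antiderivative (p : {poly C}) : exists P : {poly C}, forall w,
  is_derive w 1 (fun v : C => P.[v] : C) p.[w].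
Proof.
have [P hP] := antiderivative_sum (fun i => p`_i) (size p); exists P => w.
by apply: is_derive_eq (hP w) _; rewrite horner_coef big_mkord.
Qed.

(** The induction hypothesis, applied to h', gives a polynomial; subtracting an antiderivative of it
    from h leaves a function with null derivative. *)
Lemma null_derive1n (j : nat) h : mero h -> (forall z, null (derive1n j h) z) ->
  exists p : {poly C}, forall z, null (fun w => h w - p.[w]) z.
Proof.
elim: j h => [|j IH] h hm.
  rewrite derive1n0 => h0; exists 0 => z; apply: punct_trans (h0 z).
  by exists 1 => // w _ _; rewrite horner0 subr0.
rewrite derive1Sn => h0.
have [|p hp] := IH _ _ h0; first by move=> z; exact: germ_derive.
have [P hP] := antiderivative p; pose k w := h w - P.[w].
have km : mero k.
  move=> z; apply: germD (hm z) _.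
  apply: germ_ext (hol_germ (holB (hol_cst 0 z) (hol_horner P z))).
  by exists 1 => // w _ _; rewrite sub0r.
have [|c hc] := @null_derive_cst k km.
  have [e e0 he] := germ_near (hm 0).
  apply: punct_trans (hp 0); exists e => // w wz we.
  have [dh] : derivable h w 1 /\ True by split => //; exact: hol_derivable (he w wz we).
  move=> _; apply: derive1_val; rewrite derive1E; exact: idB (derivableP dh) (hP w).
exists (P + c%:P) => z; apply: punct_trans (hc z); exists 1 => // w _ _.
by rewrite hornerD hornerC opprD addrA.
Qed.

Lemma pole_mult_gt0 f z : (0 < pole_mult f z)%N -> has_order f z (- (pole_mult f z)%:Z).
Proof.
rewrite /pole_mult => hp; have [hex|hn] := pselect (exists i : nat, has_order f z (- i%:Z)).
  exact: (xgetPex 0%N hex).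
by rewrite xgetPN in hp => // i hi; apply: hn; exists i.
Qed.

Lemma mero_meromorphic (f : C -> C) : meromorphic f -> mero f.
Proof.
by move=> hf z; case: (hf z) => [/hol_germ //|/pole_mult_gt0 /ho_germ].
Qed.

(** Values are arbitrary only at poles, and f has none, being equal to a holomorphic function on a
    punctured neighbourhood of each point. *)
Lemma meromorphic_null_eq (f F : C -> C) : meromorphic f -> (forall z, holomorphic_at F z) ->
  (forall z, null (fun w => f w - F w) z) -> forall z, f z = F z.
Proof.
move=> hf hF h0 z; case: (hf z) => hz.
  by have := null_val (holB hz (hF z)) (h0 z); move/eqP; rewrite subr_eq0 => /eqP.
have fF : punct f F z.
  have [e e0 he] := h0 z; exists e => // w wz we.
  by have /eqP := he w wz we; rewrite subr_eq0 => /eqP.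
have := hol_ord_ge0 (hF z) (ho_ext fF (pole_mult_gt0 hz)).
by rewrite oppr_ge0 lez_nat leqNgt hz.
Qed.

Lemma allord_meromorphic (b : C -> C) : meromorphic b -> (exists z, b z != 0) -> allord b.
Proof.
move=> hb [z bz]; have [h0|//] := mero_dichotomy (mero_meromorphic hb).
have h1 w : null (fun v => b v - 0) w.
  by apply: punct_trans (h0 w); exists 1 => // v _ _; rewrite subr0.
have := meromorphic_null_eq hb (fun w => hol_cst 0 w) h1 z.
by move=> E; rewrite E eqxx in bz.
Qed.

Lemma allord_derive1n (f : C -> C) (j : nat) : meromorphic f -> transcendental f ->
  allord (derive1n j f).
Proof.
move=> hf ft; have hm := mero_meromorphic hf.
have hj : mero (derive1n j f).
  elim: j => [|j IH]; first by rewrite derive1n0.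
  by rewrite derive1nS => z; exact: germ_derive.
have [h0|//] := mero_dichotomy hj; exfalso; apply: ft.
have [p hp] := null_derive1n hm h0; exists p, 1; split; first exact: oner_neq0.
move=> z _; rewrite hornerC divr1.
exact: (meromorphic_null_eq hf (fun w => hol_horner p w) hp).
Qed.

End Constants.

(** * Logarithmic growth forces rationality *)

Section Growth.
Variable R : realType.
Notation C := (R[i] : numFieldType).
Notation rcont := (continR 0 (2 * pi)).
Implicit Types (F G h g k : C -> C) (z w a c : C) (r s t e rho : R) (n m : int).

(** For |a| <= t <= sqrt r the weight ln(r/|a|) is at least half of ln r. *)
Lemma cnt_lower h r t : allord h -> 1 <= t -> t ^+ 2 <= r ->
  cnt h t * (ln r / 2) <= ND (fun z => `|ordR h z|) r.
Proof.
move=> hh t1 tr; have t0 : 0 < t by exact: lt_le_trans t1.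
have tr' : t <= r by apply: le_trans tr; rewrite expr2 ler_peMr // ltW.
have r0 : 0 < r by exact: lt_le_trans tr'.
have r1 : 1 <= r by exact: le_trans tr'.
have [X [uX hX]] := ord_points r hh.
rewrite (cnt_seq uX tr' hX) (ND_seq uX); last 2 first.
- by move=> z /hX [].
- move=> z zr zX; apply/eqP/negPn/negP => z0; move/negP: zX; apply; apply/hX; split => //.
  by apply: contra z0 => /eqP E; rewrite /ordR E mulr0z normr0.
rewrite big_distrl /= big_mkcond big_seq [leRHS]big_seq; apply: ler_sum => a aX.
have [ar _] := (hX a).1 aX; case: ifPn => at_; last by rewrite mulr_ge0 // lg_ge0.
rewrite ler_wpM2l // /lg; have l0 : 0 <= ln r by exact: ln_ge0.
case: eqP => [_|/eqP a0]; first by rewrite ler_pdivrMr // ler_peMr // ler1n.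
have na : 0 < normc a by rewrite normc_gt0.
rewrite ln_div ?posrE //.
have h1 : ln (normc a) <= ln t by rewrite ler_ln ?posrE.
have h2 : 2 * ln t <= ln r.
  have : ln (t ^+ 2) <= ln r by rewrite ler_ln ?posrE ?exprn_gt0.
  by rewrite lnXn // -[ln t *+ 2]mulr_natl.
by move: h1 h2; move: (ln r) (ln t) (ln _) => u v x; clear; lra.
Qed.

(** Each zero or pole of larger modulus raises [cnt] by at least 1, so an unbounded set of moduli
    would push it beyond K. *)
Lemma cnt_bounded h K : allord h -> (forall t, 1 <= t -> cnt h t <= K) ->
  exists2 t0, 1 <= t0 & forall a, ord h a != 0 -> normc a <= t0.
Proof.
move=> hh hK; apply: contrapT => hn.
have step t : 1 <= t -> exists a, ord h a != 0 /\ t < normc a.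
  move=> t1; apply: contrapT => ha; apply: hn; exists t => // a oa.
  by rewrite leNgt; apply/negP => ta; apply: ha; exists a.
have H (j : nat) : exists2 t, 1 <= t & j%:R <= cnt h t.
  elim: j => [|j [t t1 ht]]; first by exists 1 => //; exact: cnt_ge0.
  have [a [oa ta]] := step t t1; exists (normc a); first exact: le_trans (ltW ta).
  by rewrite -natr1; apply: le_trans (cnt_step hh oa ta); rewrite lerD2r.
have [t t1 ht] := H (Num.bound K); have K0 : 0 <= K by exact: le_trans (cnt_ge0 1 hh) (hK 1 (lexx _)).
have := le_lt_trans (le_trans ht (hK t t1)) (archi_boundP K0); by rewrite ltxx.
Qed.

Lemma hol_prod (s : seq C) (u : C -> C -> C) z : (forall a, a \in s -> holomorphic_at (u a) z) ->
  holomorphic_at (fun w => \prod_(a <- s) u a w) z.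
Proof.
elim: s => [|a s IH] hs.
  by apply: hol_eq (hol_cst 1 z) => w; rewrite big_nil.
have h1 := hs a (mem_head _ _).
have h2 := IH (fun b bs => hs b ltac:(by rewrite inE bs orbT)).
by apply: hol_eq (holM h1 h2) => w; rewrite big_cons.
Qed.

Lemma ln_le_sqrt r : 1 <= r -> ln r <= 2 * Num.sqrt r.
Proof.
move=> r1; have s0 : 0 < Num.sqrt r by rewrite sqrtr_gt0 (lt_le_trans ltr01).
have E : r = Num.sqrt r ^+ 2 by rewrite sqr_sqrtr // (le_trans ler01).
rewrite {1}E lnXn // -[leLHS]mulr_natl; apply: ler_wpM2l => //.
by apply: ltW; exact: ln_sublinear.
Qed.

(** For [2 * x <= r] the left side is at most 16 B / sqrt r. It is the bound of [normc_log_deriv]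
    when the mean of |log |g|| grows at most like sqrt r. *)
Lemma decay_bound (r x B e : R) : 0 < e -> 0 <= B -> 1 <= r -> 2 * x <= r -> 0 <= x ->
  (16 * B / e) ^+ 2 <= r -> 4 * (r / (r - x) ^+ 2) * (B * Num.sqrt r) <= e.
Proof.
move=> e0 B0 r1 xr x0 hr; have r0 : 0 < r by exact: lt_le_trans r1.
have s0 : 0 < Num.sqrt r by rewrite sqrtr_gt0.
have E : r = Num.sqrt r ^+ 2 by rewrite sqr_sqrtr // ltW.
have hs : 16 * B <= e * Num.sqrt r.
  rewrite [leRHS]mulrC -ler_pdivrMr //; have p0 : 0 <= 16 * B / e.
    by rewrite divr_ge0 ?mulr_ge0 // ltW.
  by rewrite -ler_sqr ?nnegrE ?(ltW s0) // -E.
have h4 : r / (r - x) ^+ 2 <= 4 / r.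
  have rx : r / 2 <= r - x by clear -xr; lra.
  have d0 : 0 < r - x by apply: lt_le_trans rx; rewrite divr_gt0.
  rewrite ler_pdivrMr ?exprn_gt0 // mulrAC ler_pdivlMr // -expr2.
  have -> : r ^+ 2 = 4 * (r / 2) ^+ 2 by field.
  rewrite ler_wpM2l // ler_sqr ?nnegrE // ltW // divr_gt0 //.
apply: (@le_trans _ _ (4 * (4 / r) * (B * Num.sqrt r))).
  apply: ler_wpM2r; first by rewrite mulr_ge0 // ltW.
  by rewrite ler_pM2l.
have -> : 4 * (4 / r) * (B * Num.sqrt r) = (16 * B) * Num.sqrt r / r by field; rewrite gt_eqF.
by rewrite ler_pdivrMr // {2}E expr2 mulrA ler_wpM2r // ltW.
Qed.

Lemma normc_sub_bounds t0 r t a : 1 <= t0 -> 2 * t0 <= r -> normc a <= t0 ->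
  0 <= ln (normc (circ r t - a)) <= ln (2 * r).
Proof.
move=> t1 tr at_; have r0 : 0 < r by clear -t1 tr; lra.
have nc : normc (circ r t) = r by rewrite normc_circ gtr0_norm.
have h1 : 1 <= normc (circ r t - a).
  by have := ler_normcB (circ r t) a; rewrite nc; move: (normc (_ - _)) => x; clear -t1 tr at_; lra.
have h2 : normc (circ r t - a) <= 2 * r.
  by have := normcB_le (circ r t) a; rewrite nc; move: (normc (_ - _)) => x; clear -t1 tr at_; lra.
rewrite ln_ge0 //= ler_ln ?posrE //; first exact: lt_le_trans h1.
by rewrite mulr_gt0.
Qed.

Lemma ord_cancel (f : C -> C) (X : seq C) : allord f -> uniq X -> (forall z, (z \in X) <-> ord f z != 0) ->
  forall z, has_order (fun w => f w * \prod_(a <- X) (w - a) ^ (- ord f a)) z 0.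
Proof.
move=> hf uX hX z.
have hp := @ho_prod R C X (fun a w => (w - a) ^ (- ord f a))
  (fun a => if a == z then - ord f a else 0) z.
have := ho_M (ordP z hf) (hp _).
have -> : ord f z + \sum_(a <- X) (if a == z then - ord f a else 0) = 0.
  have [zX|zX] := boolP (z \in X).
    rewrite (bigD1_seq z) //= eqxx big1 ?addr0 ?subrr // => a /negbTE ->.
    by [].
  rewrite big_seq big1 ?addr0.
    by apply/eqP/negPn/negP => /hX; rewrite (negbTE zX).
  by move=> a aX; rewrite ifF //; apply/negbTE; apply: contraNneq zX => <-.
apply=> a aX; case: eqP => [->|/eqP az].
  by have := ho_exprz (- ord f z) (ho_sub z); rewrite mul1r.
apply: ho_hol; first by apply: hol_exprz; rewrite eq_sym.
by rewrite expfz_neq0 // subr_eq0 eq_sym.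
Qed.

Lemma rational_of_divisor (f : C -> C) (X : seq C) c :
  (forall z, z \notin X -> f z = c * \prod_(a <- X) (z - a) ^ ord f a) -> rational_function f.
Proof.
(* The successor adds a common factor X - a to numerator and denominator. Thus the denominator
   vanishes on all of [X], where the product formula for f is not assumed. *)
move=> hX; pose pa a : {poly C} := ('X - a%:P) ^+ `|Num.max (ord f a) 0|.+1.
pose qa a : {poly C} := ('X - a%:P) ^+ `|Num.max (- ord f a) 0|.+1.
exists (c%:P * \prod_(a <- X) pa a), (\prod_(a <- X) qa a); split.
  rewrite prodf_seq_neq0; apply/allP => a _; apply/implyP => _.
  by rewrite expf_neq0 // polyXsubC_eq0.
move=> z; rewrite horner_prod prodf_seq_neq0 => /allP hq.
have za a : a \in X -> z - a != 0.
  by move=> /hq /implyP /(_ isT); rewrite horner_exp hornerXsubC expf_eq0.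
have zX : z \notin X by apply/negP => /za; rewrite subrr eqxx.
rewrite hX // hornerM hornerC horner_prod -mulrA -prodf_div; congr (_ * _).
rewrite big_seq [RHS]big_seq; apply: eq_bigr => a aX.
rewrite /pa /qa !horner_exp hornerXsubC; have z0 := za a aX.
have [h0|h0] := boolP (0 <= ord f a).
  have h1 : - ord f a <= 0 by rewrite oppr_le0.
  rewrite max_l // max_r // absz0 expr1 exprS mulrC mulKf //.
  by rewrite -[in LHS](gez0_abs h0).
rewrite -ltNge in h0; have h1 : 0 <= - ord f a by rewrite oppr_ge0 ltW.
rewrite max_r ?(ltW h0) // max_l // absz0 expr1 exprS invfM mulrA divff // mul1r.
by rewrite abszN exprnN ltz0_abs // opprK.
Qed.

(* Otherwise f has finitely many zeros and poles, and dividing them out leaves a zero-free entire g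
   whose logarithmic derivative is bounded by O(log r / r), hence vanishes. *)
Lemma log_growth (f : C -> C) e : meromorphic f -> transcendental f -> 0 < e ->
  exists r0, forall r, r0 <= r -> goodr f r -> ln r <= e * characteristic r f.
Proof.
move=> fm ft e0; apply: contrapT => hn.
have hf : allord f by have := allord_derive1n 0 fm ft; rewrite derive1n0.
(* Denying the claim yields arbitrarily large good radii with [e * characteristic r f < ln r];
   through the definition of [Theta] this becomes [Theta f r <= A * ln r + d]. *)
pose A := 2 / e; pose d := `|ln (normc (lead f))| + 1.
have A0 : 0 < A by rewrite divr_gt0.
have d0 : 0 <= d by rewrite addr_ge0.
have hT r0 : exists r, [/\ r0 <= r, goodr f r & Theta f r <= A * ln r + d].
  apply: contrapT => h; apply: hn; exists r0 => r rr hg; rewrite leNgt; apply/negP => lt.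
  apply: h; exists r; split => //; rewrite /Theta -addrA lerD2r /A mulrAC -mulrA ler_wpM2l //.
  by rewrite ler_pdivlMr // mulrC ltW.
have [t0 t01 ht0] : exists2 t0, 1 <= t0 & forall a, ord f a != 0 -> normc a <= t0.
  (* [cnt f t * (ln r / 2)] is at most [A * ln r + d] for suitable r; requiring [expR 1 <= r] makes
     [ln r] at least 1, so that d is absorbed into [d * ln r]. *)
  apply: (@cnt_bounded f (2 * (A + d)) hf) => t t1.
  have [r [hr hg hTr]] := hT (Num.max (t ^+ 2) (expR 1)).
  move: hr; rewrite ge_max => /andP[tr er].
  have r0 : 0 < r by apply: lt_le_trans er; exact: expR_gt0.
  have r1 : 1 <= r by apply: le_trans er; rewrite -expR0 ler_expR.
  have l1 : 1 <= ln r by rewrite -(expRK 1) ler_ln ?posrE ?expR_gt0.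
  have [_ _ hN] := Theta_bounds hf r1 hg.
  have := le_trans (le_trans (cnt_lower hf t1 tr) hN) hTr => H.
  have l0 : 0 < ln r by exact: lt_le_trans l1.
  rewrite -(@ler_pM2r _ (ln r / 2)) ?divr_gt0 //; apply: le_trans H _.
  have -> : 2 * (A + d) * (ln r / 2) = A * ln r + d * ln r by field.
  by rewrite lerD2l ler_peMr.
have [X [uX hX0]] := ord_points t0 hf.
have hX z : (z \in X) <-> ord f z != 0.
  by split => [/hX0 []//|oz]; apply/hX0; split => //; exact: ht0.
pose F w := f w * \prod_(a <- X) (w - a) ^ (- ord f a); pose g := reg F.
have hF z : has_order F z 0 by exact: ord_cancel.
have hg z : regular g z by exact: reg_hol.
have gF z : regular f z -> g z = F z.
  move=> hz; apply: reg_id; apply: holM; first by case: hz.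
  apply: hol_prod => a /hX oa; apply: hol_exprz; apply: contraNneq oa => <-.
  by apply/eqP; exact: regular_ord.
pose N := \sum_(a <- X) `|ordR f a|; have N0 : 0 <= N by exact: sumr_ge0.
have hlog r t : 2 * t0 <= r -> goodr f r -> `|logn g r t| <= `|logn f r t| + N * ln (2 * r).
  move=> tr gr; have r0 : 0 < r by clear -t01 tr; lra.
  have nc : normc (circ r t) = r by rewrite normc_circ gtr0_norm.
  have [h1 h2] := gr _ nc; rewrite /logn gF // /F normcM.
  have za a : a \in X -> circ r t - a != 0.
    move=> aX; rewrite subr_eq0; apply: contraTneq (ht0 a ((hX a).1 aX)) => <-.
    by rewrite nc -ltNge; clear -t01 tr; lra.
  have zn a : a \in X -> (circ r t - a) ^ (- ord f a) != 0 by move=> /za; exact: expfz_neq0.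
  have p0 : \prod_(a <- X) (circ r t - a) ^ (- ord f a) != 0.
    by rewrite prodf_seq_neq0; apply/allP => a /zn.
  rewrite [ln (normc _ * _)]lnM ?posrE ?normc_gt0 // ln_normc_prod //.
  apply: le_trans (ler_normD _ _) _; rewrite lerD2l.
  apply: le_trans (ler_norm_sum _ _ _) _; rewrite /N big_distrl /=.
  rewrite big_seq [leRHS]big_seq; apply: ler_sum => a aX.
  rewrite normcXz lnXz; last by rewrite normc_gt0 za.
  rewrite normrM mulrNz normrN ler_wpM2l //.
  have /andP[l0 l1] := normc_sub_bounds t t01 tr (ht0 a ((hX a).1 aX)).
  by rewrite ger0_norm.
(* From [ln (2 * r) <= 2 * ln r] and [ln r <= 2 * Num.sqrt r]: the bound
   [A * ln r + d + N * ln (2 * r)] is at most [B * Num.sqrt r]. *)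
pose B := 2 * (A + 2 * N) + d; have B0 : 0 <= B.
  by rewrite /B; move: N0 A0 d0; clear; lra.
have hmean r : 2 * t0 <= r -> goodr f r -> Theta f r <= A * ln r + d ->
    rmean (fun t => `|logn g r t|) <= B * Num.sqrt r.
  move=> tr gr hTr; have r0 : 0 < r by clear -t01 tr; lra.
  have r1 : 1 <= r by clear -t01 tr; lra.
  have r2 : 2 <= r by clear -t01 tr; lra.
  have ggr : goodr g r by move=> z _.
  have c1 : rcont (fun t => `|logn f r t|) by apply: rcont_abs; exact: logn_cont.
  have c2 : rcont (fun t => `|logn g r t|) by apply: rcont_abs; exact: logn_cont.
  have c3 : rcont (fun=> N * ln (2 * r)) by exact: rcont_cst.
  apply: (@le_trans _ _ (rmean (fun t => `|logn f r t| + N * ln (2 * r)))).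
    apply: rmean_le => //; first exact: rcontD.
    by move=> t _; exact: hlog.
  rewrite rmeanD // rmean_cst; have [_ h1 _] := Theta_bounds hf r1 gr.
  have h2 : ln (2 * r) <= 2 * ln r.
    rewrite lnM ?posrE // mulr_natl mulr2n lerD2r ler_ln ?posrE //.
  have h3 := ln_le_sqrt r1; have h4 := ler_wpM2l N0 h2.
  have h5 : 1 <= Num.sqrt r by rewrite -(@sqrtr1 R) ler_wsqrtr.
  have h6 := ler_wpM2l d0 h5.
  have AN0 : 0 <= A + 2 * N by move: N0 A0; clear; lra.
  have h7 := ler_wpM2l AN0 h3; rewrite /B.
  have h8 := le_trans h1 hTr; move: h8 h4 h6 h7.
  move: (rmean _) (ln (2 * r)) (Num.sqrt r) (ln r) => u v s w; clear; nra.
have dg z : derive1 g z = 0.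
  have nz : normc ('D_1 g z / g z) = 0.
    apply/eqP; rewrite eq_le normc_ge0 andbT; apply/ler_addgt0Pr => del del0; rewrite add0r.
    have [r [hr gr hTr]] := hT (Num.max (2 * t0) (Num.max (2 * normc z + 1) ((16 * B / del) ^+ 2))).
    move: hr; rewrite !ge_max => /andP[tr /andP[zr br]].
    have r1 : 1 <= r by clear -t01 tr; lra.
    have zr' : normc z < r by have := normc_ge0 z; clear -zr; lra.
    have d1 w : normc w < r + 1 -> derivable g w 1 by move=> _; exact: hol_derivable (hg w).1.
    have d2 w : normc w < r + 1 -> g w != 0 by move=> _; exact: (hg w).2.
    apply: le_trans (normc_log_deriv d1 d2 zr' ltac:(by rewrite ltrDl)) _.
    apply: le_trans (decay_bound del0 B0 r1 _ (normc_ge0 z) br); last by clear -zr; lra.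
    rewrite ler_wpM2l //; last exact: hmean.
    by rewrite mulr_ge0 // divr_ge0 ?sqr_ge0 // (le_trans ler01).
  move/eqP: nz; rewrite normc_eq0 mulf_eq0 invr_eq0 (negbTE (hg z).2) orbF => /eqP E.
  by rewrite derive1E.
have gm : mero g by move=> z; exact: hol_germ (hg z).1.
have [|c hc] := null_derive_cst gm; first by exists 1 => // w _ _; rewrite dg.
have gc z : g z = c.
  by have := null_val (holB (hg z).1 (hol_cst c z)) (hc z); move/eqP; rewrite subr_eq0 => /eqP.
apply: ft; apply: (@rational_of_divisor f X c) => z zX.
have oz : ord f z = 0 by apply/eqP/negPn/negP => /hX; rewrite (negbTE zX).
have rz : regular f z.
  have hz := ordP z hf; rewrite oz in hz.
  case: (fm z) => [h1|hp]; last first.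
    have := ho_unique hz (pole_mult_gt0 hp); move: hp; by case: (pole_mult f z).
  split => //; have /has_orderP [k [k1 k2 k3]] := hz.
  have fk : punct f k z by apply: punct_trans k3 _; exists 1 => // w _ _; rewrite expr0z mul1r.
  by rewrite (punct_val h1 k1 fk).
rewrite -(gc z) gF // /F -mulrA -big_split /= big_seq big1 ?mulr1 // => a aX.
have za : z - a != 0 by rewrite subr_eq0; apply: contraNneq zX => ->.
by rewrite -expfzDr // addNr expr0z.
Qed.

End Growth.

(** * Small terms and characteristic functions *)

Section SmallTerms.
Variables (R : realType) (T : R -> R).
Implicit Types (r e c : R) (s u : R -> R) (P Q : R -> Prop).

Definition ev P := exists E, thin E /\ exists r0, forall r, r0 <= r -> ~ E r -> P r.

(** Only an upper bound, so smallness passes to anything below ([small_le]) and negative terms cost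
    nothing. The set E is independent of e. *)
Definition small s := exists E, thin E /\
  forall e, 0 < e -> exists r0, forall r, r0 <= r -> ~ E r -> s r <= e * T r.

Definition bigO s := exists K : R, 0 <= K /\ ev (fun r => s r <= K * T r).

Lemma ev_and P Q : ev P -> ev Q -> ev (fun r => P r /\ Q r).
Proof.
move=> [E1 [t1 [r1 h1]]] [E2 [t2 [r2 h2]]]; exists (E1 `|` E2); split; first exact: thinU.
exists (Num.max r1 r2) => r; rewrite ge_max => /andP[rr1 rr2] hE.
by split; [apply: h1 => // h; apply: hE; left|apply: h2 => // h; apply: hE; right].
Qed.

Lemma ev_imp P Q : ev P -> (forall r, P r -> Q r) -> ev Q.
Proof. by move=> [E [tE [r0 h]]] PQ; exists E; split => //; exists r0 => r rr /(h r rr) /PQ. Qed.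

Lemma ev_ge c : ev (fun r => c <= r).
Proof. by exists set0; split; [exact: thin0|exists c]. Qed.

Lemma ev_all (j : nat) (P : nat -> R -> Prop) : (forall i, (i < j)%N -> ev (P i)) ->
  ev (fun r => forall i, (i < j)%N -> P i r).
Proof.
elim: j => [|j IH] hP; first by apply: ev_imp (ev_ge 0) _.
have h1 := IH (fun i ij => hP i (ltnW ij)); have h2 := hP j (ltnSn j).
apply: ev_imp (ev_and h1 h2) _ => r [h3 h4] i; rewrite ltnS leq_eqVlt => /predU1P[->//|].
exact: h3.
Qed.

Lemma ev_exists P : ev P -> exists r, P r.
Proof.
by move=> [E [tE [r0 h]]]; have [r rr hE] := thin_unbounded r0 tE; exists r; exact: h.
Qed.

Lemma small_ev s e : small s -> 0 < e -> ev (fun r => s r <= e * T r).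
Proof. by move=> [E [tE h]] /h [r0 hr0]; exists E; split => //; exists r0. Qed.

Lemma small_le s u : small u -> ev (fun r => s r <= u r) -> small s.
Proof.
move=> [E1 [t1 h1]] [E2 [t2 [r2 h2]]]; exists (E1 `|` E2); split; first exact: thinU.
move=> e /h1 [r1 h3]; exists (Num.max r1 r2) => r; rewrite ge_max => /andP[rr1 rr2] hE.
apply: le_trans (h2 _ rr2 (fun h => hE (or_intror h))) _.
by apply: h3 => // h; apply: hE; left.
Qed.

Lemma smallD s u : small s -> small u -> small (fun r => s r + u r).
Proof.
move=> [E1 [t1 h1]] [E2 [t2 h2]]; exists (E1 `|` E2); split; first exact: thinU.
move=> e e0; have e2 : 0 < e / 2 by rewrite divr_gt0.
have [r1 h3] := h1 _ e2; have [r2 h4] := h2 _ e2.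
exists (Num.max r1 r2) => r; rewrite ge_max => /andP[rr1 rr2] hE.
have := h3 r rr1 (fun h => hE (or_introl h)); have := h4 r rr2 (fun h => hE (or_intror h)).
have -> : e * T r = e / 2 * T r + e / 2 * T r by rewrite -mulrDl -splitr.
by move=> a b; exact: lerD.
Qed.

Lemma smallZp c s : 0 < c -> small s -> small (fun r => c * s r).
Proof.
move=> c0 [E [tE h]]; exists E; split => // e e0.
have [r0 hr0] := h (e / c) ltac:(by rewrite divr_gt0); exists r0 => r rr hE.
by rewrite mulrC -ler_pdivlMr // mulrAC; exact: hr0.
Qed.

Hypothesis ln_small : small (@ln R).

Lemma T_ge_ln c : ev (fun r => c * ln r <= T r).
Proof.
have c0 : 0 < `|c| + 1 by rewrite ltr_wpDl.
have := small_ev ln_small (e := (`|c| + 1)^-1) ltac:(by rewrite invr_gt0) => h.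
apply: ev_imp (ev_and h (ev_ge 1)) _ => r [h1 h2].
rewrite mulrC ler_pdivlMr // mulrC in h1; apply: le_trans h1.
by rewrite ler_wpM2r ?ln_ge0 // (le_trans (ler_norm c)) // lerDl.
Qed.

Lemma T_ge c : ev (fun r => c <= T r).
Proof.
apply: ev_imp (ev_and (T_ge_ln `|c|) (ev_ge (expR 1))) _ => r [h1 h2].
apply: le_trans h1; apply: le_trans (ler_norm c) _; rewrite ler_peMr //.
by rewrite -(expRK 1) ler_ln ?posrE ?expR_gt0 // (lt_le_trans _ h2) // expR_gt0.
Qed.

Lemma small_cst c : small (fun=> c).
Proof.
have c0 : 0 < `|c| + 1 by rewrite ltr_wpDl.
apply: small_le (smallZp c0 ln_small) _; apply: ev_imp (ev_ge (expR 1)) _ => r h2.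
have l1 : 1 <= ln r.
  by rewrite -(expRK 1) ler_ln ?posrE ?expR_gt0 // (lt_le_trans _ h2) // expR_gt0.
apply: le_trans (ler_norm c) _; apply: (@le_trans _ _ (`|c| + 1)); first by rewrite lerDl.
by rewrite ler_peMr // ltW.
Qed.

Lemma smallZ c s : 0 <= c -> small s -> small (fun r => c * s r).
Proof.
rewrite le_eqVlt => /predU1P[<- _|]; last exact: smallZp.
by apply: small_le (small_cst 0) _; apply: ev_imp (ev_ge 0) _ => r _; rewrite mul0r.
Qed.

Lemma small_sum (j : nat) (s : nat -> R -> R) : (forall i, (i < j)%N -> small (s i)) ->
  small (fun r => \sum_(0 <= i < j) s i r).
Proof.
elim: j => [|j IH] hs.
  apply: small_le (small_cst 0) _; apply: ev_imp (ev_ge 0) _ => r _.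
  by rewrite big_nil.
apply: small_le (smallD (IH (fun i ij => hs i (ltnW ij))) (hs j (ltnSn j))) _.
by apply: ev_imp (ev_ge 0) _ => r _; rewrite big_nat_recr.
Qed.

Lemma big_small s : small s -> bigO s.
Proof. by move=> hs; exists 1; split => //; exact: small_ev. Qed.

Lemma bigO_le s u : bigO u -> ev (fun r => s r <= u r) -> bigO s.
Proof.
move=> [K [K0 h1]] h2; exists K; split => //; apply: ev_imp (ev_and h1 h2) _ => r [h3 h4].
exact: le_trans h4 h3.
Qed.

Lemma bigOD s u : bigO s -> bigO u -> bigO (fun r => s r + u r).
Proof.
move=> [K [K0 h1]] [L [L0 h2]]; exists (K + L); split; first exact: addr_ge0.
by apply: ev_imp (ev_and h1 h2) _ => r [h3 h4]; rewrite mulrDl; exact: lerD.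
Qed.

Lemma bigOZ c s : 0 <= c -> bigO s -> bigO (fun r => c * s r).
Proof.
move=> c0 [K [K0 h]]; exists (c * K); split; first exact: mulr_ge0.
by apply: ev_imp h _ => r h1; rewrite -mulrA ler_wpM2l.
Qed.

Lemma bigO_T : bigO T.
Proof. by exists 1; split => //; apply: ev_imp (ev_ge 0) _ => r _; rewrite mul1r. Qed.

(** [ln s] is at most 2 sqrt s, hence O(sqrt T), and sqrt T is o(T) because [ln_small] forces T to
    infinity. *)
Lemma small_ln s : bigO s -> ev (fun r => 1 <= s r) -> small (fun r => ln (s r)).
Proof.
move=> [K [K0 [E1 [t1 [r1 h1]]]]] [E2 [t2 [r2 h2]]].
have [E3 [t3 h3]] := ln_small.
exists (E1 `|` (E2 `|` E3)); split; first by do 2!apply: thinU => //.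
move=> e e0; pose x := Num.max 1 ((2 * (K + 1) / e) ^+ 2).
have [r3 hr3] := h3 1 ltr01.
exists (Num.max (Num.max r1 r2) (Num.max r3 (expR x))) => r.
rewrite !ge_max => /andP[/andP[rr1 rr2] /andP[rr3 rr4]] hE.
have sK := h1 r rr1 (fun h => hE (or_introl h)).
have s1 := h2 r rr2 (fun h => hE (or_intror (or_introl h))).
have lT := hr3 r rr3 (fun h => hE (or_intror (or_intror h))); rewrite mul1r in lT.
have xT : x <= T r.
  apply: le_trans lT; rewrite -(expRK x) ler_ln ?posrE ?expR_gt0 //.
  exact: lt_le_trans (expR_gt0 _) rr4.
have [T1 T2] : 1 <= T r /\ (2 * (K + 1) / e) ^+ 2 <= T r.
  by move: xT; rewrite /x ge_max => /andP[].
have T0 : 0 <= T r by exact: le_trans T1.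
apply: le_trans (ln_le_sqrt s1) _.
have K1 : 0 < K + 1 by rewrite ltr_wpDl.
have h4 : Num.sqrt (s r) <= (K + 1) * Num.sqrt (T r).
  have e1 : 0 <= (K + 1) * Num.sqrt (T r) by rewrite mulr_ge0 ?sqrtr_ge0 // ltW.
  rewrite -ler_sqr ?nnegrE ?sqrtr_ge0 // sqr_sqrtr ?(le_trans ler01 s1) //.
  rewrite exprMn sqr_sqrtr //; apply: le_trans sK _; apply: ler_wpM2r => //.
  by rewrite expr2; move: K0; clear; nra.
have h5 : 2 * (K + 1) <= e * Num.sqrt (T r).
  rewrite [leRHS]mulrC -ler_pdivrMr //.
  have p0 : 0 <= 2 * (K + 1) / e by rewrite divr_ge0 // ?mulr_ge0 // ltW.
  by rewrite -ler_sqr ?nnegrE ?sqrtr_ge0 // ?sqr_sqrtr.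
apply: (@le_trans _ _ (2 * (K + 1) * Num.sqrt (T r))).
  by rewrite -mulrA ler_wpM2l.
rewrite -{2}(sqr_sqrtr T0) expr2 mulrA ler_wpM2r ?sqrtr_ge0 //.
Qed.

End SmallTerms.

(** * The positive part of the logarithm *)

Section LogPlus.
Variable R : realType.
Implicit Types (x y : R).

Lemma logplus_ge0 x : 0 <= logplus x.
Proof. by rewrite /logplus le_max lexx. Qed.

Lemma logplus0 : logplus (0 : R) = 0.
Proof. by rewrite /logplus ln0 // maxxx. Qed.

Lemma logplus_ge_ln x : ln x <= logplus x.
Proof. by rewrite /logplus le_max lexx orbT. Qed.

Lemma logplus_le x y : 0 <= x -> x <= y -> logplus x <= logplus y.
Proof.
rewrite le_eqVlt => /predU1P[<- _|x0 xy]; first by rewrite logplus0 logplus_ge0.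
rewrite {1}/logplus ge_max logplus_ge0 /=; apply: le_trans (logplus_ge_ln y).
by rewrite ler_ln ?posrE // (lt_le_trans x0).
Qed.

Lemma logplusM x y : 0 <= x -> 0 <= y -> logplus (x * y) <= logplus x + logplus y.
Proof.
rewrite le_eqVlt => /predU1P[<- _|x0]; first by rewrite mul0r logplus0 addr_ge0 ?logplus_ge0.
rewrite le_eqVlt => /predU1P[<-|y0]; first by rewrite mulr0 logplus0 addr_ge0 ?logplus_ge0.
rewrite {1}/logplus ge_max addr_ge0 ?logplus_ge0 //= lnM ?posrE //.
by apply: lerD; exact: logplus_ge_ln.
Qed.

Lemma logplusX x (n : nat) : 0 <= x -> logplus (x ^+ n) = n%:R * logplus x.
Proof.
rewrite le_eqVlt => /predU1P[<-|x0].
  case: n => [|n]; first by rewrite expr0 mul0r /logplus ln1 maxxx.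
  by rewrite expr0n /= logplus0 mulr0.
by rewrite /logplus lnXn // -[ln x *+ n]mulr_natl maxr_pMr ?mulr0 ?ler0n.
Qed.

Lemma logplus2 x : 0 <= x -> logplus (2 * x) <= logplus x + ln 2.
Proof.
move=> x0; apply: le_trans (logplusM _ x0) _ => //; rewrite addrC lerD2l /logplus.
by rewrite ge_max lexx andbT ln_ge0 // ler1n.
Qed.

Lemma logplusD x y : 0 <= x -> 0 <= y -> logplus (x + y) <= logplus x + logplus y + ln 2.
Proof.
wlog xy : x y / x <= y => [hw x0 y0|x0 y0].
  have [/hw|/ltW /hw] := leP x y; first exact.
  by move=> /(_ y0 x0); rewrite addrC [logplus y + _]addrC.
apply: le_trans (logplus_le (addr_ge0 x0 y0) (_ : _ <= 2 * y)) _.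
  by rewrite mulr_natl mulr2n lerD2r.
by apply: le_trans (logplus2 y0) _; rewrite lerD2r lerDr logplus_ge0.
Qed.

End LogPlus.

(** * Proximity and characteristic functions under products, inverses and derivatives *)

Section Characteristic.
Variable R : realType.
Notation C := (R[i] : numFieldType).
Notation rcont := (continR 0 (2 * pi)).
Implicit Types (F G h g k : C -> C) (z w a c : C) (r s t e rho : R) (n m : int).

Lemma regularM h k z : regular h z -> regular k z -> regular (fun w => h w * k w) z.
Proof. by move=> [h1 h2] [k1 k2]; split; [exact: holM h1 k1|exact: mulf_neq0]. Qed.

Lemma regularV h z : regular h z -> regular (fun w => (h w)^-1) z.
Proof. by move=> [h1 h2]; split; [exact: holV h2 h1|rewrite invr_eq0]. Qed.

Lemma regular_cst c z : c != 0 -> regular (fun _ : C => c) z.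
Proof. by move=> c0; split => //; exact: hol_cst. Qed.

Lemma goodrM h k r : goodr h r -> goodr k r -> goodr (fun w => h w * k w) r.
Proof. by move=> gh gk z zr; apply: regularM; [exact: gh|exact: gk]. Qed.

Lemma goodrV h r : goodr h r -> goodr (fun w => (h w)^-1) r.
Proof. by move=> gh z zr; apply: regularV; exact: gh. Qed.

Lemma goodrX h r (j : nat) : goodr h r -> goodr (fun w => h w ^+ j) r.
Proof. by move=> gh z /gh [h1 h2]; split; [exact: holX|rewrite expf_neq0]. Qed.

Lemma goodr_cst c r : c != 0 -> goodr (fun _ : C => c) r.
Proof. by move=> c0 z _; exact: regular_cst. Qed.

Lemma normc_circ0 r t : 0 < r -> normc (circ r t) = r.
Proof. by move=> r0; rewrite normc_circ gtr0_norm. Qed.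

Lemma proximity_ext h k r : 0 < r -> (forall z, normc z = r -> h z = k z) ->
  proximity r h = proximity r k.
Proof.
by move=> r0 hk; rewrite !proximityE; apply: eq_rmean => t _; rewrite hk // normc_circ0.
Qed.

Lemma proximity_ge0 h r : 0 < r -> goodr h r -> 0 <= proximity r h.
Proof.
move=> r0 hg; rewrite proximityE -(rmean_cst (0 : R)); apply: rmean_le.
- exact: rcont_cst.
- exact: lplus_cont.
- by move=> t _; exact: logplus_ge0.
Qed.

Lemma proximityM h k r : 0 < r -> goodr h r -> goodr k r ->
  proximity r (fun z => h z * k z) <= proximity r h + proximity r k.
Proof.
move=> r0 gh gk; rewrite !proximityE -rmeanD; [|exact: lplus_cont|exact: lplus_cont].
apply: rmean_le; first exact: (@lplus_cont R (fun z => h z * k z) r r0 (goodrM gh gk)).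
  exact: rcontD (lplus_cont r0 gh) (lplus_cont r0 gk).
by move=> t _; rewrite normcM; apply: logplusM; exact: normc_ge0.
Qed.

Lemma proximityX h r (j : nat) : 0 < r -> goodr h r ->
  proximity r (fun z => h z ^+ j) = j%:R * proximity r h.
Proof.
move=> r0 gh; rewrite !proximityE -rmeanZ; last exact: lplus_cont.
by apply: eq_rmean => t _; rewrite normcX logplusX // normc_ge0.
Qed.

Lemma proximity_cst c r : proximity r (fun _ : C => c) = logplus (normc c).
Proof. by rewrite proximityE rmean_cst. Qed.

Lemma proximityV h r : proximity r (fun z => (h z)^-1) = rmean (lminus h r).
Proof. by rewrite proximityE; apply: eq_rmean => t _; rewrite /lminus normcV. Qed.

Lemma allordM h k : allord h -> allord k -> allord (fun z => h z * k z).
Proof. by move=> hh hk z; exists (ord h z + ord k z); exact: ho_M (ordP z hh) (ordP z hk). Qed.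

Lemma ordM h k z : allord h -> allord k -> ord (fun z => h z * k z) z = ord h z + ord k z.
Proof. by move=> hh hk; apply: ord_eq; exact: ho_M (ordP z hh) (ordP z hk). Qed.

Lemma allordV h : allord h -> allord (fun z => (h z)^-1).
Proof. by move=> hh z; exists (- ord h z); exact: ho_V (ordP z hh). Qed.

Lemma ordV h z : allord h -> ord (fun z => (h z)^-1) z = - ord h z.
Proof. by move=> hh; apply: ord_eq; exact: ho_V (ordP z hh). Qed.

Lemma ordX h z (j : nat) : allord h -> ord (fun z => h z ^+ j) z = ord h z *+ j.
Proof. by move=> hh; apply: ord_eq; exact: ho_X (ordP z hh). Qed.

Lemma allord_cst c : c != 0 -> allord (fun _ : C => c).
Proof. by move=> c0 z; exists 0; exact: ho_cst. Qed.

Lemma ord_cst c z : c != 0 -> ord (fun _ : C => c) z = 0.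
Proof. by move=> c0; apply: ord_eq; exact: ho_cst. Qed.

Lemma ordRM h k z : allord h -> allord k -> ordR (fun z => h z * k z) z = ordR h z + ordR k z.
Proof. by move=> hh hk; rewrite /ordR ordM // intrD. Qed.

Lemma ordRV h z : allord h -> ordR (fun z => (h z)^-1) z = - ordR h z.
Proof. by move=> hh; rewrite /ordR ordV // mulrNz. Qed.

Lemma pm_M h k z : allord h -> allord k -> pm (fun z => h z * k z) z <= pm h z + pm k z.
Proof.
move=> hh hk; have hhk := allordM hh hk.
rewrite (pm_ord z hhk) ge_max addr_ge0 ?pm_ge0 // andbT ordRM //.
rewrite (ordR_zp z hh) (ordR_zp z hk); have := zm_ge0 h z; have := zm_ge0 k z.
by generalize (zm h z) (pm h z) (zm k z) (pm k z) => p q u v; clear; lra.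
Qed.

Lemma pm_V h z : allord h -> pm (fun z => (h z)^-1) z = zm h z.
Proof. by move=> hh; have hv := allordV hh; rewrite pm_ord // zm_ord // ordRV // opprK. Qed.

Lemma characteristicE h r : allord h -> 0 < r ->
  characteristic r h = proximity r h + ND (pm h) r.
Proof. by move=> hh r0; rewrite /characteristic counting_polesE. Qed.

Lemma characteristic_ge0 h r : allord h -> 1 <= r -> goodr h r -> 0 <= characteristic r h.
Proof.
move=> hh r1 gh; have r0 : 0 < r by exact: lt_le_trans r1.
rewrite (characteristicE hh r0); apply: addr_ge0; first exact: (proximity_ge0 r0 gh).
by apply: ND_ge0 r1 (lf_pm hh) _ => z; exact: pm_ge0.
Qed.

Lemma characteristicM h k r : allord h -> allord k -> 1 <= r -> goodr h r -> goodr k r ->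
  characteristic r (fun z => h z * k z) <= characteristic r h + characteristic r k.
Proof.
move=> hh hk r1 gh gk; have r0 : 0 < r by exact: lt_le_trans r1.
rewrite (characteristicE hh r0) (characteristicE hk r0) (characteristicE (allordM hh hk) r0).
rewrite addrACA; apply: lerD; first exact: (proximityM r0 gh gk).
rewrite -(NDD r (lf_pm hh) (lf_pm hk)).
apply: (ND_le r1 (lf_pm (allordM hh hk)) (lfD (lf_pm hh) (lf_pm hk))) => z.
exact: pm_M.
Qed.

Lemma characteristicV h r : allord h -> 1 <= r -> goodr h r ->
  characteristic r (fun z => (h z)^-1) = characteristic r h - ln (normc (lead h)).
Proof.
move=> hh r1 gh; have r0 : 0 < r by exact: lt_le_trans r1.
rewrite -(first_main hh r0 gh) (characteristicE (allordV hh) r0).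
have E : pm (fun z => (h z)^-1) = zm h by apply/funext => z; exact: (pm_V z hh).
by rewrite proximityV E.
Qed.

Lemma ord_ge0_hol h z : allord h -> 0 <= ord h z ->
  exists2 g, holomorphic_at g z & punct h g z.
Proof.
move=> hh h0; have /has_orderP [g [g1 g2 g3]] := ordP z hh.
exists (fun w => (w - z) ^+ `|ord h z|%N * g w); first exact: holM (holX _ (hol_sub z z)) g1.
apply: punct_trans g3 _; exists 1 => // w _ _.
by rewrite -[X in (w - z) ^ X](gez0_abs h0).
Qed.

Lemma ord_ge0 h z g : allord h -> holomorphic_at g z -> punct h g z -> 0 <= ord h z.
Proof. move=> hh hg hp; exact: (hol_ord_ge0 hg (ho_ext hp (ordP z hh))). Qed.

Lemma punct_derive1 h g z : punct h g z -> punct (derive1 h) (derive1 g) z.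
Proof.
move=> /punct_near_near [e e0 he]; exists e; first exact: e0.
move=> w wz we; rewrite !derive1E.
by apply: near_eq_derive; exact: (he w wz we).
Qed.

Lemma ord_derive_ge0 h z : allord h -> allord (derive1 h) -> 0 <= ord h z -> 0 <= ord (derive1 h) z.
Proof.
move=> hh hd /(ord_ge0_hol hh) [g g1 /punct_derive1 g2].
exact: ord_ge0 hd (hol_derive1 g1) g2.
Qed.

Lemma ord_derive h z : allord h -> ord h z != 0 -> ord (derive1 h) z = ord h z - 1.
Proof. by move=> hh h0; apply: ord_eq; apply: ho_derive h0 (ordP z hh). Qed.

(** Differentiation raises the order of a pole by one, hence at most doubles it. *)
Lemma pm_derive h z : allord h -> allord (derive1 h) -> pm (derive1 h) z <= 2 * pm h z.
Proof.
move=> hh hd; rewrite (pm_ord z hd) ge_max mulr_ge0 ?pm_ge0 // andbT.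
have [h0|h0] := leP 0 (ord h z).
  have := ord_derive_ge0 hh hd h0; rewrite -(ler0z R) -/(ordR _ _) => h1.
  by apply: (@le_trans _ _ 0); [rewrite oppr_le0|rewrite mulr_ge0 // pm_ge0].
rewrite /ordR ord_derive ?lt_eqF // intrB (pm_ord z hh) -/(ordR h z).
have h1 : ordR h z <= -1 by rewrite /ordR -(intrN R 1) ler_int -ltzD1 addNr.
by rewrite max_l; move: h1; generalize (ordR h z) => x; clear; lra.
Qed.

End Characteristic.

(** * Functions whose characteristic is O(T(r, f)) *)

Section Mild.
Variable R : realType.
Notation C := (R[i] : numFieldType).
Notation rcont := (continR 0 (2 * pi)).
Implicit Types (F G h g k : C -> C) (z w a c : C) (r s t e rho : R) (n m : int).
Variable f : C -> C.
Hypothesis fm : meromorphic f.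
Hypothesis ft : transcendental f.

Definition Tf r := characteristic r f.

Lemma ev_goodr h : allord h -> ev (goodr h).
Proof.
move=> /thin_bad hh; exists [set r | ~ goodr h r]; split => //; exists 0 => r _.
by move=> /contrapT.
Qed.

Lemma small_logarithm : small Tf (@ln R).
Proof.
have hf : allord f by have := allord_derive1n 0 fm ft; rewrite derive1n0.
exists [set r | ~ goodr f r]; split; first exact: thin_bad.
move=> e e0; have [r0 h0] := log_growth fm ft e0; exists r0 => r rr /contrapT.
exact: h0.
Qed.

(** The error terms in the lemma on the logarithmic derivative for h are measured by T(r, h); in
    this class they are small against T(r, f). Products, inverses and derivatives stay in the class,
    so it contains M and G. *)
Definition mild h := allord h /\ bigO Tf (fun r => characteristic r h).

Lemma mild_f : mild f.
Proof.
by split; [have := allord_derive1n 0 fm ft; rewrite derive1n0|exact: bigO_T].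
Qed.

Lemma bigO_cst (x : R) : bigO Tf (fun _ : R => x).
Proof. exact: (big_small (small_cst small_logarithm x)). Qed.

Lemma mild_cst c : c != 0 -> mild (fun _ : C => c).
Proof.
move=> c0; have ac := allord_cst c0; split; first exact: ac.
apply: bigO_le (bigO_cst (logplus (normc c))) _.
apply: ev_imp (ev_ge 1) _ => r r1; have r0 : 0 < r by exact: lt_le_trans r1.
rewrite (characteristicE ac r0) proximity_cst.
have -> : ND (pm (fun _ : C => c)) r = 0.
  have E : pm (fun _ : C => c) = (fun z => 0 * pm (fun _ : C => c) z).
    by apply/funext => z; rewrite mul0r pm_ord // /ordR ord_cst // oppr0 maxxx.
  by rewrite E (NDZ 0 r (lf_pm ac)) mul0r.
by rewrite addr0.
Qed.

Lemma mildM h k : mild h -> mild k -> mild (fun z => h z * k z).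
Proof.
move=> [hh bh] [hk bk]; split; first exact: allordM.
apply: bigO_le (bigOD bh bk) _.
apply: ev_imp (ev_and (ev_ge 1) (ev_and (ev_goodr hh) (ev_goodr hk))) _ => r [r1 [g1 g2]].
exact: (characteristicM hh hk r1 g1 g2).
Qed.

Lemma mildV h : mild h -> mild (fun z => (h z)^-1).
Proof.
move=> [hh bh]; split; first exact: allordV.
apply: bigO_le (bigOD bh (bigO_cst (- ln (normc (lead h))))) _.
apply: ev_imp (ev_and (ev_ge 1) (ev_goodr hh)) _ => r [r1 g1].
by rewrite (characteristicV hh r1 g1).
Qed.

Lemma mild_eq h k : h =1 k -> mild h -> mild k.
Proof. by move=> /funext ->. Qed.

Lemma mildX h (j : nat) : mild h -> mild (fun z => h z ^+ j).
Proof.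
move=> mh; elim: j => [|j IH].
  by apply: mild_eq (mild_cst (oner_neq0 C)) => z; rewrite expr0.
by apply: mild_eq (mildM mh IH) => z; rewrite exprS.
Qed.

Lemma mild_prod (j : nat) (u : nat -> C -> C) : (forall i, (i < j)%N -> mild (u i)) ->
  mild (fun z => \prod_(0 <= i < j) u i z).
Proof.
elim: j => [|j IH] hu.
  by apply: mild_eq (mild_cst (oner_neq0 C)) => z; rewrite big_nil.
have m1 := IH (fun i ij => hu i (ltnW ij)).
by apply: mild_eq (mildM m1 (hu j (ltnSn j))) => z; rewrite big_nat_recr.
Qed.

Lemma pm_sub1 h z : allord h -> allord (fun w => h w - 1) -> pm (fun w => h w - 1) z <= pm h z.
Proof.
move=> hh h1; rewrite (pm_ord z h1) (pm_ord z hh).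
have [h0|h0] := leP 0 (ord h z).
  have [g g1 g2] := ord_ge0_hol hh h0.
  have := ord_ge0 h1 (holB g1 (hol_cst 1 z)) (punct1 (fun v => v - 1) g2).
  rewrite -(ler0z R) -/(ordR _ _) => E.
  by rewrite [leLHS]max_r ?oppr_le0 // le_max lexx orbT.
have m1 : (-1 : C) != 0 by rewrite oppr_eq0 oner_neq0.
have := ord_eq (ho_D_lt (ordP z hh) (ho_cst z m1) h0).
by rewrite /ordR => ->.
Qed.

Lemma mild_sub1 h : mild h -> allord (fun z => h z - 1) -> mild (fun z => h z - 1).
Proof.
move=> [hh bh] h1; split; first exact: h1.
apply: bigO_le (bigOD bh (bigO_cst (ln 2))) _.
apply: ev_imp (ev_and (ev_ge 1) (ev_and (ev_goodr hh) (ev_goodr h1))) _ => r [r1 [g1 g2]].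
have r0 : 0 < r by exact: lt_le_trans r1.
rewrite (characteristicE hh r0) (characteristicE h1 r0) addrAC; apply: lerD.
  rewrite !proximityE -(rmean_cst (ln 2)) -rmeanD; [|exact: (lplus_cont r0 g1)|exact: rcont_cst].
  apply: rmean_le; first exact: (@lplus_cont R (fun z => h z - 1) r r0 g2).
    apply: rcontD; [exact: (lplus_cont r0 g1)|exact: rcont_cst].
  move=> t _; apply: le_trans (logplus_le (normc_ge0 _) (normcB_le _ _)) _.
  rewrite (normc1 R); apply: le_trans (logplusD (normc_ge0 _) ler01) _.
  by rewrite {2}/logplus ln1 maxxx addr0.
by apply: (ND_le r1 (lf_pm h1) (lf_pm hh)) => z; exact: (pm_sub1 z hh h1).
Qed.

Definition logder h z := derive1 h z / h z.

Lemma allord_logder h : allord h -> allord (derive1 h) -> allord (logder h).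
Proof. by move=> hh hd; exact: (allordM hd (allordV hh)). Qed.

(** The pointwise bound of [log_derivative] makes the proximity function at most ln K + 3 ln r + 6
    ln [Theta], and each of these is small against T(r, f). *)
Lemma small_logder h : mild h -> allord (derive1 h) ->
  small Tf (fun r => proximity r (logder h)).
Proof.
move=> [hh bh] hd; have [E [tE [K [K1 hK]]]] := log_derivative hh.
have hq := allord_logder hh hd.
have bT : bigO Tf (Theta h).
  have b1 := bigOD (bigOZ (ler0n R 2) bh) (bigO_cst (`|ln (normc (lead h))| + 1)).
  by apply: bigO_le b1 _; apply: ev_imp (ev_ge 0) _ => r _; rewrite /Theta addrA.
have eT : ev (fun r => 1 <= Theta h r).
  apply: ev_imp (ev_and (ev_ge 1) (ev_goodr hh)) _ => r [r1 g1].
  by have [] := Theta_bounds hh r1 g1.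
have ls := small_logarithm.
have s1 := small_ln ls bT eT.
have s2 := smallD (smallD (small_cst ls (ln K)) (smallZ ls (ler0n R 3) ls))
  (smallZ ls (ler0n R 6) s1).
apply: small_le s2 _.
have evE : ev (fun r => ~ E r) by exists E; split => //; exists 0.
apply: ev_imp (ev_and (ev_and (ev_ge 1) evE) (ev_and eT (ev_goodr hq))) _ => r [[r1 nE] [T1 gq]].
have r0 : 0 < r by exact: lt_le_trans r1.
have T0 : 0 < Theta h r by exact: lt_le_trans T1.
have [_ hb] := hK r r1 nE.
rewrite proximityE -[leRHS]rmean_cst; apply: rmean_le.
- exact: (@lplus_cont R (logder h) r r0 gq).
- exact: rcont_cst.
- move=> t _; have := hb (circ r t) (normc_circ0 t r0); rewrite -derive1E => hb1.
  apply: le_trans (logplus_le (normc_ge0 _) hb1) _.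
  have K0 : 0 < K by exact: lt_le_trans K1.
  have p0 : 0 < r * Theta h r ^+ 2 by rewrite mulr_gt0 // exprn_gt0.
  have p1 : 1 <= r * Theta h r ^+ 2.
    by rewrite -[1]mulr1; apply: ler_pM => //; rewrite exprn_ege1.
  have lK : 0 <= ln K by exact: ln_ge0.
  have l1 : 0 <= ln (r * Theta h r ^+ 2) by exact: ln_ge0.
  rewrite /logplus lnM ?posrE ?exprn_gt0 // lnXn // -[ln (r * _) *+ 3]mulr_natl.
  rewrite max_r ?addr_ge0 ?mulr_ge0 // -addrA lerD2l lnM ?posrE ?exprn_gt0 // lnXn //.
  rewrite -[ln (Theta h r) *+ 2]mulr_natl.
  by generalize (ln r) (ln (Theta h r)) => u v; clear -fm ft; lra.
Qed.

Lemma proximity_derive h r : allord h -> allord (derive1 h) -> 0 < r -> goodr h r ->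
  goodr (derive1 h) r -> proximity r (derive1 h) <= proximity r (logder h) + proximity r h.
Proof.
move=> hh hd r0 g1 g2; have gq : goodr (logder h) r by exact: (goodrM g2 (goodrV g1)).
rewrite (@proximity_ext R (derive1 h) (fun z => logder h z * h z) r r0).
  exact: (proximityM r0 gq g1).
by move=> z zr; rewrite /logder divfK //; case: (g1 z zr).
Qed.

Lemma mild_derive h : mild h -> allord (derive1 h) -> mild (derive1 h).
Proof.
move=> mh hd; have [hh bh] := mh; split; first exact: hd.
have b1 := bigOD (big_small (small_logder mh hd)) (bigOZ (ler0n R 2) bh).
apply: bigO_le b1 _.
apply: ev_imp (ev_and (ev_ge 1) (ev_and (ev_goodr hh) (ev_goodr hd))) _ => r [r1 [g1 g2]].
have r0 : 0 < r by exact: lt_le_trans r1.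
have := proximity_derive hh hd r0 g1 g2.
have := proximity_ge0 r0 g1.
have : ND (pm (derive1 h)) r <= 2 * ND (pm h) r.
  rewrite -(NDZ 2 r (lf_pm hh)); apply: (ND_le r1 (lf_pm hd) (lfZ 2 (lf_pm hh))) => z.
  exact: pm_derive.
rewrite (characteristicE hh r0) (characteristicE hd r0).
generalize (ND (pm (derive1 h)) r) (ND (pm h) r) (proximity r h) (proximity r (derive1 h))
  (proximity r (logder h)) => u v w x y; clear -fm ft; lra.
Qed.

Lemma mild_derive1n (j : nat) : mild (derive1n j f).
Proof.
elim: j => [|j IH]; first by rewrite derive1n0; exact: mild_f.
rewrite derive1nS; apply: mild_derive => //.
by have := allord_derive1n j.+1 fm ft; rewrite derive1nS.
Qed.

(** Telescoping: each further derivative multiplies the quotient by the logarithmic derivative of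
    the preceding one. *)
Lemma small_proximity_quot (j : nat) : small Tf (fun r => proximity r (fun z => derive1n j f z / f z)).
Proof.
have ls := small_logarithm; have hf := mild_f.1.
elim: j => [|j IH].
  apply: small_le (small_cst ls 0) _; apply: ev_imp (ev_and (ev_ge 1) (ev_goodr hf)) _ => r [r1 g].
  have r0 : 0 < r by exact: lt_le_trans r1.
  rewrite (@proximity_ext R _ (fun=> 1) r r0).
    by rewrite proximity_cst (normc1 R) /logplus ln1 maxxx.
  by move=> z zr; rewrite derive1n0 divff //; case: (g z zr).
have h0 := (mild_derive1n j).1; have h1 := (mild_derive1n j.+1).1.
rewrite derive1nS in h1; have s1 := small_logder (mild_derive1n j) h1.
apply: small_le (smallD s1 IH) _.
apply: ev_imp (ev_and (ev_and (ev_ge 1) (ev_goodr hf)) (ev_and (ev_goodr h0) (ev_goodr h1))) _.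
move=> r [[r1 g] [g0 g1]]; have r0 : 0 < r by exact: lt_le_trans r1.
rewrite (@proximity_ext R _ (fun z => logder (derive1n j f) z * (derive1n j f z / f z)) r r0).
  exact: (proximityM r0 (goodrM g1 (goodrV g0)) (goodrM g0 (goodrV g))).
move=> z zr; rewrite derive1nS /logder mulrA divfK //; case: (g0 z zr) => _; exact.
Qed.

End Mild.

(** * The main inequality *)

Section Divisor.
Variable R : realType.
Notation C := (R[i] : numFieldType).
Implicit Types (F G h g k : C -> C) (z w a c : C) (r s t e rho : R) (n m : int).

(* [n, al, be, g, d, e, ka] stand for the orders of f, a, phi, G, G', G - 1 and M - phi. *)
Lemma divisor_real (q0 gam l n al be g d e ka : R) : 0 < l ->
  (n < 0 -> l <= - n) -> (0 < n -> 1 <= n) ->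
  (0 <= n -> q0 * n + al - be <= g) ->
  (g < 0 -> g <= -1 /\ d = g - 1 /\ e = g) -> (0 < g -> 1 <= g /\ d = g - 1 /\ e = 0) ->
  (g = 0 -> 0 <= d /\ (e = 0 \/ 1 <= e /\ d = e - 1)) ->
  (be < 0 -> be <= -1) -> ka = be + e ->
  e - d + gam * Num.max n 0 <=
  Num.max ka 0 + (gam - q0 + 1) * Num.max n 0 + l^-1 * Num.max (- n) 0 +
  Num.max (- al) 0 + Num.max be 0 + Num.max (- be) 0.
Proof.
move=> l0 n1 n2 hM g1 g2 g3 b1 kaE.
(* (G - 1)/G' never has more than a simple zero. *)
have ed : e - d <= 1.
  have [/g1 [_ [-> ->]]|/g2 [h [-> ->]]|/g3 [h1 [->|[h2 ->]]]] := ltgtP g 0; lra.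
have ge_max0 (x : R) : x <= Num.max x 0 /\ 0 <= Num.max x 0 by rewrite !le_max !lexx orbT.
have [k1 k2] := ge_max0 ka; have [a1 a2] := ge_max0 (- al); have [b2 b3] := ge_max0 be.
have [b4 b5] := ge_max0 (- be).
(* At a pole of f this simple zero is paid for by the pole, whose multiplicity divided by l is at
   least 1. *)
have [n0|] := boolP (n < 0); last rewrite -leNgt => n0.
  rewrite [Num.max n 0]max_r ?(ltW n0) // [Num.max (- n) 0]max_l ?oppr_ge0 ?(ltW n0) //.
  have : 1 <= l^-1 * - n by rewrite mulrC ler_pdivlMr // mul1r; exact: n1.
  move: k2 a2 b3 b5 ed; rewrite !mulr0 !addr0.
  move: (Num.max ka 0) (Num.max (- al) 0) (Num.max be 0) (Num.max (- be) 0) (l^-1 * - n) => p q u v w.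
  by clear; lra.
rewrite [Num.max n 0]max_l // [Num.max (- n) 0]max_r ?oppr_le0 // mulr0 addr0.
have {hM} := hM n0; rewrite !mulrDl mulNr mul1r.
move: k1 k2 a1 a2 b2 b3 b4 b5 ed.
move: (Num.max ka 0) (Num.max (- al) 0) (Num.max be 0) (Num.max (- be) 0) (gam * n).
move=> mk ma mb mb' gn k1 k2 a1 a2 b2 b3 b4 b5 ed hM.
(* At a zero of f of order n, G has order at least q0 n, up to the small functions. If G vanishes,
   (G - 1)/G' has order 1 - g, which offsets all but gam - q0 + 1 of the gam n zeros; otherwise a
   pole of [a] or a zero of phi pays for the q0 n. *)
have [np|nn] := ltP 0 n.
  have {n2} := n2 np; have [/g1 [h [-> ->]]|/g2 [h [-> ->]]|g0] := ltgtP g 0.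
  - by move: hM h k2 a1 b2 b5; move: (q0 * n) => p; clear; lra.
  - by move: hM h k2 a1 b2 b5; move: (q0 * n) => p; clear; lra.
  - by move: hM k2 a1 b2 b5 ed; rewrite g0; move: (q0 * n) => p; clear; lra.
(* Elsewhere a zero of (G - 1)/G' is a pole of G, paid for by [a] or phi, or a zero of G - 1. The
   latter is a zero of M - phi unless phi has a pole there. *)
have n00 : n = 0 by apply/eqP; rewrite eq_le nn n0.
move: hM; rewrite n00 mulr0.
have [/g1 [h [-> ->]]|/g2 [h [-> ->]]|/g3 [h1 he]] := ltgtP g 0.
- by move: h k2 a1 b2 b5; clear; lra.
- by move: h k2 a2 b3 b5; clear; lra.
- case: he => [e0|[e1 dE]] _; first by move: e0 h1 k2 a2 b3 b5; clear; lra.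
  have [/b1 hb|hb] := ltP be 0.
    by move: dE hb k2 a2 b3 b4; clear; lra.
  by move: dE e1 hb k1 a2 b3 b5; rewrite kaE; clear; lra.
Qed.

Lemma ordR_ge1 h z : (0 < ordR h z -> 1 <= ordR h z) /\ (ordR h z < 0 -> ordR h z <= -1).
Proof.
rewrite /ordR; split; first by rewrite ltr0z ler1z gtz0_ge1.
by rewrite ltrz0 -(intrN R 1) ler_int -ltzD1 addNr.
Qed.

(** Poles survive the subtraction of 1 and zeros turn into the value -1. At order 0 the derivative
    is read off h - 1, which has the same derivative as h and may vanish. *)
Lemma ord_sub1 h z : allord h -> allord (fun w => h w - 1) -> allord (derive1 h) ->
  [/\ ordR h z < 0 -> ordR (derive1 h) z = ordR h z - 1 /\ ordR (fun w => h w - 1) z = ordR h z,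
      0 < ordR h z -> ordR (derive1 h) z = ordR h z - 1 /\ ordR (fun w => h w - 1) z = 0 &
      ordR h z = 0 -> 0 <= ordR (derive1 h) z /\ (ordR (fun w => h w - 1) z = 0 \/
        1 <= ordR (fun w => h w - 1) z /\ ordR (derive1 h) z = ordR (fun w => h w - 1) z - 1)].
Proof.
move=> hh h1 hd; have m1 : (-1 : C) != 0 by rewrite oppr_eq0 oner_neq0.
have dE : ord h z != 0 -> ordR (derive1 h) z = ordR h z - 1.
  by move=> h0; rewrite /ordR ord_derive // intrB.
split; rewrite /ordR.
- rewrite ltrz0 => h0; split; first by rewrite -[LHS]/(ordR _ _) dE // lt_eqF.
  by have /ord_eq -> := ho_D_lt (ordP z hh) (ho_cst z m1) h0.
- rewrite ltr0z => h0; split; first by rewrite -[LHS]/(ordR _ _) dE // gt_eqF.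
  have H := ho_D_lt (ho_cst z m1) (ordP z hh) h0.
  have E : punct (fun w => -1 + h w) (fun w => h w - 1) z by exists 1 => // w _ _; rewrite addrC.
  by have /ord_eq -> := ho_ext E H.
- move=> /eqP; rewrite intr_eq0 => /eqP h0.
  have hz : 0 <= ord h z by rewrite h0.
  split; first by rewrite ler0z; exact: ord_derive_ge0.
  have [g g1 g2] := ord_ge0_hol hh hz.
  have e0 := ord_ge0 h1 (holB g1 (hol_cst 1 z)) (punct1 (fun v => v - 1) g2).
  have [e1|e1] := eqVneq (ord (fun w => h w - 1) z) 0; first by left; rewrite e1.
  right; split; first by rewrite ler1z -gtz0_ge1 lt_neqAle eq_sym e1.
  by rewrite -(derive1_sub_cst h 1) ord_derive // intrB.
Qed.

End Divisor.

(** * Finite products and parts of the characteristic *)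

Section Products.
Variable R : realType.
Notation C := (R[i] : numFieldType).
Implicit Types (F G h g k : C -> C) (z w c : C) (r s t e rho : R).

Lemma goodr_prod (j : nat) (u : nat -> C -> C) r : (forall i, (i < j)%N -> goodr (u i) r) ->
  goodr (fun z => \prod_(0 <= i < j) u i z) r.
Proof.
elim: j => [|j IH] hu.
  rewrite (_ : (fun z => _) = (fun=> 1 : C)); first exact: goodr_cst (oner_neq0 C).
  by apply/funext => z; rewrite big_nil.
rewrite (_ : (fun z => _) = (fun z => (\prod_(0 <= i < j) u i z) * u j z)).
  exact: (goodrM (IH (fun i ij => hu i (ltnW ij))) (hu j (ltnSn j))).
by apply/funext => z; rewrite big_nat_recr.
Qed.

Lemma proximity_prod (j : nat) (u : nat -> C -> C) r : 0 < r ->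
  (forall i, (i < j)%N -> goodr (u i) r) ->
  proximity r (fun z => \prod_(0 <= i < j) u i z) <= \sum_(0 <= i < j) proximity r (u i).
Proof.
move=> r0; elim: j => [|j IH] hu.
  rewrite big_nil (_ : (fun z => _) = (fun=> 1 : C)).
    by rewrite proximity_cst (normc1 R) /logplus ln1 maxxx.
  by apply/funext => z; rewrite big_nil.
have hj i : (i < j)%N -> goodr (u i) r by move=> ij; apply: hu; exact: ltnW.
rewrite big_nat_recr //= (_ : (fun z => _) = (fun z => (\prod_(0 <= i < j) u i z) * u j z)).
  apply: le_trans (proximityM r0 (goodr_prod hj) (hu j (ltnSn j))) _.
  by rewrite lerD2r; exact: IH.
by apply/funext => z; rewrite big_nat_recr.
Qed.

Lemma characteristic_parts h r : allord h -> 1 <= r -> goodr h r ->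
  [/\ 0 <= proximity r h, 0 <= ND (pm h) r,
      proximity r h <= characteristic r h & ND (pm h) r <= characteristic r h].
Proof.
move=> hh r1 gh; have r0 : 0 < r by exact: lt_le_trans r1.
have p0 := proximity_ge0 r0 gh.
have n0 : 0 <= ND (pm h) r by apply: (ND_ge0 r1 (lf_pm hh)) => z; exact: pm_ge0.
by rewrite (characteristicE hh r0); split => //; [rewrite lerDl|rewrite lerDr].
Qed.

Lemma zm_ND h r : allord h -> ND (zm h) r = ND (pm (fun z => (h z)^-1)) r.
Proof.
move=> hh; have E : pm (fun z => (h z)^-1) = zm h by apply/funext => z; exact: (pm_V z hh).
by rewrite E.
Qed.

End Products.

(** * The differential monomial and its quotient by phi *)

Section Monomial.
Variable R : realType.
Notation C := (R[i] : numFieldType).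
Notation rcont := (continR 0 (2 * pi)).
Implicit Types (F h g : C -> C) (z w c : C) (r s t e rho : R).
Variables (f a phi : C -> C) (k : nat) (q : nat -> nat).
Hypotheses (fm : meromorphic f) (ft : transcendental f).
Hypotheses (ha : allord a) (sa : small (Tf f) (fun r => characteristic r a)).
Hypotheses (hp : allord phi) (sp : small (Tf f) (fun r => characteristic r phi)).

Let D (j : nat) : C -> C := derive1n j f.
Let M : C -> C := diff_monomial k q a f.
Let gam : nat := (\sum_(0 <= j < k.+1) q j)%N.
Let G (z : C) : C := M z * (phi z)^-1.
(** M / f^gam, arranged into the quotients of derivatives by f, whose proximity functions are
    small. *)
Let W (z : C) : C := a z * \prod_(0 <= j < k.+1) (D j z / f z) ^+ q j.

Let hf : allord f. Proof. exact: (mild_f fm ft).1. Qed.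
Let hD (j : nat) : allord (D j). Proof. exact: (mild_derive1n fm ft j).1. Qed.
Let ls : small (Tf f) (@ln R). Proof. exact: small_logarithm. Qed.

Lemma mild_M : mild f M.
Proof.
have ma : mild f a by split; [exact: ha|exact: big_small].
apply: (mildM ma); apply: (@mild_prod R f fm ft k.+1 (fun j z => D j z ^+ q j)) => j _.
exact: (mildX fm ft (q j) (mild_derive1n fm ft j)).
Qed.

Lemma mild_G : mild f G.
Proof.
have mp : mild f phi by split; [exact: hp|exact: big_small].
exact: (mildM mild_M (mildV fm ft mp)).
Qed.

Definition good_radius r := [/\ 1 <= r, goodr f r, goodr a r, goodr phi r &
  forall i, (i < k.+1)%N -> goodr (D i) r].

Lemma ev_good_radius : ev good_radius.
Proof.
have h1 := @ev_all R k.+1 (fun i => goodr (D i)) (fun i _ => ev_goodr (hD i)).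
apply: ev_imp (ev_and (ev_and (ev_ge 1) (ev_goodr hf))
  (ev_and (ev_and (ev_goodr ha) (ev_goodr hp)) h1)) _.
by move=> r [[r1 g1] [[g2 g3] g4]]; split.
Qed.

Lemma good_radiusM r : good_radius r -> goodr M r /\ goodr G r /\ goodr W r.
Proof.
move=> [r1 gf ga gp gD].
have gM : goodr M r.
  apply: (goodrM ga); apply: (@goodr_prod R k.+1 (fun j z => D j z ^+ q j)) => j jk.
  exact: (goodrX (q j) (gD j jk)).
split; first exact: gM; split; first exact: (goodrM gM (goodrV gp)).
apply: (goodrM ga); apply: (@goodr_prod R k.+1 (fun j z => (D j z / f z) ^+ q j)) => j jk.
exact: (goodrX (q j) (goodrM (gD j jk) (goodrV gf))).
Qed.

Lemma small_W : small (Tf f) (fun r => proximity r W).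
Proof.
have s1 := @small_sum R (Tf f) ls k.+1
  (fun j r => (q j)%:R * proximity r (fun z => D j z / f z)) (fun j _ =>
   smallZ ls (ler0n R (q j)) (small_proximity_quot fm ft j)).
apply: small_le (smallD sa s1) _; apply: ev_imp ev_good_radius _ => r gr.
have [r1 gf ga gp gD] := gr; have r0 : 0 < r by exact: lt_le_trans r1.
have gq j : (j < k.+1)%N -> goodr (fun z => (D j z / f z) ^+ q j) r.
  by move=> jk; exact: (goodrX (q j) (goodrM (gD j jk) (goodrV gf))).
have gP := @goodr_prod R k.+1 (fun j z => (D j z / f z) ^+ q j) r gq.
apply: le_trans (proximityM r0 ga gP) _; apply: lerD.
  by have [] := characteristic_parts ha r1 ga.
apply: le_trans (@proximity_prod R k.+1 (fun j z => (D j z / f z) ^+ q j) r r0 gq) _.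
rewrite big_nat [leRHS]big_nat; apply: ler_sum => j /andP[_ jk].
by rewrite (proximityX (q j) r0 (goodrM (gD j jk) (goodrV gf))).
Qed.

Lemma W_E z : W z = M z / f z ^+ gam.
Proof.
rewrite /W /M /diff_monomial /gam -mulrA; congr (_ * _).
rewrite expr_sum -prodf_div; apply: eq_bigr => j _.
by rewrite expr_div_n.
Qed.

Lemma proximity_fV r : good_radius r -> gam%:R * proximity r (fun z => (f z)^-1) <=
  proximity r W + (proximity r (fun z => (phi z)^-1) + proximity r (fun z => (G z)^-1)).
Proof.
move=> gr; have [gM [gG gW]] := good_radiusM gr; have [r1 gf ga gp gD] := gr.
have r0 : 0 < r by exact: lt_le_trans r1.
rewrite -(proximityX gam r0 (goodrV gf)).
rewrite (@proximity_ext R _ (fun z => W z * ((phi z)^-1 * (G z)^-1)) r r0).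
  apply: le_trans (proximityM r0 gW (goodrM (goodrV gp) (goodrV gG))) _.
  by rewrite lerD2l; exact: (proximityM r0 (goodrV gp) (goodrV gG)).
move=> z zr; rewrite W_E /G; have [_ f0] := gf z zr; have [_ p0] := gp z zr.
have [_ m0] := gM z zr; rewrite exprVn; have y0 : f z ^+ gam != 0 by rewrite expf_neq0.
move: (f z ^+ gam) (M z) (phi z) y0 m0 p0 => y m p y0 m0 p0.
by field; rewrite y0 m0 p0.
Qed.

Lemma ordR_M_ge z : 0 <= ord f z -> ordR a z + (q 0%N)%:R * ordR f z <= ordR M z.
Proof.
move=> h0; have hDj j : 0 <= ord (D j) z.
  elim: j => [|j IH]; first by rewrite /D derive1n0.
  have h1 := hD j.+1; rewrite /D derive1nS in h1 *.
  exact: (ord_derive_ge0 (hD j) h1 IH).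
have H := ho_M (ordP z ha) (@ho_prod R nat (index_iota 0 k.+1) (fun j w => D j w ^+ q j)
  (fun j => ord (D j) z *+ q j) z (fun j _ => ho_X (q j) (ordP z (hD j)))).
rewrite /ordR (ord_eq H) intrD lerD2l big_ltn // intrD.
have -> : (q 0%N)%:R * (ord f z)%:~R = (ord (D 0) z *+ q 0%N)%:~R :> R.
  by rewrite /D derive1n0 rmorphMn /= mulr_natl.
by rewrite lerDl ler0z; apply: sumr_ge0 => j _; rewrite mulrn_wge0.
Qed.

Lemma ordR_G z : ordR G z = ordR M z - ordR phi z.
Proof. by rewrite /G (ordRM z mild_M.1 (allordV hp)) (ordRV z hp). Qed.

Lemma small_phiV : small (Tf f) (fun r => characteristic r (fun z => (phi z)^-1)).
Proof.
apply: small_le (smallD sp (small_cst ls (- ln (normc (lead phi))))) _.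
apply: ev_imp (ev_and (ev_ge 1) (ev_goodr hp)) _ => r [r1 g1].
by rewrite (characteristicV hp r1 g1).
Qed.

Lemma small_part h (s : R -> R) : allord h -> small (Tf f) (fun r => characteristic r h) ->
  ev (fun r => s r = proximity r h \/ s r = ND (pm h) r) -> small (Tf f) s.
Proof.
move=> hh sh hs; apply: small_le sh _.
apply: ev_imp (ev_and (ev_and (ev_ge 1) (ev_goodr hh)) hs) _ => r [[r1 g1] h1].
by have [_ _ h2 h3] := characteristic_parts hh r1 g1; case: h1 => ->.
Qed.

Let evT (P : R -> Prop) : (forall r, P r) -> ev P.
Proof. by move=> hP; apply: ev_imp (ev_ge 0) _ => r _; exact: hP. Qed.

Lemma small_parts : [/\ small (Tf f) (ND (pm a)), small (Tf f) (ND (pm phi)),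
  small (Tf f) (ND (zm phi)) & small (Tf f) (fun r => proximity r (fun z => (phi z)^-1))].
Proof.
split.
- by apply: (small_part ha sa); apply: evT => r; right.
- by apply: (small_part hp sp); apply: evT => r; right.
- by apply: (small_part (allordV hp) small_phiV); apply: evT => r; right; exact: (zm_ND r hp).
- by apply: (small_part (allordV hp) small_phiV); apply: evT => r; left.
Qed.

Hypothesis q0_gt0 : (0 < q 0%N)%N.

Lemma gam_ge : (q 0%N)%:R <= gam%:R :> R.
Proof. by rewrite ler_nat /gam big_ltn // leq_addr. Qed.

(* If M were a constant multiple of phi, the zeros of f and its proximity to 0 would both
   be controlled by a and phi, contradicting the first main theorem. *)
Lemma G_not_constant c : ~ (forall z, null (fun w => G w - c) z).
Proof.
move=> hc; have [hG _] := mild_G.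
have c0 : c != 0.
  apply/eqP => c0; have [n hn] := hG 0; apply: (null_not_ho _ hn).
  by apply: punct_trans (hc 0); exists 1 => // w _ _; rewrite c0 subr0.
have oG z : ordR G z = 0.
  rewrite /ordR; apply/eqP; rewrite intr_eq0; apply/eqP; apply: ord_eq.
  apply: ho_ext (ho_cst z c0); apply: punct_sym; have [e e0 he] := hc z.
  by exists e => // w wz we; have /eqP := he w wz we; rewrite subr_eq0 => /eqP.
(* A constant G has order 0, so the zeros which f contributes to M through [q 0 >= 1] must be
   compensated by poles of [a] or zeros of phi. *)
have zle z : zm f z <= pm a z + zm phi z.
  rewrite (zm_ord z hf) (pm_ord z ha) (zm_ord z hp) ge_max; apply/andP; split; last first.
    by apply: addr_ge0; rewrite le_max lexx orbT.
  have [h0|h0] := ltP (ord f z) 0.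
    apply: (@le_trans _ _ 0); first by rewrite lerz0 ltW.
    by apply: addr_ge0; rewrite le_max lexx orbT.
  have := ordR_M_ge h0; have := ordR_G z; rewrite oG => h1.
  have : 1 * ordR f z <= (q 0%N)%:R * ordR f z.
    by apply: ler_wpM2r; [rewrite ler0z|rewrite ler1n].
  have : - ordR a z <= Num.max (- ordR a z) 0 by rewrite le_max lexx.
  have : ordR phi z <= Num.max (ordR phi z) 0 by rewrite le_max lexx.
  move: h1; generalize (Num.max (- ordR a z) 0) (Num.max (ordR phi z) 0) (ordR a z) (ordR phi z)
    (ordR f z) (ordR M z) ((q 0%N)%:R * ordR f z) => p u x y n m w.
  by lra.
have [s1 s2 s3 s4] := small_parts.
have cf := small_cst ls (ln (normc (lead f))).
have cc := small_cst ls (logplus (normc c^-1)).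
have S1 := smallD (smallD (smallD small_W s4) cc) (smallD (smallD s1 s3) cf).
(* All terms bounding T(r, f) = m(r, 1/f) + N(r, 1/f) + ln |lead f| are small, so at one suitable
   radius T <= T/2, absurd once T >= 1. *)
have e1 := small_ev (e := 2^-1) S1 ltac:(by []).
have [r [[h1 gr] T1]] := ev_exists (ev_and (ev_and e1 ev_good_radius) (T_ge ls 1)).
have [r1 gf ga gp gD] := gr; have r0 : 0 < r by exact: lt_le_trans r1.
have [gM [gG gW]] := good_radiusM gr.
have F := first_main hf r0 gf; rewrite -proximityV in F.
have H1 := proximity_fV gr.
have EG : proximity r (fun z => (G z)^-1) = logplus (normc c^-1).
  rewrite -(proximity_cst c^-1 r); apply: (proximity_ext r0) => z zr; congr (_^-1).
  have [hGz _] := gG z zr.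
  by have := null_val (holB hGz (hol_cst c z)) (hc z); move/eqP; rewrite subr_eq0 => /eqP.
rewrite EG in H1.
have p0 := proximity_ge0 r0 (goodrV gf).
have g1 : 1 <= gam%:R :> R by apply: le_trans gam_ge; rewrite ler1n.
have H2 := ler_wpM2r p0 g1; rewrite mul1r in H2.
have H3 : ND (zm f) r <= ND (pm a) r + ND (zm phi) r.
  rewrite -(NDD r (lf_pm ha) (lf_zm hp)).
  by apply: (ND_le r1 (lf_zm hf) (lfD (lf_pm ha) (lf_zm hp))).
move: h1 F H1 H2 H3 T1; rewrite /Tf /=.
generalize (proximity r W) (proximity r (fun z => (phi z)^-1)) (logplus (normc c^-1))
  (ND (pm a) r) (ND (zm phi) r) (ln (normc (lead f))) (ND (zm f) r) (characteristic r f)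
  (proximity r (fun z => (f z)^-1)) => x1 x2 x3 x4 x5 x6 x7 x8 x9.
by generalize (gam%:R * x9) => x10; lra.
Qed.

Lemma G_nonconstant : allord (derive1 G) /\ allord (fun z => G z - 1).
Proof.
have [hG _] := mild_G; have mG : mero G by move=> z; exact: ho_germ (ordP z hG).
split.
  have mG' : mero (derive1 G) by move=> z; exact: germ_derive.
  have [h0|//] := mero_dichotomy mG'; exfalso.
  have [c hc] := null_derive_cst mG (h0 0).
  exact: (G_not_constant hc).
have [h0|//] := mero_dichotomy (@meroB_cst R G 1 mG); exfalso.
exact: (G_not_constant h0).
Qed.

Variable l : nat.
Hypothesis l_gt0 : (0 < l)%N.
Hypothesis f_poles : forall z, (0 < pole_mult f z)%N -> (l <= pole_mult f z)%N.

Let Q (z : C) : C := M z - phi z.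
Let K (z : C) : C := (G z - 1) * (derive1 G z)^-1.

(** M - phi is phi (G - 1), but only off the zeros and singularities of phi; hence the punctured
    neighbourhood. *)
Lemma has_order_Q z : has_order Q z (ord phi z + ord (fun w => G w - 1) z).
Proof.
have [_ h1] := G_nonconstant; apply: ho_ext (ho_M (ordP z hp) (ordP z h1)).
have [e e0 he] := ho_near (ordP z hp); exists e => // w wz we.
have [_ p0] := he w wz we; rewrite /G /Q; move: (M w) (phi w) p0 => m p p0.
by field.
Qed.

Lemma allord_Q : allord Q.
Proof. by move=> z; eexists; exact: has_order_Q. Qed.

Lemma pole_order z : ordR f z < 0 -> l%:R <= - ordR f z.
Proof.
move=> h0; have E := pm_ord z hf; rewrite max_l in E; last by rewrite oppr_ge0 ltW.
rewrite -E /pm ler_nat; apply: f_poles.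
have p : 0 < pm f z by rewrite E oppr_gt0.
by move: p; rewrite /pm ltr0n.
Qed.

Lemma divisor_le z : ordR K z + gam%:R * zm f z <=
  zm Q z + (gam%:R - (q 0%N)%:R + 1) * zm f z + l%:R^-1 * pm f z + pm a z + zm phi z + pm phi z.
Proof.
have [hd h1] := G_nonconstant; have [hG _] := mild_G.
rewrite (zm_ord z hf) (zm_ord z allord_Q) (pm_ord z hf) (pm_ord z ha) (zm_ord z hp) (pm_ord z hp).
rewrite /K (ordRM z h1 (allordV hd)) (ordRV z hd).
have [s1 s2 s3] := ord_sub1 z hG h1 hd.
apply: (@divisor_real _ _ _ _ (ordR f z) _ _ (ordR G z)).
- by rewrite ltr0n.
- exact: pole_order.
- exact: (ordR_ge1 f z).1.
- by rewrite ler0z => h0; rewrite ordR_G lerD2r addrC; exact: ordR_M_ge.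
- by move=> h; split; [exact: (ordR_ge1 G z).2|exact: s1].
- by move=> h; split; [exact: (ordR_ge1 G z).1|exact: s2].
- exact: s3.
- exact: (ordR_ge1 phi z).2.
- by rewrite /ordR (ord_eq (has_order_Q z)) intrD.
Qed.

Lemma ND_divisor r : 1 <= r -> ND (ordR K) r + gam%:R * ND (zm f) r <=
  ND (zm Q) r + (gam%:R - (q 0%N)%:R + 1) * ND (zm f) r + l%:R^-1 * ND (pm f) r +
  ND (pm a) r + ND (zm phi) r + ND (pm phi) r.
Proof.
move=> r1; have [hd h1] := G_nonconstant.
have lK := lf_ord (allordM h1 (allordV hd)).
have lz := lf_zm hf; have lp := lf_pm hf; have lQ := lf_zm allord_Q.
have la := lf_pm ha; have lzp := lf_zm hp; have lpp := lf_pm hp.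
pose x := gam%:R - (q 0%N)%:R + 1 : R.
have l1 := lfD lQ (lfZ x lz); have l2 := lfD l1 (lfZ l%:R^-1 lp).
have l3 := lfD l2 la; have l4 := lfD l3 lzp.
rewrite -(NDZ gam%:R r lz) -(NDD r lK (lfZ gam%:R lz)) -/x.
rewrite -(NDZ x r lz) -(NDZ l%:R^-1 r lp) -(NDD r lQ (lfZ x lz)) -(NDD r l1 (lfZ l%:R^-1 lp)).
rewrite -(NDD r l2 la) -(NDD r l3 lzp) -(NDD r l4 lpp).
apply: (ND_le r1 (lfD lK (lfZ gam%:R lz)) (lfD l4 lpp)) => z; exact: divisor_le.
Qed.

Lemma proximity_GV r : goodr G r -> goodr (derive1 G) r -> goodr (fun z => G z - 1) r -> 0 < r ->
  proximity r (fun z => (G z)^-1) <= proximity r (logder G) + proximity r K + ln 2.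
Proof.
move=> gG gd g1 r0; have gl : goodr (logder G) r by exact: (goodrM gd (goodrV gG)).
have gK : goodr K r by exact: (goodrM g1 (goodrV gd)).
have gGV := goodrV gG.
rewrite !proximityE -(rmean_cst (ln 2)) -(rmeanD (lplus_cont r0 gl) (lplus_cont r0 gK)).
rewrite -rmeanD; [|exact: rcontD (lplus_cont r0 gl) (lplus_cont r0 gK)|exact: rcont_cst].
apply: rmean_le.
- exact: (@lplus_cont R (fun z => (G z)^-1) r r0 gGV).
- apply: rcontD; last exact: rcont_cst.
  exact: rcontD (lplus_cont r0 gl) (lplus_cont r0 gK).
move=> t _; have nc := normc_circ0 t r0.
have [_ G0] := gG _ nc; have [_ d0] := gd _ nc.
have -> : (G (circ r t))^-1 = 1 - logder G (circ r t) * K (circ r t).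
  rewrite /logder /K; move: (G (circ r t)) (derive1 G (circ r t)) G0 d0 => x y x0 y0.
  by field; rewrite x0 y0.
apply: le_trans (logplus_le (normc_ge0 _) (normcB_le _ _)) _.
rewrite (normc1 R); apply: le_trans (logplusD ler01 (normc_ge0 _)) _.
rewrite {1}/logplus ln1 maxxx add0r normcM lerD2r.
by apply: logplusM; exact: normc_ge0.
Qed.

Lemma proximity_K r : 0 < r -> goodr (derive1 G) r -> goodr (fun z => G z - 1) r ->
  proximity r K = proximity r (logder (fun z => G z - 1)) + ln (normc (lead K)) + ND (ordR K) r.
Proof.
move=> r0 gd g1; have [hd h1] := G_nonconstant.
have gK : goodr K r by exact: (goodrM g1 (goodrV gd)).
have hK := allordM h1 (allordV hd).
have [E _] := mean_lplus_lminus r0 gK; have J := jensen hK r0 gK.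
rewrite J -proximityV in E.
have -> : proximity r (logder (fun z => G z - 1)) = proximity r (fun z => (K z)^-1).
  apply: (proximity_ext r0) => z _; rewrite /logder derive1_sub_cst /K.
  by rewrite invfM invrK mulrC.
by rewrite -addrA -E addrC subrK.
Qed.

(* The factor in front of T(r, f) is what is left of gam T(r, f) after the zeros of f, the
   distinct zeros and the distinct poles of f have been paid for. *)
Lemma second_main : small (Tf f) (fun r =>
  ((q 0%N)%:R - 1 - l%:R^-1) * characteristic r f - ND (zm Q) r).
Proof.
have [hd h1] := G_nonconstant; have mG := mild_G; have m1 := mild_sub1 fm ft mG h1.
have hd1 : allord (derive1 (fun z => G z - 1)) by rewrite derive1_sub_cst.
have sl := small_logder fm ft mG hd.
have sl1 : small (Tf f) (fun r => proximity r (logder (fun z => G z - 1))).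
  exact: (small_logder fm ft m1 hd1).
have [s1 s2 s3 s4] := small_parts.
pose cK := ln (normc (lead K)); pose cf := ln (normc (lead f)).
have S1 := smallD (smallD small_W s4) (smallD (smallD sl sl1) (small_cst ls (cK + ln 2))).
(* The first main theorem for f enters with factor gam, and with gam - q0 + 1 in the bound for N(r,
   1/f); the two multiples of [cf] differ by q0 - 1. *)
have S2 := smallD (smallD s1 s2) (smallD s3 (small_cst ls (((q 0%N)%:R - 1) * cf))).
apply: small_le (smallD S1 S2) _.
apply: ev_imp (ev_and ev_good_radius (ev_and (ev_goodr hd) (ev_goodr h1))) _ => r [gr [gd g1]].
have [r1 gf ga gp gD] := gr; have r0 : 0 < r by exact: lt_le_trans r1.
have [gM [gG gW]] := good_radiusM gr.
have F := first_main hf r0 gf; rewrite -proximityV -/cf in F.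
have H1 := proximity_fV gr.
have H2 := proximity_GV gG gd g1 r0.
have H3 := proximity_K r0 gd g1; rewrite -/cK in H3.
have H4 := ND_divisor r1.
have p0 := proximity_ge0 r0 (goodrV gf).
have [_ _ _ H5] := characteristic_parts hf r1 gf.
have l0 : 0 <= l%:R^-1 :> R by rewrite invr_ge0 ler0n.
have {}H5 := ler_wpM2l l0 H5.
have x0 : 0 <= gam%:R - (q 0%N)%:R + 1 :> R by rewrite addr_ge0 // subr_ge0 gam_ge.
have H6 : ND (zm f) r <= characteristic r f - cf by rewrite -F lerDr.
have {}H6 := ler_wpM2l x0 H6.
move=> {x0 l0 p0}; cbv beta.
(* The products with gam are expanded, so that the rest is linear arithmetic in the generalised
   terms. *)
have F' : gam%:R * proximity r (fun z => (f z)^-1) + gam%:R * ND (zm f) r =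
  gam%:R * characteristic r f - gam%:R * cf by rewrite -mulrDr F mulrBr.
move: F' H1 H2 H3 H4 H5 H6 {F s1 s2 s3 s4 S1 S2 sl sl1}.
generalize (proximity r W) (proximity r (fun z => (phi z)^-1)) (proximity r (fun z => (G z)^-1)).
generalize (ND (pm a) r) (ND (zm phi) r) (ND (pm phi) r) (ND (zm f) r) (ND (pm f) r)
  (ND (zm Q) r) (ND (ordR K) r) (characteristic r f) (proximity r (fun z => (f z)^-1)).
generalize (proximity r (logder G)) (proximity r K) (proximity r (logder (fun z => G z - 1))).
move: cK cf => cK cf x1 x2 x3 y1 y2 y3 y4 y5 y6 y7 T m w1 w2 w3.
move=> F' H1 H2 H3 H4 H5 H6.
by lra.
Qed.

End Monomial.

(** * Passing between [small] and the error terms S(r, f) *)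

Section Conversion.
Variable R : realType.
Notation C := (R[i] : numFieldType).
Implicit Types (r s t e : R).

Lemma small_is_S (f b : C -> C) : allord f -> is_S f (fun r => characteristic r b) ->
  small (Tf f) (fun r => characteristic r b).
Proof.
move=> hf [E [mE _ fE hE]]; exists (E `|` [set r | ~ goodr f r]); split.
  by apply: thinU; [exists E; split|exact: thin_bad].
(* The neighbourhood of infinity is the open half-line beyond x, whence [x + 1]; on good circles of
   radius at least 1 the characteristic of f is nonnegative, which removes its absolute value. *)
move=> e e0; have [x [_ hx]] := hE e e0; exists (Num.max 1 (x + 1)) => r.
rewrite ge_max => /andP[r1 xr] nE.
have gf : goodr f r by apply: contrapT => h; apply: nE; right.
apply: le_trans (ler_norm _) _; rewrite /Tf -[X in e * X]ger0_norm.
  apply: hx => [|h]; last by apply: nE; left.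
  by apply: lt_le_trans xr; rewrite ltrDl.
exact: characteristic_ge0.
Qed.

Lemma is_S_small (f : C -> C) (s : R -> R) : (forall r, 0 <= s r) ->
  (ev (fun r => 0 <= Tf f r)) -> small (Tf f) s -> is_S f s.
Proof.
move=> s0 [E0 [[F0 [m0 f0 sF0]] [x0 h0]]] [E [[F [mF fF sF]] hE]].
(* The measurable hulls replace the thin sets, and the cut at 0 yields a set of positive reals as
   [is_S] demands. *)
exists ((F0 `|` F) `&` [set` `]0, +oo[]); split.
- by apply: measurableI; [exact: measurableU|exact: measurable_itv].
- by move=> r [_]; rewrite /= in_itv /= andbT.
- have mU : measurable (F0 `|` F) by exact: measurableU.
  have mI : measurable ((F0 `|` F) `&` [set` `]0, +oo[]).
    by apply: measurableI => //; exact: measurable_itv.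
  have l1 := le_measure lebesgue_measure (mem_set mI) (mem_set mU) (@subIsetl _ _ _).
  apply: le_lt_trans l1 _; apply: le_lt_trans (measureU2 lebesgue_measure m0 mF) _.
  exact: lte_add_pinfty.
move=> e e0; have [x hx] := hE e e0; exists (Num.max 0 (Num.max x0 x)); split; first exact: num_real.
move=> r; rewrite !gt_max => /and3P[r0 xr0 xr] nF.
have nF' : ~ (F0 `|` F) r by move=> h; apply: nF; split => //; rewrite /= in_itv /= r0.
rewrite ger0_norm // ger0_norm; last by apply: h0; [exact: ltW|move=> h; apply: nF'; left; exact: sF0].
by apply: hx; [exact: ltW|move=> h; apply: nF'; right; exact: sF].
Qed.

End Conversion.

Theorem theorem2p3 (R : realType) (f phi a : R[i] -> R[i])
    (l k : nat) (q : nat -> nat)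
    (f_mero : meromorphic f) (f_trans : transcendental f)
    (phi_small : small_function f phi)
    (l_ge1 : (1 <= l)%N)
    (f_poles : forall z : R[i], (0 < pole_mult f z)%N -> (l <= pole_mult f z)%N)
    (k_ge1 : (1 <= k)%N)
    (q0_ge : 1 + 2 / l%:R <= (q 0%N)%:R :> R)
    (qk_ge1 : (1 <= q k)%N)
    (a_small : small_function f a) :
  exists S : R -> R, is_S f S /\
    forall r : R, 0 < r ->
      characteristic r f <=
        l%:R / (l%:R * (q 0%N)%:R - l%:R - 1) *
          counting_zeros r (fun z => diff_monomial k q a f z - phi z) + S r.
Proof.
pose co : R := l%:R / (l%:R * (q 0%N)%:R - l%:R - 1).
pose N r := counting_zeros r (fun z => diff_monomial k q a f z - phi z).
have [phi_m phi0 phiS] := phi_small; have [a_m a0 aS] := a_small.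
have hf : allord f := (mild_f f_mero f_trans).1.
have ha := allord_meromorphic a_m a0; have hp := allord_meromorphic phi_m phi0.
have sa := small_is_S hf aS; have sp := small_is_S hf phiS.
have l0 : 0 < l%:R :> R by rewrite ltr0n.
have q0_gt0 : (0 < q 0%N)%N.
  rewrite -(ltr0n R); apply: lt_le_trans q0_ge.
  by rewrite addr_gt0 // divr_gt0.
have H := @second_main R f a phi k q f_mero f_trans ha sa hp sp q0_gt0 l l_ge1 f_poles.
have hQ := @allord_Q R f a phi k q f_mero f_trans ha sa hp sp q0_gt0.
pose d : R := (q 0%N)%:R - 1 - l%:R^-1.
(* The bound on [q 0] leaves at least 2/l - 1/l = 1/l. *)
have d0 : 0 < d.
  have : 0 < l%:R^-1 :> R by rewrite invr_gt0.
  by move: q0_ge; rewrite /d; move: (l%:R^-1) ((q 0%N)%:R) => x y; clear; lra.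
have coE : co = d^-1.
  have dE : l%:R * (q 0%N)%:R - l%:R - 1 = l%:R * d :> R.
    by rewrite /d !mulrBr mulr1 divff // gt_eqF.
  by rewrite /co dE invfM mulrA divff ?mul1r // gt_eqF.
have ls := small_logarithm f_mero f_trans.
(* With the positive part of the defect the inequality holds at every radius by construction, and
   since this S is nonnegative [is_S] asks only for an upper bound. *)
exists (fun r => Num.max 0 (characteristic r f - co * N r)); split; last first.
  by move=> r r0; rewrite -lerBlDl le_max lexx orbT.
apply: is_S_small; first by move=> r; rewrite le_max lexx.
  exact: (T_ge ls 0).
have co0 : 0 <= co by rewrite coE invr_ge0 ltW.
have s1 := smallZ ls co0 H; have [E [tE hE]] := s1.
(* The branch 0 of the maximum is below [e * T] only where T is nonnegative, which is guaranteed off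
   a thin set. *)
have [E2 [tE2 [x2 h2]]] := T_ge ls 0.
exists (E `|` E2); split; first exact: thinU.
move=> e e0; have [x hx] := hE e e0; exists (Num.max (Num.max x x2) 1) => r.
rewrite !ge_max => /andP[/andP[xr x2r] r1] nE; have r0 : 0 < r by exact: lt_le_trans r1.
have T0 : 0 <= Tf f r by apply: h2 => // h; apply: nE; right.
apply/andP; split; first by apply: mulr_ge0 => //; exact: ltW.
apply: le_trans (hx r xr (fun h => nE (or_introl h))).
rewrite /N (counting_zerosE hQ r0) mulrBr coE mulrA.
by rewrite mulVf ?mul1r // gt_eqF.
Qed.
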